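(* Let $K\subset\mathbb{R}^n$ ($n\ge 2$) be a compact set. The Choquet boundary of $K$ with respect to $S(K)$ is the fine boundary of $K$, i.e. $$Ch_{S(K)}K=\partial_f K.$$
   Context: The fine topology on $\mathbb{R}^n$ is the coarsest topology making all subharmonic functions continuous as functions into $[-\infty,\infty]$. $\partial_f K$ is the boundary of $K$ in the fine topology. $S(K)$ is the uniform closure in $C(K)$ of the set of functions in $C(K)$ that are restrictions to $K$ of functions subharmonic on a neighborhood of $K$. Jensen measures: for an open set $U$ and $z\in U$, $\mathcal{J}_z(U)$ is the set of Radon probability measures $\mu$ with support compactly contained in $U$ such that $f(z)\le\int f\,d\mu$ for every subharmonic function $f$ on $U$. For $z\in K$, $\mathcal{J}_z(K)=\bigcap_{U\supset K}\mathcal{J}_z(U)$ over all open $U\supset K$. (These are precisely the probability measures $\mu$ on $K$ with $f(z)\le\int f\,d\mu$ for all $f\in S(K)$.) The Choquet boundary of $K$ with respect to $S(K)$ is $Ch_{S(K)}K=\{z\in K:\mathcal{J}_z(K)=\{\delta_z\}\}$, where $\delta_z$ is the Dirac measure at $z$. *)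

(* Defs.v *)
From mathcomp Require Export all_boot all_order all_algebra.
From mathcomp Require Export all_classical all_reals all_analysis.
From mathcomp Require Export lebesgue_integral_theory.giry.
Export Order.TTheory GRing.Theory Num.Theory.
Export numFieldNormedType.Exports.

Set Implicit Arguments.
Unset Strict Implicit.
Unset Printing Implicit Defensive.

Local Open Scope classical_set_scope.
Local Open Scope ring_scope.

(* The space R^n is 'rV[R]_n. Its library topology is induced by the sup norm
   and hence is the Euclidean one. Functions on a subset of R^n are represented
   by functions on R^n whose values off that subset are irrelevant. *)

Section Subharmonic.
Context {R : realType} {n : nat}.
Local Notation Rn := 'rV[R]_n.

Definition partial (i : 'I_n) (h : Rn -> R) : Rn -> R :=
  'D_(delta_mx 0 i) h.

(* In [C1_on], [C2_on] and [harmonic_on], U is meant to be open. *)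
Definition C1_on (U : set Rn) (h : Rn -> R) : Prop :=
  forall x, U x -> forall i : 'I_n,
    derivable h x (delta_mx 0 i) /\ {for x, continuous (partial i h)}.

Definition C2_on (U : set Rn) (h : Rn -> R) : Prop :=
  C1_on U h /\ forall i : 'I_n, C1_on U (partial i h).

Definition laplacian (h : Rn -> R) (x : Rn) : R :=
  \sum_(i < n) partial i (partial i h) x.

Definition harmonic_on (U : set Rn) (h : Rn -> R) : Prop :=
  C2_on U h /\ forall x, U x -> laplacian h x = 0.

Definition usc_on (U : set Rn) (u : Rn -> \bar R) : Prop :=
  forall x, U x -> forall a : R, (u x < a%:E)%E ->
    \forall y \near x, (u y < a%:E)%E.

(* Subharmonicity on an open set U, by harmonic majorization (Hoermander,
   Notions of Convexity, Definition 3.2.2). The value -oo is allowed, as is the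
   constant function -oo. A compact C is closed, so C `\` C° is its boundary. *)
Definition subharmonic (U : set Rn) (u : Rn -> \bar R) : Prop :=
  [/\ forall x, U x -> (u x < +oo)%E,
      usc_on U u &
      forall (C : set Rn) (h : Rn -> R),
        compact C -> C `<=` U ->
        {within C, continuous h} -> harmonic_on C° h ->
        (forall x, (C `\` C°) x -> (u x <= (h x)%:E)%E) ->
        forall x, C x -> (u x <= (h x)%:E)%E].

End Subharmonic.

Section FineTopology.
Context (R : realType) (n : nat).
Local Notation Rn := 'rV[R]_n.

(* R^n with the supremum, over all functions u subharmonic on R^n, of the
   initial topologies of u : R^n -> [-oo, +oo]. *)
Definition fine_space : topologicalType :=
  @sup_topology Rn {u : Rn -> \bar R | subharmonic setT u}
    (fun u => Topological.class (initial_topology (proj1_sig u))).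

Definition fine_boundary (K : set Rn) : set Rn :=
  closure (K : set fine_space) `\` interior (K : set fine_space).

End FineTopology.

Section Jensen.
Context {R : realType} {n : nat}.
Local Notation Rn := 'rV[R]_n.

Definition borel_space := g_sigma_algebraType (@open Rn).

(* Every Borel probability measure on R^n is a Radon measure. *)
Definition borel_probability := probability borel_space R.

Definition measure_support (mu : borel_probability) : set Rn :=
  [set x | forall V : set Rn, open_nbhs x V -> (0 < mu V)%E].

(* An integrand f below is bounded above on the compact support of mu, so its
   positive part is integrable and \int f is well defined in [-oo, +oo[. *)
Definition jensen_open (U : set Rn) (z : Rn) : set borel_probability :=
  [set mu : borel_probability |
    [/\ compact (measure_support mu),
        measure_support mu `<=` U &
        forall f : Rn -> \bar R, subharmonic U f ->
          (f z <= \int[mu]_(x in (U : set borel_space)) f x)%E]].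

Definition jensen (K : set Rn) (z : Rn) : set borel_probability :=
  \bigcap_(U in [set U : set Rn | open U /\ K `<=` U]) jensen_open U z.

(* The equation J_z(K) = {\d_z} is read with measures identified when they
   agree on Borel sets (measure_eq): the library's measures also carry
   unspecified values on the non-measurable sets. *)
Definition choquet_boundary (K : set Rn) : set Rn :=
  [set z | K z /\
    jensen K z =
      [set mu : borel_probability | measure_eq mu (\d_(z : borel_space))]].

End Jensen.

(* Main.v *)
Require Import Defs.
From HB Require Import structures.
From mathcomp Require Import ring lra.

(** The idea is to test Jensen measures at z on the squared distance
f(x) = |x - z|^2, written [sqdist z]: it is subharmonic, and a probability
measure is the Dirac measure at z as soon as f vanishes almost everywhere.

Let z be a point of K outside the fine interior of K. For r > 0 let U_r be the
set of the points at distance less than r from K, and let [perron] r be the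
supremum of the functions which are subharmonic on R^n and at most f off U_r.
The decreasing limit of [perron] r as r tends to 0, which is [upper_perron] 0,
is subharmonic on R^n and at most f off K. If its value at z were larger than
some c > 0, then the set where [upper_perron] 0 > c and f < c would be a fine
neighbourhood of z contained in K. Hence the value at z is at most 0
([upper_perron_le0]). On the other hand [perron] r z bounds the integral of f
with respect to every Jensen measure at z ([jensen_le_perron]), since the
increasing limit [lower_perron] r is superharmonic on U_r and at least f.
Letting r tend to 0 leaves only the Dirac measure ([jensen_dirac]).

An upper envelope of subharmonic functions need not be semicontinuous. Here
it is so up to a change of r, since f(x + a) - f(x) is affine in x: translating a
competitor for U_r by a and subtracting this affine function gives a competitor
for U_(r + |a|) ([perron_translate]). The one-sided limits in r are therefore
semicontinuous, and they inherit the majorization property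
([upper_perron_subharmonic], [lower_perron_superharmonic]).

Now let z be in the fine interior of K. Near z the set K contains a set {u > c}
with u subharmonic on R^n and c < u(z) ([fine_nbhs_filter]), so that the
subharmonic function w = max(u - c, 0) vanishes off K near z while w(z) > 0.
Adding small multiples of w shows that, for some e > 0, an inequality
g + t f <= M on K with g subharmonic near K and t >= 0 improves at z to
g(z) + t e <= M ([fine_interior_bound]). By the Hahn-Banach theorem
([sublinear_dominates_linear]) this yields a positive functional L of total mass
1 which dominates evaluation at z on subharmonic functions and satisfies
L f >= e. It is defined on all bounded functions on K, and so it gives a mass to
every set; an outer measure construction turns it into a Borel probability
measure with larger masses on closed sets ([dominating_probability]) and hence
with larger integrals of upper semicontinuous functions ([integral_ge]). The
result is a Jensen measure at z for which f has integral at least e > 0, so it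
is not the Dirac measure ([exists_jensen]).

Both parts rest on the fact that the sum of two subharmonic functions is
subharmonic ([subharmonicD]). A failure of the majorization property
produces an interior maximum of u + v - h + e |x - y|^2, which contradicts a
sub-mean value inequality on small spheres about the maximum. The latter is
additive ([submeanD]) since upper semicontinuous functions on a sphere can be
separated from above by polynomials ([approx_separation]) and every polynomial
agrees on the sphere with a harmonic polynomial ([harmpoly_sphere]), which
takes the place of the Poisson integral. *)

Set Implicit Arguments.
Unset Strict Implicit.
Unset Printing Implicit Defensive.

Local Open Scope classical_set_scope.
Local Open Scope ring_scope.

(** * Linearity of the Laplacian and the second derivative test *)

Section Calculus.
Context {R : realType} {n : nat}.
Local Notation Rn := 'rV[R]_n.
Implicit Types (U V C : set Rn) (f g h : Rn -> R).

Lemma open_near U x : open U -> U x -> \forall y \near x, U y.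
Proof. by move=> oU Ux; exact: open_nbhs_nbhs. Qed.

Lemma C1_on_eq U f g : open U -> (forall x, U x -> f x = g x) ->
  C1_on U f -> C1_on U g.
Proof.
move=> oU fg Cf x Ux i; have [df cf] := Cf x Ux i.
have nfg : forall y, U y -> \forall z \near y, f z = g z.
  by move=> y Uy; near=> z; apply: fg; near: z; exact: open_near.
split.
  by apply: near_eq_derivable df; exact: nfg.
have Dfg : \forall y \near x, partial i f y = partial i g y.
  near=> y; rewrite /partial.
  have Uy : U y by near: y; exact: open_near.
  by apply: near_eq_derive; exact: nfg.
rewrite /prop_for /continuous_at -(nbhs_singleton Dfg).
by apply: cvg_trans cf; exact: near_eq_cvg Dfg.
Unshelve. all: by end_near. Qed.

Lemma partial_lin a f g x (i : 'I_n) : derivable f x (delta_mx 0 i) ->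
  derivable g x (delta_mx 0 i) ->
  partial i (fun y => a * f y + g y) x = a * partial i f x + partial i g x.
Proof.
move=> df dg; have E : (fun y => a * f y + g y) = (a \*: f) + g by [].
by rewrite /partial E (deriveD (derivableZ (k := a) df) dg) (deriveZ a df).
Qed.

Lemma C1_on_lin U a f g : open U -> C1_on U f -> C1_on U g ->
  C1_on U (fun y => a * f y + g y).
Proof.
move=> oU Cf Cg x Ux i; have [df cf] := Cf x Ux i; have [dg cg] := Cg x Ux i.
have E : (fun y => a * f y + g y) = (a \*: f) + g by [].
split; first by rewrite E; exact: derivableD (derivableZ (k := a) df) dg.
have D : \forall y \near x, a * partial i f y + partial i g y =
    partial i (fun y => a * f y + g y) y.
  near=> y; have Uy : U y by near: y; exact: open_near.
  by rewrite (partial_lin a (Cf y Uy i).1 (Cg y Uy i).1).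
rewrite /prop_for /continuous_at -(nbhs_singleton D).
apply: cvg_trans; first exact: near_eq_cvg D.
by apply: cvgD cg; apply: cvgM cf; exact: cvg_cst.
Unshelve. all: by end_near. Qed.

Lemma C2_on_lin U a f g : open U -> C2_on U f -> C2_on U g ->
  C2_on U (fun y => a * f y + g y).
Proof.
move=> oU [Cf Df] [Cg Dg]; split; first exact: C1_on_lin oU Cf Cg.
move=> i; apply: (C1_on_eq oU _ (C1_on_lin a oU (Df i) (Dg i))) => x Ux.
by rewrite (partial_lin a (Cf x Ux i).1 (Cg x Ux i).1).
Qed.

Lemma laplacian_lin U a f g x : open U -> U x -> C2_on U f -> C2_on U g ->
  laplacian (fun y => a * f y + g y) x = a * laplacian f x + laplacian g x.
Proof.
move=> oU Ux [Cf Df] [Cg Dg]; rewrite /laplacian mulr_sumr -big_split/=.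
apply: eq_bigr => i _.
rewrite -(partial_lin a (Df i x Ux i).1 (Dg i x Ux i).1).
rewrite /partial; apply: near_eq_derive.
near=> y; have Uy : U y by near: y; exact: open_near.
exact: (partial_lin a (Cf y Uy i).1 (Cg y Uy i).1).
Unshelve. all: by end_near. Qed.

(** The bridge from directional derivatives in R^n to functions of one real
variable, for which the mean value theorem and Rolle's theorem are available. *)
Lemma derivable_line f x v (t : R) : derivable f (t *: v + x) v ->
  is_derive t (1:R) (fun s : R => f (s *: v + x)) ('D_v f (t *: v + x)).
Proof.
have E : (fun h : R => h^-1 *: ((fun s : R => f (s *: v + x)) (h *: 1 + t)
      - f (t *: v + x))) =
    (fun h : R => h^-1 *: (f (h *: v + (t *: v + x)) - f (t *: v + x))).
  by apply/funext => h; rewrite /= [h *: 1]mulr1 scalerDl addrA.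
move=> df; apply: DeriveDef.
  by rewrite /derivable /= E.
by rewrite /derive /= E.
Qed.

Lemma line_near (x v : Rn) (P : set Rn) : (\forall y \near x, P y) ->
  exists2 d : R, 0 < d & forall t, `|t| < d -> P (t *: v + x).
Proof.
move=> nP.
have c : (fun t : R => t *: v + x) @ 0 --> x.
  rewrite -[X in _ --> X](add0r x) -(scale0r v).
  by apply: cvgD; [apply: cvgZr_tmp; exact: cvg_id|exact: cvg_cst].
have /nbhs_ballP [d /= d0 dP] := c _ nP.
exists d => // t td; apply: dP; rewrite /ball /= sub0r normrN //.
Qed.

(** Restrict g to the line through x in the i-th direction. The first derivative
vanishes at x, so a positive second derivative would make it positive shortly
after x, and by the mean value theorem g would exceed its maximum there. *)
Lemma partial2_le0_at_max U g x (i : 'I_n) : open U -> U x -> C2_on U g ->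
  (forall y, U y -> g y <= g x) -> partial i (partial i g) x <= 0.
Proof.
move=> oU Ux [C1 C2] gmax; rewrite leNgt; apply/negP => D2.
set v : Rn := delta_mx 0 i.
have [d d0 dU] := line_near v (open_near oU Ux).
have Dg (t : R) : `|t| < d ->
    is_derive t (1:R) (fun s : R => g (s *: v + x)) (partial i g (t *: v + x)).
  by move=> td; apply: derivable_line; have [] := C1 _ (dU _ td) i.
have x0 : 0 *: v + x = x by rewrite scale0r add0r.
have D10 : partial i g x = 0.
  have h0 : is_derive (0:R) (1:R) (fun s : R => g (s *: v + x)) 0.
    apply: (@derive1_at_max _ _ (- d) d).
    - lra.
    - move=> t; rewrite in_itv/= -ltr_norml => /Dg H; exact: (@ex_derive _ _ _ _ _ _ _ H).
    - by rewrite in_itv/=; apply/andP; split; lra.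
    - by move=> t; rewrite in_itv/= -ltr_norml x0 => /dU; exact: gmax.
  have := Dg 0; rewrite normr0 => /(_ d0) H.
  by rewrite -x0 -(@derive_val _ _ _ _ _ _ _ H) (@derive_val _ _ _ _ _ _ _ h0).
have [e e0 eP] : exists2 e : R, 0 < e &
    forall t, 0 < t < e -> 0 < partial i g (t *: v + x).
  have [dd _] := C2 i x Ux i.
  have : (fun h : R => h^-1 *: (partial i g (h *: v + x) - partial i g x))
     @ 0^' --> partial i (partial i g) x by [].
  move=> /cvgr_gt /(_ 0 D2) /nbhs_ballP[e /= e0 H].
  exists e => // t /andP[t0 te].
  have := H t; rewrite /ball /= sub0r normrN gtr0_norm// => /(_ te).
  rewrite gt_eqF// D10 subr0 => /(_ isT).
  by rewrite -[_ *: _]/(_ * _) pmulr_rgt0// invr_gt0.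
pose s := Num.min d e / 2.
have m0 : 0 < Num.min d e by rewrite lt_min d0.
have s0 : 0 < s by rewrite /s; lra.
have sd : s < d.
  have : Num.min d e <= d by rewrite ge_min lexx.
  by rewrite /s; lra.
have se : s < e.
  have : Num.min d e <= e by rewrite ge_min lexx orbT.
  by rewrite /s; lra.
have [||c] := @MVT _ (fun s : R => g (s *: v + x))
   (fun t => partial i g (t *: v + x)) _ _ s0.
- move=> t; rewrite in_itv/= => /andP[t0 ts]; apply: Dg.
  by rewrite gtr0_norm//; lra.
- apply: continuous_in_subspaceT => t; rewrite inE/= in_itv/= => /andP[t0 ts].
  apply/differentiable_continuous/derivable1_diffP.
  have td : `|t| < d by rewrite ger0_norm//; lra.
  exact: (@ex_derive _ _ _ _ _ _ _ (Dg _ td)).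
rewrite in_itv/= => /andP[c0 cs] E.
have gs : g (s *: v + x) <= g x by apply/gmax/dU; rewrite gtr0_norm.
have pc : 0 < partial i g (c *: v + x).
  by apply: eP; apply/andP; split; lra.
have : 0 < partial i g (c *: v + x) * (s - 0) by rewrite subr0 mulr_gt0.
by rewrite -E scale0r add0r subr_gt0 ltNge gs.
Qed.

End Calculus.

(** * Homogeneous polynomial functions *)

Section Polynomials.
Context {R : realType} {n : nat} (x0 : 'rV[R]_n).
Local Notation Rn := 'rV[R]_n.
Implicit Types (p q g h : Rn -> R).

(** The square of the Euclidean distance, which unlike the sup norm of the
underlying type is smooth. *)
Definition sqdist (a x : Rn) : R := \sum_(i < n) (x 0 i - a 0 i) ^+ 2.

(** Homogeneous polynomials of degree d in x - x0, as functions. The zero function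
is put in every degree so that the derivatives stay in the family. *)
Inductive hompoly : nat -> (Rn -> R) -> Prop :=
| hompoly_cst c : hompoly 0 (fun=> c)
| hompoly_zero d : hompoly d (fun=> 0)
| hompoly_mulX d i p : hompoly d p -> hompoly d.+1 (fun x : Rn => (x 0 i - x0 0 i) * p x)
| hompoly_add d p q : hompoly d p -> hompoly d q -> hompoly d (fun x => p x + q x).

Lemma is_derive_coord (i : 'I_n) (x v : Rn) :
  is_derive x v (fun y : Rn => y 0 i - x0 0 i) (v 0 i).
Proof.
have E : (fun y : Rn => y 0 i - x0 0 i) = (fun y : Rn => y 0 i : R) \- cst (x0 0 i).
  by [].
have df : differentiable (fun y : Rn => y 0 i : R) x := differentiable_coord x 0 i.
have lg : linear (fun N : Rn => N 0 i : R) by move=> k y z; rewrite !mxE.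
pose gM := GRing.isLinear.Build _ _ _ _ _ lg.
pose g : {linear Rn -> R} := HB.pack (fun N : Rn => N 0 i : R) gM.
have Dg : 'D_v (fun y : Rn => y 0 i : R) x = v 0 i.
  rewrite deriveE// -[fun y : Rn => _]/(g : Rn -> R) diff_lin//.
  exact: coord_continuous.
rewrite E; apply: DeriveDef.
  by apply: derivableB; [exact: diff_derivable|exact: derivable_cst].
rewrite deriveB; [|exact: diff_derivable|exact: derivable_cst].
by rewrite Dg derive_cst subr0.
Qed.

Lemma partial_mul p q x (i : 'I_n) : derivable p x (delta_mx 0 i) ->
  derivable q x (delta_mx 0 i) ->
  partial i (fun y => p y * q y) x = p x * partial i q x + q x * partial i p x.
Proof. by move=> dp dq; exact: (deriveM dp dq). Qed.

Lemma hompoly_scale d p c : hompoly d p -> hompoly d (fun x => c * p x).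
Proof.
elim=> [b|e|e i q _ IH|e q r _ IHq _ IHr].
- exact: hompoly_cst.
- rewrite (_ : (fun x => _) = (fun=> 0)); first exact: hompoly_zero.
  by apply/funext => x; rewrite mulr0.
- rewrite (_ : (fun x => _) = (fun x : Rn => (x 0 i - x0 0 i) * (c * q x))).
    exact: hompoly_mulX.
  by apply/funext => x; ring.
- rewrite (_ : (fun x => _) = (fun x => c * q x + c * r x)); first exact: hompoly_add.
  by apply/funext => x; ring.
Qed.

Lemma hompoly_sum (I : Type) (s : seq I) d (F : I -> Rn -> R) :
  (forall i, hompoly d (F i)) -> hompoly d (fun x => \sum_(i <- s) F i x).
Proof.
move=> H; elim: s => [|a s IH].
  rewrite (_ : (fun x => _) = (fun=> 0)); first exact: hompoly_zero.
  by apply/funext => x; rewrite big_nil.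
rewrite (_ : (fun x => _) = (fun x => F a x + \sum_(i <- s) F i x)).
  exact: hompoly_add.
by apply/funext => x; rewrite big_cons.
Qed.

Lemma hompoly_derivable d p x (i : 'I_n) : hompoly d p -> derivable p x (delta_mx 0 i).
Proof.
elim=> [b|e|e j q _ IH|e q r _ IHq _ IHr].
- exact: derivable_cst.
- exact: derivable_cst.
- apply: (derivableM _ IH).
  exact: (@ex_derive _ _ _ _ _ _ _ (is_derive_coord j x _)).
- exact: (derivableD IHq IHr).
Qed.

Lemma partialD p q x (i : 'I_n) : derivable p x (delta_mx 0 i) ->
  derivable q x (delta_mx 0 i) ->
  partial i (fun y => p y + q y) x = partial i p x + partial i q x.
Proof. by move=> dp dq; rewrite /partial; exact: deriveD. Qed.

Lemma partial_coord (i j : 'I_n) (x : Rn) :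
  partial i (fun y : Rn => y 0 j - x0 0 j) x = (i == j)%:R.
Proof.
rewrite /partial (@derive_val _ _ _ _ _ _ _ (is_derive_coord j x _)).
by rewrite mxE eqxx eq_sym.
Qed.

Lemma coord_derivable (j : 'I_n) x v : derivable (fun y : Rn => y 0 j - x0 0 j) x v.
Proof. exact: (@ex_derive _ _ _ _ _ _ _ (is_derive_coord j x _)). Qed.

Lemma hompoly_partial0 p (i : 'I_n) : hompoly 0 p -> partial i p = fun=> 0.
Proof.
move=> hp; have : hompoly 0 p -> 0%N = 0%N -> partial i p = fun=> 0.
  move: {1 3}0%N => d; elim=> [b|e|e j q _ IH|e q r hq IHq hr IHr] // e0.
  - by apply/funext => x; exact: derive_cst.
  - by apply/funext => x; exact: derive_cst.
  - apply/funext => x; rewrite partialD ?IHq ?IHr ?addr0//.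
      exact: hompoly_derivable hq.
    exact: hompoly_derivable hr.
exact.
Qed.

Lemma hompoly_partial d p (i : 'I_n) : hompoly d.+1 p -> hompoly d (partial i p).
Proof.
move=> hp; suff : forall e, hompoly e p -> e = d.+1 -> hompoly d (partial i p).
  by move/(_ _ hp); exact.
move=> e he; elim: he d {hp} => [b|e'|e' j q hq IH|e' q r hq IHq hr IHr] d //.
- move=> _; rewrite (_ : partial i _ = (fun=> 0)); first exact: hompoly_zero.
  by apply/funext => x; exact: derive_cst.
- move=> [e'd]; subst e'.
  rewrite (_ : partial i _ = (fun x : Rn => (x 0 j - x0 0 j) * partial i q x +
     (i == j)%:R * q x)).
    apply: hompoly_add; last exact: hompoly_scale.
    case: d hq IH => [hq _|d hq IH]; last by apply: hompoly_mulX; exact: IH.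
    rewrite (hompoly_partial0 _ hq) (_ : (fun x => _) = (fun=> 0)).
      exact: hompoly_zero.
    by apply/funext => x; rewrite mulr0.
  apply/funext => x; rewrite partial_mul; first by rewrite partial_coord [X in _ + X]mulrC.
  + exact: coord_derivable.
  + exact: hompoly_derivable hq.
- move=> ed; rewrite (_ : partial i _ = (fun x => partial i q x + partial i r x)).
    by apply: hompoly_add; [exact: IHq|exact: IHr].
  apply/funext => x; rewrite partialD//; [exact: hompoly_derivable hq|exact: hompoly_derivable hr].
Qed.

Lemma hompoly_euler d p (x : Rn) : hompoly d p ->
  \sum_(i < n) (x 0 i - x0 0 i) * partial i p x = d%:R * p x.
Proof.
elim=> [b|e|e j q hq IH|e q r hq IHq hr IHr].
- by rewrite mul0r big1// => i _; rewrite /partial derive_cst mulr0.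
- by rewrite mulr0 big1// => i _; rewrite /partial derive_cst mulr0.
- under eq_bigr => i _.
    rewrite partial_mul; [|exact: coord_derivable|exact: hompoly_derivable hq].
    rewrite partial_coord mulrDr mulrCA.
    over.
  rewrite big_split/= -mulr_sumr IH (bigD1 j)//= eqxx big1 ?addr0.
    by rewrite -natr1 mulr1n; ring.
  by move=> i /negPf ->; rewrite !mulr0.
- under eq_bigr => i _.
    rewrite partialD; [|exact: hompoly_derivable hq|exact: hompoly_derivable hr].
    rewrite mulrDr.
    over.
  by rewrite big_split/= IHq IHr mulrDr.
Qed.

Lemma coord_cont (i : 'I_n) : continuous (fun y : Rn => y 0 i - x0 0 i).
Proof.
move=> x; apply: (@continuousB _ _ _ (fun y : Rn => y 0 i : R) (cst (x0 0 i)) x).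
  exact: coord_continuous.
exact: cst_continuous.
Qed.

Lemma hompoly_continuous d p : hompoly d p -> continuous p.
Proof.
elim=> [b|e|e j q hq IH|e q r hq IHq hr IHr] x.
- exact: cst_continuous.
- exact: cst_continuous.
- apply: (@continuousM _ _ (fun y : Rn => y 0 j - x0 0 j) q x).
  exact: coord_cont.
  exact: IH.
- by apply: (@continuousD _ _ _ q r x); [exact: IHq|exact: IHr].
Qed.

Lemma hompoly_C1 d p : hompoly d p -> C1_on setT p.
Proof.
move=> hp x _ i; split; first exact: hompoly_derivable hp.
case: d hp => [|d] hp; last exact: (hompoly_continuous (hompoly_partial i hp)).
rewrite (hompoly_partial0 _ hp); exact: cst_continuous.
Qed.

Lemma hompoly_C2 d p : hompoly d p -> C2_on setT p.
Proof.
move=> hp; split => [|i]; first exact: hompoly_C1 hp.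
case: d hp => [|d] hp; last exact: (hompoly_C1 (hompoly_partial i hp)).
rewrite (hompoly_partial0 _ hp); exact: hompoly_C1 (hompoly_cst 0).
Qed.

Lemma hompoly_laplacian d p : hompoly d.+2 p -> hompoly d (laplacian p).
Proof.
by move=> hp; apply: hompoly_sum => i; apply: hompoly_partial; exact: hompoly_partial.
Qed.

Lemma hompoly_laplacian_small d p : (d < 2)%N -> hompoly d p -> laplacian p = fun=> 0.
Proof.
move=> d2 hp; apply/funext => x; rewrite /laplacian big1// => i _.
case: d d2 hp => [|[|//]] _ hp; last by rewrite (hompoly_partial0 i (hompoly_partial i hp)).
by rewrite (hompoly_partial0 i hp) /partial derive_cst.
Qed.

Lemma hompoly_mul_sqdist d p : hompoly d p -> hompoly d.+2 (fun x => sqdist x0 x * p x).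
Proof.
move=> hp; rewrite (_ : (fun x => _) = (fun x : Rn => \sum_(i < n)
    (x 0 i - x0 0 i) * ((x 0 i - x0 0 i) * p x))).
  by apply: hompoly_sum => i; apply: hompoly_mulX; exact: hompoly_mulX.
by apply/funext => x; rewrite /sqdist mulr_suml; apply: eq_bigr => i _; ring.
Qed.

Lemma hompoly_sqdist : hompoly 2 (sqdist x0).
Proof.
rewrite (_ : sqdist x0 = (fun x => sqdist x0 x * 1)).
  exact: hompoly_mul_sqdist (hompoly_cst 1).
by apply/funext => x; rewrite mulr1.
Qed.

Lemma partial_sum (F : 'I_n -> Rn -> R) x (i : 'I_n) :
  (forall j, derivable (F j) x (delta_mx 0 i)) ->
  partial i (fun y => \sum_(j < n) F j y) x = \sum_(j < n) partial i (F j) x.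
Proof.
move=> dF; rewrite /partial -(derive_sum dF).
have -> : (fun y => \sum_(j < n) F j y) = \sum_(j < n) F j; last by [].
by apply/funext => y; rewrite fct_sumE.
Qed.

Lemma partial_sqdist i (x : Rn) : partial i (sqdist x0) x = 2 * (x 0 i - x0 0 i).
Proof.
have dX j : derivable (fun y : Rn => y 0 j - x0 0 j) x (delta_mx 0 i).
  exact: coord_derivable.
rewrite (_ : sqdist x0 =
    fun y => \sum_(j < n) (y 0 j - x0 0 j) * (y 0 j - x0 0 j)); last first.
  by apply/funext => y; apply: eq_bigr => j _; ring.
rewrite (partial_sum (F := fun j (y : Rn) => (y 0 j - x0 0 j) * (y 0 j - x0 0 j))).
  rewrite (bigD1 i)//= big1 ?addr0 => [|j ji].
    by rewrite (partial_mul (dX i) (dX i)) partial_coord eqxx mulr1n; ring.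
  by rewrite (partial_mul (dX j) (dX j)) partial_coord eq_sym (negPf ji) mulr0n; ring.
by move=> j; exact: (derivableM (dX j) (dX j)).
Qed.

(** By the product rule the cross term is four times the sum of the
(x_i - x0_i) d_i p, which Euler's identity evaluates. *)
Lemma laplacian_sqdist_mul d p (x : Rn) : hompoly d p ->
  laplacian (fun x => sqdist x0 x * p x) x =
  (2 * n%:R + 4 * d%:R) * p x + sqdist x0 x * laplacian p x.
Proof.
move=> hp.
have dsq y i : derivable (sqdist x0) y (delta_mx 0 i) by exact: hompoly_derivable hompoly_sqdist.
have dp y i : derivable p y (delta_mx 0 i) by exact: hompoly_derivable hp.
have dpp y i j : derivable (partial j p) y (delta_mx 0 i).
  by have [+ _] := (hompoly_C2 hp).2 j y I i.
have E i : partial i (fun x => sqdist x0 x * p x) =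
    (fun x => sqdist x0 x * partial i p x + 2 * ((x 0 i - x0 0 i) * p x)).
  by apply/funext => y; rewrite (partial_mul (dsq y i) (dp y i)) partial_sqdist; ring.
rewrite {1}/laplacian.
transitivity (\sum_(i < n) (2 * p x + 4 * ((x 0 i - x0 0 i) * partial i p x) +
    sqdist x0 x * partial i (partial i p) x)).
  apply: eq_bigr => i _; rewrite E.
  have dXi : derivable (fun y : Rn => y 0 i - x0 0 i) x (delta_mx 0 i).
    exact: coord_derivable.
  have dXp : derivable (fun y : Rn => (y 0 i - x0 0 i) * p y) x (delta_mx 0 i).
    exact: (derivableM dXi (dp x i)).
  rewrite (partialD (derivableM (dsq x i) (dpp x i i)) (derivableZ (k := 2) dXp)).
  rewrite (partial_mul (dsq x i) (dpp x i i)) partial_sqdist.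
  have -> : partial i (fun y : Rn => 2 * ((y 0 i - x0 0 i) * p y)) x =
     2 * partial i (fun y : Rn => (y 0 i - x0 0 i) * p y) x by exact: (deriveZ 2 dXp).
  rewrite (partial_mul dXi (dp x i)).
  by rewrite partial_coord eqxx mulr1n; ring.
rewrite !big_split/= -mulr_sumr -mulr_sumr (hompoly_euler _ hp) sumr_const card_ord.
by rewrite -mulr_sumr -mulr_natr /laplacian; ring.
Qed.

Lemma laplacian_sqdist x : laplacian (sqdist x0) x = 2 * n%:R.
Proof.
have := @laplacian_sqdist_mul _ _ x (hompoly_cst 1).
have -> : (fun x => sqdist x0 x * 1) = sqdist x0 by apply/funext => y; rewrite mulr1.
move=> ->; rewrite (hompoly_laplacian_small (d := 0) _ (hompoly_cst 1))//.
ring.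
Qed.

End Polynomials.

(** * The maximum principle and the Dirichlet problem with polynomial data *)

Section MaxPrinciple.
Context {R : realType} {n : nat} (n0 : (0 < n)%N).
Local Notation Rn := 'rV[R]_n.
Implicit Types (U V C : set Rn) (f g h p q : Rn -> R).

Lemma C1_on_sub U V f : V `<=` U -> C1_on U f -> C1_on V f.
Proof. by move=> VU Cf x /VU; exact: Cf. Qed.

Lemma C2_on_sub U V f : V `<=` U -> C2_on U f -> C2_on V f.
Proof.
move=> VU [Cf Df]; split=> [|i]; first exact: C1_on_sub Cf.
exact: C1_on_sub (Df i).
Qed.

Lemma sqdist_ge0 (a x : Rn) : 0 <= sqdist a x.
Proof. by apply: sumr_ge0 => i _; exact: sqr_ge0. Qed.

Lemma sqdist_self (a : Rn) : sqdist a a = 0.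
Proof. by rewrite /sqdist big1// => i _; rewrite subrr expr0n. Qed.

Lemma sqdist_continuous (a : Rn) : continuous (sqdist a).
Proof. exact: hompoly_continuous (hompoly_sqdist a). Qed.

Lemma compact_max C g : C !=set0 -> compact C -> {within C, continuous g} ->
  exists2 x, C x & forall y, C y -> g y <= g x.
Proof.
move=> C0 cC cg; have [x] := compact_EVT_max C0 cC cg.
rewrite inE => Cx H; exists x => // y Cy; apply: H; rewrite inE//.
Qed.

Lemma within_addc C f g : {within C, continuous f} -> {within C, continuous g} ->
  {within C, continuous (fun x => f x + g x)}.
Proof. exact: within_continuousD. Qed.

(** Adding e |x|^2 with a small e makes the Laplacian positive in the interior.
The maximum of the sum is then not attained there by the second derivative
test, and e is small enough for it to exceed all the boundary values. *)
Lemma max_principle C g : compact C -> {within C, continuous g} ->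
  C2_on C° g -> (forall x, C° x -> 0 <= laplacian g x) ->
  (forall x, (C `\` C°) x -> g x <= 0) -> forall x, C x -> g x <= 0.
Proof.
move=> cC cg Cg Lg bg y Cy; rewrite leNgt; apply/negP => gy.
have C0 : C !=set0 by exists y.
have csqd : {within C, continuous (sqdist (0 : Rn))}.
  by apply: continuous_subspaceT; exact: sqdist_continuous.
have [m Cm mmax] := compact_max C0 cC csqd.
(* chosen so that e |x|^2 < g y on C, where |m| is the maximum of |x| *)
pose e := g y / (2 * (1 + sqdist 0 m)).
have m0 := sqdist_ge0 0 m.
have e0 : 0 < e by rewrite /e divr_gt0//; lra.
have em : e * sqdist 0 m < g y.
  rewrite /e mulrAC ltr_pdivrMr; last by lra.
  by rewrite ltr_pM2l//; lra.
pose w := fun x => e * sqdist 0 x + g x.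
have cw : {within C, continuous w}.
  apply: within_addc => //; apply: continuous_subspaceT => x.
  by apply: (@continuousM _ _ (cst e) (sqdist 0) x);
    [exact: cst_continuous|exact: sqdist_continuous].
have [x Cx xmax] := compact_max C0 cC cw.
have Cix : C° x.
  apply: contrapT => nCx; have := bg x (conj Cx nCx).
  have := xmax y Cy; rewrite /w => h1 h2.
  have h3 : e * sqdist 0 x <= e * sqdist 0 m by rewrite ler_pM2l// mmax.
  have h4 : 0 <= e * sqdist 0 y by rewrite mulr_ge0 ?sqdist_ge0// ltW.
  lra.
have oC : open C° by exact: open_interior.
have Csqd : C2_on C° (sqdist (0 : Rn)) := C2_on_sub (@subsetT _ _) (hompoly_C2 (hompoly_sqdist 0)).
have : laplacian w x <= 0.
  rewrite /laplacian; apply: sumr_le0 => i _.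
  apply: (partial2_le0_at_max (g := w) i oC Cix).
    exact: C2_on_lin oC Csqd Cg.
  by move=> z /interior_subset; exact: xmax.
rewrite (laplacian_lin e oC Cix Csqd Cg) laplacian_sqdist.
have := Lg x Cix; have : 0 < e * (2 * n%:R).
  by rewrite mulr_gt0// mulr_gt0// ltr0n.
lra.
Qed.

(** Looking for g = (p - |x|^2 k) / c1, with c1 = 2n + 4d + c the coefficient of g,
and expanding the Laplacian of |x|^2 k, one finds the same equation for k with
the Laplacian of p in place of p and the degree d - 2. The parameter c turns
into c1, so the induction needs the statement for all c >= 0. *)
Lemma hompoly_solve x0 d (p : Rn -> R) (c : R) : 0 <= c -> hompoly x0 d p ->
  exists2 g, hompoly x0 d g & forall x,
   sqdist x0 x * laplacian g x + (2 * n%:R + 4 * d%:R + c) * g x = p x.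
Proof.
elim/ltn_ind: d p c => d IH p c c0 hp.
have [c1 c1E] : exists c1, c1 = 2 * n%:R + 4 * d%:R + c by eexists.
have c1_gt0 : 0 < c1.
  have : 0 < n%:R :> R by rewrite ltr0n.
  have : 0 <= d%:R :> R by [].
  by rewrite c1E; lra.
have [d2|d2] := ltnP d 2.
  exists (fun x => c1^-1 * p x); first exact: hompoly_scale.
  move=> x; rewrite (hompoly_laplacian_small d2 (hompoly_scale _ hp)) -c1E mulr0 add0r.
  by rewrite mulVKf// gt_eqF.
case: d IH hp c1E d2 => [|[|d]]// IH hp c1E _.
have dd2 : (d < d.+2)%N by [].
have [k hk kE] := IH d dd2 (laplacian p) c1 (ltW c1_gt0) (hompoly_laplacian hp).
exists (fun x => c1^-1 * (p x + (- 1) * (sqdist x0 x * k x))).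
  by apply: hompoly_scale; apply: hompoly_add => //; apply: hompoly_scale; exact: hompoly_mul_sqdist.
move=> x; rewrite -c1E.
have E : laplacian (fun x => c1^-1 * (p x + (- 1) * (sqdist x0 x * k x))) x = k x.
  have Cp := hompoly_C2 hp.
  have Ck := hompoly_C2 (hompoly_mul_sqdist hk).
  have C0 := hompoly_C2 (hompoly_cst x0 0).
  have -> : (fun x => c1^-1 * (p x + (- 1) * (sqdist x0 x * k x))) =
     (fun x => - c1^-1 * (sqdist x0 x * k x) + (c1^-1 * p x + 0)).
    by apply/funext => y; ring.
  have CC := C2_on_lin c1^-1 openT Cp C0.
  rewrite (laplacian_lin _ openT I Ck CC) (laplacian_lin _ openT I Cp C0).
  rewrite (laplacian_sqdist_mul _ hk).
  rewrite (hompoly_laplacian_small (d := 0) _ (hompoly_cst x0 0))//.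
  rewrite -(kE x) c1E -!natr1; field.
  by rewrite !natr1 -c1E gt_eqF.
by rewrite E; field; rewrite gt_eqF.
Qed.

Inductive polyfun x0 : (Rn -> R) -> Prop :=
| polyfun_hom d p : hompoly x0 d p -> polyfun x0 p
| polyfun_add p q : polyfun x0 p -> polyfun x0 q -> polyfun x0 (fun x => p x + q x).

Lemma polyfun_cst x0 c : polyfun x0 (fun=> c).
Proof. exact: polyfun_hom (hompoly_cst x0 c). Qed.

Lemma polyfun_continuous x0 p : polyfun x0 p -> continuous p.
Proof.
elim=> [d q /hompoly_continuous//|q r _ IHq _ IHr] x.
by apply: (@continuousD _ _ _ q r x); [exact: IHq|exact: IHr].
Qed.

Lemma polyfun_C2 x0 p : polyfun x0 p -> C2_on setT p.
Proof.
elim=> [d q /hompoly_C2//|q r _ IHq _ IHr].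
have := C2_on_lin 1 openT IHq IHr; congr (C2_on _ _).
by apply/funext => x; rewrite mul1r.
Qed.

Lemma polyfun_scale x0 c p : polyfun x0 p -> polyfun x0 (fun x => c * p x).
Proof.
elim=> [d q hq|q r _ IHq _ IHr].
  by apply: polyfun_hom; exact: hompoly_scale hq.
rewrite (_ : (fun x => _) = fun x => c * q x + c * r x); first exact: polyfun_add.
by apply/funext => x; rewrite mulrDr.
Qed.

Lemma hompoly_mul x0 d e p q : hompoly x0 d p -> hompoly x0 e q ->
  hompoly x0 (d + e) (fun x => p x * q x).
Proof.
move=> hp hq; elim: hp => [b|d'|d' i p' _ IH|d' q' r' _ IHq _ IHr].
- by rewrite add0n; exact: hompoly_scale.
- rewrite (_ : (fun x => _) = fun=> 0); first exact: hompoly_zero.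
  by apply/funext => x; rewrite mul0r.
- rewrite (_ : (fun x => _) = fun x : Rn => (x 0 i - x0 0 i) * (p' x * q x)).
    by rewrite addSn; exact: hompoly_mulX.
  by apply/funext => x; rewrite mulrA.
- rewrite (_ : (fun x => _) = fun x : Rn => q' x * q x + r' x * q x).
    exact: hompoly_add.
  by apply/funext => x; rewrite mulrDl.
Qed.

Lemma polyfun_mul x0 p q : polyfun x0 p -> polyfun x0 q -> polyfun x0 (fun x => p x * q x).
Proof.
move=> hp hq; elim: hp => [d p' hp|p1 p2 _ IH1 _ IH2]; last first.
  rewrite (_ : (fun x => _) = fun x : Rn => p1 x * q x + p2 x * q x).
    exact: polyfun_add.
  by apply/funext => x; rewrite mulrDl.
elim: hq => [e q' hq'|p1 p2 _ IH1 _ IH2]; first exact: polyfun_hom (hompoly_mul hp hq').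
rewrite (_ : (fun x => _) = fun x : Rn => p' x * p1 x + p' x * p2 x).
  exact: polyfun_add.
by apply/funext => x; rewrite mulrDr.
Qed.

Lemma polyfun_coord x0 (i : 'I_n) : polyfun x0 (fun x => x 0 i).
Proof.
rewrite (_ : (fun x => _) = fun x : Rn => (x 0 i - x0 0 i) * 1 + x0 0 i).
  apply: polyfun_add; last exact: polyfun_cst.
  by apply: polyfun_hom; apply: hompoly_mulX; exact: hompoly_cst.
by apply/funext => x; rewrite mulr1 subrK.
Qed.

Lemma polyfun_sum x0 (I : Type) (s : seq I) (F : I -> Rn -> R) :
  (forall i, polyfun x0 (F i)) -> polyfun x0 (fun x => \sum_(i <- s) F i x).
Proof.
move=> H; elim: s => [|a s IH].
  rewrite (_ : (fun x => _) = (fun=> 0)); first exact: polyfun_cst.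
  by apply/funext => x; rewrite big_nil.
rewrite (_ : (fun x => _) = (fun x => F a x + \sum_(i <- s) F i x)).
  exact: polyfun_add.
by apply/funext => x; rewrite big_cons.
Qed.

Lemma polyfun_sqdist x0 a : polyfun x0 (sqdist a).
Proof.
apply: polyfun_sum => i.
have H : polyfun x0 (fun x : Rn => x 0 i + - a 0 i).
  by apply: polyfun_add; [exact: polyfun_coord|exact: polyfun_cst].
rewrite (_ : (fun x => _) = (fun x : Rn => (x 0 i + - a 0 i) * (x 0 i + - a 0 i))).
  exact: polyfun_mul.
by apply/funext => x; rewrite expr2.
Qed.

Definition harmpoly x0 h := polyfun x0 h /\ forall x, laplacian h x = 0.

Lemma harmpoly_lin x0 a g h : harmpoly x0 g -> harmpoly x0 h ->
  harmpoly x0 (fun x => a * g x + h x).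
Proof.
move=> [pg Lg] [ph Lh]; split; first by apply: polyfun_add => //; exact: polyfun_scale.
move=> x; rewrite (laplacian_lin _ openT I (polyfun_C2 pg) (polyfun_C2 ph)).
by rewrite Lg Lh mulr0 addr0.
Qed.

Lemma harmpoly_cst x0 c : harmpoly x0 (fun=> c).
Proof.
split; first exact: polyfun_cst.
by move=> x; rewrite (hompoly_laplacian_small (d := 0) _ (hompoly_cst x0 c)).
Qed.

Lemma harmpoly_coord x0 (i : 'I_n) : harmpoly x0 (fun x => x 0 i).
Proof.
split; first exact: polyfun_coord.
move=> x; rewrite (_ : (fun x => _) = fun x : Rn => 1 * ((x 0 i - x0 0 i) * 1) + x0 0 i).
  have h1 : hompoly x0 1 (fun x : Rn => (x 0 i - x0 0 i) * 1).
    by apply: hompoly_mulX; exact: hompoly_cst.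
  rewrite (laplacian_lin _ openT I (hompoly_C2 h1) (hompoly_C2 (hompoly_cst x0 _))).
  by rewrite (hompoly_laplacian_small _ h1)// (hompoly_laplacian_small _ (hompoly_cst x0 _))// mulr0 addr0.
by apply/funext => y; ring.
Qed.

(** In degree d choose g with Laplacian of |x|^2 g equal to that of p
([hompoly_solve] in degree d - 2). Then p - |x|^2 g is harmonic and equals
p - r2 g on the sphere, where g has a smaller degree. *)
Lemma harmpoly_sphere x0 (r2 : R) p : polyfun x0 p ->
  exists2 h, harmpoly x0 h & forall x, sqdist x0 x = r2 -> h x = p x.
Proof.
elim=> [d {}p hp|p1 p2 _ [h1 H1 E1] _ [h2 H2 E2]]; last first.
  exists (fun x => 1 * h1 x + h2 x); first exact: harmpoly_lin.
  by move=> x xr; rewrite E1// E2// mul1r.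
elim/ltn_ind: d p hp => d IH p hp.
have [d2|d2] := ltnP d 2.
  exists p => //; split; first exact: polyfun_hom hp.
  by move=> x; rewrite (hompoly_laplacian_small d2 hp).
case: d IH hp d2 => [|[|d]]// IH hp _.
have [g hg gE] := hompoly_solve (lexx 0) (hompoly_laplacian hp).
have dd2 : (d < d.+2)%N by [].
have [h1 H1 E1] := IH d dd2 g hg.
exists (fun x => r2 * h1 x + ((-1) * (sqdist x0 x * g x) + p x)).
  apply: (harmpoly_lin r2 H1); split.
    apply: polyfun_add; last exact: polyfun_hom hp.
    by apply: polyfun_scale; apply: polyfun_hom; exact: hompoly_mul_sqdist hg.
  move=> x; rewrite (laplacian_lin _ openT I (hompoly_C2 (hompoly_mul_sqdist hg)) (hompoly_C2 hp)).
  by rewrite (laplacian_sqdist_mul _ hg) -gE; ring.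
by move=> x xr; rewrite E1// xr; ring.
Qed.

End MaxPrinciple.

(** * First properties of subharmonic functions *)

Section Basics.
Context {R : realType} {n : nat} (n0 : (0 < n)%N).
Local Notation Rn := 'rV[R]_n.
Implicit Types (U V C : set Rn) (f g h p q : Rn -> R) (u v : Rn -> \bar R).

Lemma continuous_lt f x (a : R) : {for x, continuous f} -> f x < a ->
  \forall y \near x, f y < a.
Proof. by move=> cf fa; have := cf _ (lt_nbhsl fa). Qed.

Lemma within_continuous_lt C g x (a : R) : {within C, continuous g} -> C x ->
  g x < a -> \forall y \near x, C y -> g y < a.
Proof.
move=> cg Cx ga; have [cg' _] := @subspace_continuousP _ C _ g.
by have := cg' cg x Cx _ (lt_nbhsl ga).
Qed.

(** The maximum principle applies to f - h, whose Laplacian is that of f. *)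
Lemma C2_subharmonic U f : open U -> C2_on U f -> (forall x, U x -> 0 <= laplacian f x) ->
  (forall x, U x -> {for x, continuous f}) -> subharmonic U (EFin \o f).
Proof.
move=> oU Cf Lf cf; split.
- by move=> x _; exact: ltry.
- by move=> x Ux a /=; rewrite lte_fin => fa; apply: continuous_lt fa; exact: cf.
move=> C h cC CU ch [Ch Lh] bh x Cx /=; rewrite lee_fin.
have oC : open C° by exact: open_interior.
have CfC : C2_on C° f by apply: C2_on_sub Cf => y /interior_subset; exact: CU.
suff : -1 * h x + f x <= 0 by lra.
apply: (max_principle n0 cC (g := fun x => -1 * h x + f x)); last exact: Cx.
- apply: within_addc; last first.
    by apply: continuous_in_subspaceT => y; rewrite inE => /CU; exact: cf.
  move=> y; apply: (@continuousM _ (subspace C) (cst (-1)) h y).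
    exact: cst_continuous.
  exact: ch.
- exact: (C2_on_lin (-1) oC Ch CfC).
- move=> y Cy; rewrite (laplacian_lin (-1) oC Cy Ch CfC) Lh// mulr0 add0r.
  by apply/Lf/CU; exact: interior_subset.
- by move=> y /bh; rewrite /= lee_fin; lra.
Qed.

Lemma harmpoly_harmonic x0 V h : harmpoly x0 h -> harmonic_on V h.
Proof.
move=> [ph Lh]; split => [|x _]; last exact: Lh.
exact: C2_on_sub (@subsetT _ _) (polyfun_C2 ph).
Qed.

Lemma subharmonic_le_cst U C u (M : R) : subharmonic U u -> compact C -> C `<=` U ->
  (forall x, (C `\` C°) x -> (u x <= M%:E)%E) -> forall x, C x -> (u x <= M%:E)%E.
Proof.
move=> [_ _ H] cC CU; move=> bd; apply: (H C (fun=> M) cC CU) bd.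
  by apply: continuous_subspaceT; exact: cst_continuous.
exact: harmpoly_harmonic (harmpoly_cst 0 M).
Qed.

Lemma subharmonicS U V u : V `<=` U -> subharmonic U u -> subharmonic V u.
Proof.
move=> VU [H1 H2 H3]; split.
- by move=> x /VU; exact: H1.
- by move=> x /VU; exact: H2.
- by move=> C h cC CV; apply: H3 => // x /CV /VU.
Qed.

Lemma subharmonic_max U u v : subharmonic U u -> subharmonic U v ->
  subharmonic U (fun x => maxe (u x) (v x)).
Proof.
move=> [u1 u2 u3] [v1 v2 v3]; split.
- by move=> x Ux; rewrite gt_max u1// v1.
- move=> x Ux a; rewrite gt_max => /andP[ua va].
  by apply: filterS2 (u2 x Ux a ua) (v2 x Ux a va) => y uy vy; rewrite gt_max uy.
- move=> C h cC CU ch Hh bd x Cx; rewrite ge_max.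
  rewrite (u3 C h)// ?(v3 C h)// => y /bd; rewrite ge_max => /andP[]//.
Qed.

Lemma subharmonic_addcst U u (c : R) : subharmonic U u -> subharmonic U (fun x => u x + c%:E)%E.
Proof.
move=> [u1 u2 u3]; split.
- by move=> x Ux; rewrite lte_add_pinfty// ?u1// ltry.
- move=> x Ux a; rewrite -lteBrDr// -EFinB => /(u2 x Ux).
  by apply: filterS => y; rewrite EFinB lteBrDr.
- move=> C h cC CU ch [Ch Lh] bd x Cx; rewrite -leeBrDr// -EFinB.
  apply: (u3 C (fun x => h x - c) cC CU); last exact: Cx.
  + apply: (within_addc ch); apply: continuous_subspaceT; exact: cst_continuous.
  + have [Cc Lc] := @harmpoly_harmonic 0 C° _ (harmpoly_cst 0 (- c)).
    have oC : open C° by exact: open_interior.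
    have E : (fun x => h x - c) = (fun x => 1 * h x + (- c)).
      by apply/funext => y; rewrite mul1r.
    split; first by rewrite E; exact: (C2_on_lin 1 oC Ch Cc).
    by move=> y Cy; rewrite E (laplacian_lin 1 oC Cy Ch Cc) Lh// Lc// mulr0 addr0.
  + by move=> y /bd; rewrite EFinB leeBrDr.
Qed.

Lemma subharmonic_scale U u (t : R) : 0 < t -> subharmonic U u ->
  subharmonic U (fun x => t%:E * u x)%E.
Proof.
move=> t0 [u1 u2 u3].
have ut x (b : R) : (t%:E * u x <= b%:E)%E = (u x <= (t^-1 * b)%:E)%E.
  by rewrite EFinM lee_pdivlMl.
have utl x (b : R) : (t%:E * u x < b%:E)%E = (u x < (t^-1 * b)%:E)%E.
  by rewrite EFinM lte_pdivlMl.
split.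
- move=> x Ux; have := u1 x Ux; case: (u x) => [r| |]//= _.
    by rewrite -EFinM ltry.
  by rewrite gt0_muleNy ?lte_fin// ltNyr.
- move=> x Ux a; rewrite utl => /(u2 x Ux).
  by apply: filterS => y; rewrite utl.
- move=> C h cC CU ch [Ch Lh] bd x Cx; rewrite ut.
  have oC : open C° by exact: open_interior.
  have [C0 L0] := @harmpoly_harmonic 0 C° _ (harmpoly_cst 0 0).
  have E : (fun x => t^-1 * h x) = (fun x => t^-1 * h x + 0).
    by apply/funext => y; rewrite addr0.
  apply: (u3 C (fun x => t^-1 * h x) cC CU); last exact: Cx.
  + move=> y; apply: (@continuousM _ (subspace C) (cst t^-1) h y).
      exact: cst_continuous.
    exact: ch.
  + split; first by rewrite E; exact: (C2_on_lin t^-1 oC Ch C0).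
    by move=> y Cy; rewrite E (laplacian_lin t^-1 oC Cy Ch C0) Lh// L0// mulr0 addr0.
  + by move=> y /bd; rewrite ut.
Qed.

Lemma compact_closed_rV C : compact C -> closed C.
Proof. by move=> cC; apply: compact_closed => //; exact: norm_hausdorff. Qed.

(** The candidate of the Perron method: inside C the function may be raised to g. *)
Definition glue C g u : Rn -> \bar R :=
  fun x => if x \in C then maxe (u x) (g x)%:E else u x.

Lemma glue_in C g u x : C x -> glue C g u x = maxe (u x) (g x)%:E.
Proof. by move=> Cx; rewrite /glue mem_set. Qed.

Lemma glue_out C g u x : ~ C x -> glue C g u x = u x.
Proof. by move=> Cx; rewrite /glue memNset. Qed.

Lemma glue_ge C g u x : (u x <= glue C g u x)%E.
Proof. by rewrite /glue; case: ifP => // _; rewrite le_max lexx. Qed.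

(** A harmonic majorant h of the glued function on the boundary of D first majorizes
u on D. On D /\ C it is compared with g by the maximum principle: a boundary
point of D /\ C is a boundary point of D, or of C, and there g <= u <= h. *)
Lemma subharmonic_glue C g u : subharmonic setT u -> compact C ->
  {within C, continuous g} -> harmonic_on C° g ->
  (forall x, (C `\` C°) x -> ((g x)%:E <= u x)%E) ->
  subharmonic setT (glue C g u).
Proof.
move=> [u1 u2 u3] cC cg [Cg Lg] bg; split.
- move=> x _; rewrite /glue; case: ifP => _; last exact: u1.
  by rewrite gt_max u1//= ltry.
- move=> x _ a; have [Cx|nCx] := pselect (C x).
    rewrite glue_in// gt_max => /andP[ua]; rewrite lte_fin => ga.
    apply: filterS2 (u2 x I a ua) (within_continuous_lt cg Cx ga) => y uy gy.
    rewrite /glue; case: ifPn => // /set_mem Cy.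
    by rewrite gt_max uy lte_fin gy.
  rewrite glue_out// => ua; have := u2 x I a ua.
  have : \forall y \near x, (~` C) y.
    apply: open_near => //; apply: closed_openC; exact: compact_closed_rV.
  by apply: filterS2 => y ? ?; rewrite glue_out.
- move=> D h cD _ ch [Ch Lh] bd.
  have uh : forall x, D x -> (u x <= (h x)%:E)%E.
    apply: u3 => // x /bd; exact: le_trans (glue_ge _ _ _ _).
  move=> x Dx; have [Cx|nCx] := pselect (C x); last by rewrite glue_out// uh.
  rewrite glue_in// ge_max uh//= lee_fin.
  suff : -1 * h x + g x <= 0 by lra.
  have cDC : compact (D `&` C) by apply: compact_closedI => //; exact: compact_closed_rV.
  have oDC : open (D `&` C)° by exact: open_interior.
  have ID : (D `&` C)° `<=` D° by rewrite interiorI => ? [].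
  have IC : (D `&` C)° `<=` C° by rewrite interiorI => ? [].
  have chD : {within D `&` C, continuous h} by apply: continuous_subspaceW ch => ? [].
  have ChD : C2_on (D `&` C)° h := C2_on_sub ID Ch.
  have CgD : C2_on (D `&` C)° g := C2_on_sub IC Cg.
  apply: (max_principle n0 cDC (g := fun x => -1 * h x + g x)); last by split.
  + apply: within_addc.
      move=> y; apply: (@continuousM _ (subspace (D `&` C)) (cst (-1)) h y).
        exact: cst_continuous.
      exact: chD.
    by apply: continuous_subspaceW cg => ? [].
  + exact: (C2_on_lin (-1) oDC ChD CgD).
  + move=> y Dy; rewrite (laplacian_lin (-1) oDC Dy ChD CgD).
    by rewrite Lh ?Lg ?mulr0 ?addr0//; [exact: IC|exact: ID].
  + move=> y [[Dy Cy]]; rewrite interiorI => nDC.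
    suff : ((g y)%:E <= (h y)%:E)%E by rewrite lee_fin; lra.
    have [Diy|nDy] := pselect (D° y).
      by apply: le_trans (uh _ Dy); apply: bg; split => // Ciy; exact: nDC.
    apply: le_trans (bd y (conj Dy nDy)).
    by rewrite glue_in// le_max lexx orbT.
Qed.

End Basics.

(** * Upper semicontinuity and polynomial approximation on compact sets *)

Section CompactSets.
Context {T : topologicalType}.
Implicit Types C : set T.

(** Dini's argument for a directed index set: if the property P i holds locally for
all large i, finitely many neighbourhoods cover C and a common upper bound of
their indices works everywhere. The sets containing all large indices form a
filter, to which the covering form of compactness applies. *)
Lemma compact_directed C (I : Type) (G : set I) (le : I -> I -> Prop)
    (P : I -> T -> Prop) :
  compact C -> G !=set0 -> (forall i, G i -> le i i) ->
  (forall i j, G i -> G j -> exists2 k, G k & forall l, G l -> le k l -> le i l /\ le j l) ->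
  (forall x, C x -> exists2 i, G i &
     \forall y \near x, forall j, G j -> le i j -> C y -> P j y) ->
  exists2 i, G i & forall x, C x -> P i x.
Proof.
move=> /compact_near_coveringP /near_covering_withinP cC [i0 Gi0] lexx dir loc.
(* the sets which contain all sufficiently large indices *)
pose F : set_system I :=
  [set A | exists2 i, G i & forall j, G j -> le i j -> A j].
have FF : Filter F.
  split.
  - by exists i0.
  - move=> A B [i Gi iA] [j Gj jB]; have [k Gk kij] := dir i j Gi Gj.
    exists k => // l Gl kl; have [il jl] := kij l Gl kl.
    by split; [exact: iA|exact: jB].
  - by move=> A B AB [i Gi iA]; exists i => // j Gj ij; apply: AB; exact: iA.
have [|i Gi iP] := cC I F (fun j x => P j x) FF.
  move=> x /loc[i Gi nx].
  exists ((fun y => forall j, G j -> le i j -> C y -> P j y), (fun j => G j /\ le i j)).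
    by split => //=; exists i.
  by move=> [y j] /= [H [Gj ij]] Cy; exact: H.
by exists i => // x Cx; apply: iP => //; exact: lexx.
Qed.

End CompactSets.

Section UscCompact.
Context {R : realType} {T : topologicalType}.
Implicit Types (C : set T) (u v : T -> \bar R).

Definition usc_within C u := forall x, C x -> forall a : R, (u x < a%:E)%E ->
  \forall y \near x, C y -> (u y < a%:E)%E.

(** If there were no maximum, each point x would have a larger value u y, and u
would be smaller than u y near x. The values of u direct C itself, so a single
i in C would satisfy u < u i on C, in particular at i. *)
Lemma usc_max C u : C !=set0 -> compact C -> usc_within C u ->
  (forall x, C x -> (u x < +oo)%E) ->
  exists2 x, C x & forall y, C y -> (u y <= u x)%E.
Proof.
move=> C0 cC uscu uoo; apply: contrapT => nomax.
have H x : C x -> exists2 y, C y & (u x < u y)%E.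
  move=> Cx; apply: contrapT => nx; apply: nomax; exists x => // y Cy.
  by rewrite leNgt; apply/negP => xy; apply: nx; exists y.
have [||||i Ci] := @compact_directed _ C T C (fun i j => (u i <= u j)%E)
  (fun i x => (u x < u i)%E) cC.
- exact: C0.
- by [].
- move=> i j Ci Cj; have [ij|ji] := leP (u i) (u j).
    by exists j => // l _ jl; split => //; exact: le_trans jl.
  by exists i => // l _ il; split => //; apply: le_trans il; exact: ltW.
- move=> x Cx; have [y Cy xy] := H x Cx.
  exists y => //; case E : (u y) xy => [r| |] xy.
  + apply: filterS (uscu x Cx r xy) => z uz j Cj rj Cz.
    by apply: lt_le_trans rj; exact: uz.
  + by have := uoo y Cy; rewrite E.
  + by rewrite ltNge leNye in xy.
by move=> /(_ i Ci); rewrite ltxx.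
Qed.

Lemma usc_bounded C u : compact C -> usc_within C u ->
  (forall x, C x -> (u x < +oo)%E) ->
  exists M : R, forall x, C x -> (u x <= M%:E)%E.
Proof.
move=> cC uscu uoo; have [C0|C0] := pselect (C !=set0); last first.
  by exists 0 => x Cx; exfalso; apply: C0; exists x.
have [x Cx xmax] := usc_max C0 cC uscu uoo.
have := uoo x Cx; case E : (u x) => [r| |]// _; rewrite E in xmax.
  by exists r.
by exists 0 => y /xmax; rewrite leeNy_eq => /eqP ->; exact: leNye.
Qed.

Lemma usc_add C u v : usc_within C u -> usc_within C v ->
  (forall x, C x -> (u x < +oo)%E) -> (forall x, C x -> (v x < +oo)%E) ->
  usc_within C (u \+ v)%E.
Proof.
move=> uscu uscv uoo voo x Cx a uva.
have [b [c [ub vc bca]]] : exists b c : R,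
    [/\ (u x < b%:E)%E, (v x < c%:E)%E & b + c <= a].
  have := uoo x Cx; have := voo x Cx; move: uva => /=.
  case: (u x) => [r| |]//; case: (v x) => [s| |]//.
  - rewrite -EFinD lte_fin => rsa _ _; pose d := (a - r - s) / 2.
    exists (r + d), (s + d); rewrite !lte_fin /d; split; lra.
  - by move=> _ _ _; exists (r + 1), (a - r - 1); rewrite lte_fin ltNyr; split => //; lra.
  - by move=> _ _ _; exists (a - s - 1), (s + 1); rewrite lte_fin ltNyr; split => //; lra.
  - by move=> _ _ _; exists a, 0; rewrite !ltNyr addr0.
apply: filterS2 (uscu x Cx b ub) (uscv x Cx c vc) => y uy vy Cy.
by apply: lt_le_trans (lteD (uy Cy) (vy Cy)) _; rewrite -EFinD lee_fin.
Qed.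

End UscCompact.

Section Usc.
Context {R : realType} {n : nat}.
Local Notation Rn := 'rV[R]_n.
Implicit Types (U V C S : set Rn) (f g h p q : Rn -> R) (u v : Rn -> \bar R).

Lemma usc_on_within U C u : C `<=` U -> usc_on U u -> usc_within C u.
Proof. by move=> CU H x /CU Ux a /(H x Ux); apply: filterS => y + _. Qed.

Lemma within_cont_usc C f : {within C, continuous f} -> usc_within C (EFin \o f).
Proof.
move=> cf x Cx a /=; rewrite lte_fin => fa.
by apply: filterS (within_continuous_lt cf Cx fa) => y H Cy; rewrite lte_fin H.
Qed.

Section Approx.
Context (x0 : Rn) (S : set Rn) (cS : compact S).

Definition approx f := forall e : R, 0 < e ->
  exists2 p, polyfun x0 p & forall x, S x -> `|p x - f x| <= e.

Lemma approx_poly p : polyfun x0 p -> approx p.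
Proof. by move=> pp e e0; exists p => // x _; rewrite subrr normr0 ltW. Qed.

Lemma approx_add f g : approx f -> approx g -> approx (fun x => f x + g x).
Proof.
move=> af ag e e0; have e2 : 0 < e / 2 by lra.
have [p pp pf] := af _ e2; have [q pq qg] := ag _ e2.
exists (fun x => p x + q x); first exact: polyfun_add.
move=> x Sx; rewrite (_ : _ - _ = (p x - f x) + (q x - g x)); last by ring.
apply: le_trans (ler_normD _ _) _; have := pf x Sx; have := qg x Sx; lra.
Qed.

Lemma approx_scale c f : approx f -> approx (fun x => c * f x).
Proof.
move=> af e e0; have c1 : 0 < `|c| + 1 by rewrite ltr_pwDr.
have [p pp pf] := af _ (divr_gt0 e0 c1).
exists (fun x => c * p x); first exact: polyfun_scale.
move=> x Sx; rewrite -mulrBr normrM.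
have := pf x Sx; rewrite ler_pdivlMr// => h.
apply: le_trans h; rewrite mulrC ler_wpM2l// lerDl//.
Qed.

(** The iteration of the classical proof of the Stone-Weierstrass theorem. It
consists of polynomials in t and increases to |t| on [-1, 1]. *)
Fixpoint abs_seq (t : R) (k : nat) : R :=
  if k is k'.+1 then abs_seq t k' + (t ^+ 2 - abs_seq t k' ^+ 2) / 2 else 0.

(** With s the current value, |t| - s is multiplied by 1 - (|t| + s) / 2, which
is at most 1 - (|t| - s) / 2; hence it decays like 2 / (k + 1). *)
Lemma abs_seqP (t : R) k : `|t| <= 1 ->
  [/\ 0 <= abs_seq t k, abs_seq t k <= `|t| & k.+1%:R * (`|t| - abs_seq t k) <= 2].
Proof.
move=> t1; have t0 := normr_ge0 t.
have -> : abs_seq t k = abs_seq `|t| k.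
  by elim: k => //= k ->; rewrite real_normK ?num_real.
move: (`|t|) t0 t1 => {}t t0 t1; elim: k => [|k [IH1 IH2 IH3]] /=.
  by rewrite subr0 mul1r; split => //; lra.
rewrite -(natr1 k.+1); rewrite -(natr1 k) in IH3 *.
move: (abs_seq t k) IH1 IH2 IH3 => s s0 st.
have := ler0n R k; move: (k%:R) => K K0 H.
have h1 : t + s <= 2 by lra.
have h2 : 0 <= (t - s) * (t + s) by apply: mulr_ge0; lra.
have h3 : (t - s) * (t + s) <= (t - s) * 2 by apply: ler_wpM2l; lra.
split; [lra|lra|].
have h4 : 0 <= (2 - (K + 1) * (t - s)) * (1 - (t - s)) by apply: mulr_ge0; lra.
have h5 : 0 <= s * (t - s) * (K + 2) by apply: mulr_ge0; [apply: mulr_ge0|]; lra.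
have h6 : 0 <= (t - s) ^+ 2 by exact: sqr_ge0.
nra.
Qed.

End Approx.
End Usc.

(** * Separation by polynomials and the sub-mean value property *)

Section Separation.
Context {R : realType} {n : nat} (n0 : (0 < n)%N).
Local Notation Rn := 'rV[R]_n.
Implicit Types (U V C S : set Rn) (f g h p q : Rn -> R) (u v : Rn -> \bar R).

Lemma polyfun_abs_seq (x0 : Rn) p k : polyfun x0 p -> polyfun x0 (fun x => abs_seq (p x) k).
Proof.
move=> pp; elim: k => [|k IH]; first exact: polyfun_cst.
have H : polyfun x0 (fun x => abs_seq (p x) k + (2^-1 * (p x * p x) +
  - 2^-1 * (abs_seq (p x) k * abs_seq (p x) k))).
  exact: (polyfun_add IH (polyfun_add (polyfun_scale _ (polyfun_mul pp pp))
    (polyfun_scale _ (polyfun_mul IH IH)))).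
by move: H; congr (polyfun _ _); apply/funext => x /=; field.
Qed.

Lemma compact_cont_bounded S f : compact S -> continuous f ->
  exists2 M, 0 < M & forall x, S x -> `|f x| <= M.
Proof.
move=> cS cf; have cn : continuous (fun x => `|f x|).
  by move=> x; apply: (@continuous_comp _ _ _ f (@Num.norm R R) x);
    [exact: cf|exact: norm_continuous].
have [||M MS] := @usc_bounded _ _ S (EFin \o (fun x => `|f x|)) cS.
- by apply: within_cont_usc; exact: continuous_subspaceT.
- by move=> x _ /=; rewrite ltry.
exists (`|M| + 1); first by rewrite ltr_pwDr.
by move=> x /MS /=; rewrite lee_fin => h; have := ler_norm M; lra.
Qed.

Lemma approx_abs (x0 : Rn) S f : compact S -> approx x0 S f -> approx x0 S (fun x => `|f x|).
Proof.
move=> cS af e e0; have e2 : 0 < e / 2 by lra.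
have [p pp pf] := af _ e2.
have [M M0 MS] := compact_cont_bounded cS (polyfun_continuous pp).
have M1 : 0 <= M^-1 by rewrite invr_ge0 ltW.
(* p / M has values in [-1, 1], and the error 2 / (k + 1) is multiplied by M *)
have [k kP] : exists k, 2 * M / (e / 2) <= k.+1%:R.
  exists (Num.truncn (2 * M / (e / 2))); apply: ltW; exact: truncnS_gt.
exists (fun x => M * abs_seq (M^-1 * p x) k).
  by apply: polyfun_scale; apply: polyfun_abs_seq; exact: polyfun_scale.
move=> x Sx.
have t1 : `|M^-1 * p x| <= 1.
  by rewrite normrM (ger0_norm M1) ler_pdivrMl// mulr1 MS.
have [h1 h2 h3] := abs_seqP k t1.
have E : `|p x| = M * `|M^-1 * p x|.
  by rewrite normrM (ger0_norm M1) mulVKf// gt_eqF.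
have k0 : 0 < k.+1%:R :> R by rewrite ltr0n.
have h4 : `|M * abs_seq (M^-1 * p x) k - `|p x| | <= e / 2.
  rewrite E -mulrBr normrM (gtr0_norm M0) distrC ger0_norm ?subr_ge0//.
  rewrite -(ler_pM2l k0) mulrCA.
  apply: le_trans (_ : M * 2 <= _); first by rewrite ler_pM2l.
  by move: kP; rewrite ler_pdivrMr// [M * 2]mulrC.
rewrite (_ : _ - _ = (M * abs_seq (M^-1 * p x) k - `|p x|) + (`|p x| - `|f x|)); last by ring.
apply: le_trans (ler_normD _ _) _.
have h5 : `| `|p x| - `|f x| | <= e / 2.
  by apply: le_trans (pf x Sx); exact: ler_dist_dist.
lra.
Qed.

Lemma approx_min (x0 : Rn) S f g : compact S -> approx x0 S f -> approx x0 S g ->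
  approx x0 S (fun x => Num.min (f x) (g x)).
Proof.
move=> cS af ag.
have H : approx x0 S (fun x => 2^-1 * ((f x + g x) + -1 * `|f x + -1 * g x|)).
  apply: approx_scale; apply: approx_add; first exact: approx_add.
  apply: approx_scale; apply: (@approx_abs _ _ (fun x => f x + -1 * g x) cS).
  by apply: approx_add => //; exact: approx_scale.
move: H; congr (approx _ _ _); apply/funext => x; rewrite minr_absE mulN1r mulN1r.
by rewrite mulrC.
Qed.

(** The sup norm is bounded by the Euclidean norm. *)
Lemma sqdist_ball (y x : Rn) (r : R) : 0 < r -> sqdist y x < r ^+ 2 -> ball y r x.
Proof.
move=> r0 h; rewrite mx_norm_ball /ball_ /= /Num.norm /=.
rewrite mx_normrE; apply/bigmax_ltP; split => // -[i j] _ /=.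
rewrite ord1 !mxE -(ltr_pXn2r (n := 2)) ?nnegrE ?(ltW r0)//.
rewrite real_normK ?num_real//; apply: le_lt_trans h.
rewrite /sqdist (bigD1 j)//= -sqrrN opprB lerDl; apply: sumr_ge0 => k _; exact: sqr_ge0.
Qed.

(** Below a near y by upper semicontinuity, and away from y the paraboloid exceeds
an upper bound of u on S if it is steep enough. *)
Lemma usc_le_paraboloid S u y (a : R) : compact S -> usc_within S u ->
  (forall x, S x -> (u x < +oo)%E) -> S y -> (u y < a%:E)%E ->
  exists c : R, forall x, S x -> (u x <= (a + c * sqdist y x)%:E)%E.
Proof.
move=> cS uscu uoo Sy ua; have [M MS] := usc_bounded cS uscu uoo.
have /nbhs_ballP[r /= r0 rP] := uscu y Sy a ua.
exists (`|M - a| / r ^+ 2) => x Sx.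
have r2 : 0 < r ^+ 2 by rewrite exprn_gt0.
have c0 : 0 <= `|M - a| / r ^+ 2 by rewrite divr_ge0// ltW.
have [xr|xr] := ltP (sqdist y x) (r ^+ 2).
  apply: (@le_trans _ _ a%:E); first by apply/ltW/rP => //; exact: sqdist_ball.
  by rewrite lee_fin lerDl mulr_ge0// sqdist_ge0.
apply: le_trans (MS x Sx) _; rewrite lee_fin.
have : `|M - a| / r ^+ 2 * r ^+ 2 <= `|M - a| / r ^+ 2 * sqdist y x by rewrite ler_wpM2l.
rewrite mulfVK ?gt_eqF//; have := ler_norm (M - a); lra.
Qed.

(** The pairs of approximable majorants of u and v are directed downwards, because
minima of approximable functions are approximable ([approx_min]). Locally a pair
of paraboloids with sum below g exists, so by compactness one pair works on S. *)
Lemma approx_separation (x0 : Rn) S u v g : compact S ->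
  usc_within S u -> usc_within S v ->
  (forall x, S x -> (u x < +oo)%E) -> (forall x, S x -> (v x < +oo)%E) ->
  continuous g -> (forall x, S x -> (u x + v x < (g x)%:E)%E) ->
  exists phi psi, [/\ approx x0 S phi, approx x0 S psi,
    forall x, S x -> (u x <= (phi x)%:E)%E,
    forall x, S x -> (v x <= (psi x)%:E)%E &
    forall x, S x -> phi x + psi x < g x].
Proof.
move=> cS uscu uscv uoo voo cg uvg.
pose G : set ((Rn -> R) * (Rn -> R)) := [set fg | [/\ approx x0 S fg.1, approx x0 S fg.2,
    forall x, S x -> (u x <= (fg.1 x)%:E)%E &
    forall x, S x -> (v x <= (fg.2 x)%:E)%E]].
pose le (fg fg' : (Rn -> R) * (Rn -> R)) :=
  forall x, S x -> fg'.1 x <= fg.1 x /\ fg'.2 x <= fg.2 x.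
pose P (fg : (Rn -> R) * (Rn -> R)) x := fg.1 x + fg.2 x < g x.
have [||||[phi psi] [h1 h2 h3 h4] h5] := @compact_directed _ S _ G le P cS.
- have [M MS] := usc_bounded cS uscu uoo; have [N NS] := usc_bounded cS uscv voo.
  exists ((fun=> M), (fun=> N)); split => //=; apply: approx_poly; exact: polyfun_cst.
- by move=> fg _ x _.
- move=> [f1 g1] [f2 g2] [/= a1 a2 a3 a4] [/= b1 b2 b3 b4].
  exists ((fun x => Num.min (f1 x) (f2 x)), (fun x => Num.min (g1 x) (g2 x))).
    split => /=; [exact: approx_min|exact: approx_min| |].
      by move=> x Sx; rewrite EFin_min le_min a3// b3.
    by move=> x Sx; rewrite EFin_min le_min a4// b4.
  move=> l _ kl; split => x Sx; have [/=] := kl x Sx; rewrite !le_min.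
    by move=> /andP[-> _] /andP[-> _].
  by move=> /andP[_ ->] /andP[_ ->].
- move=> y Sy.
  have [a [b [ua vb ab]]] : exists a b : R,
      [/\ (u y < a%:E)%E, (v y < b%:E)%E & a + b < g y].
    have := uoo y Sy; have := voo y Sy; have := uvg y Sy.
    case: (u y) => [r| |]//; case: (v y) => [s| |]//.
    + rewrite -EFinD lte_fin => rsa _ _; pose d := (g y - r - s) / 3.
      exists (r + d), (s + d); rewrite !lte_fin /d; split; lra.
    + by move=> _ _ _; exists (r + 1), (g y - r - 2); rewrite lte_fin ltNyr; split => //; lra.
    + by move=> _ _ _; exists (g y - s - 2), (s + 1); rewrite lte_fin ltNyr; split => //; lra.
    + by move=> _ _ _; exists (g y - 1), 0; rewrite !ltNyr; split => //; lra.
  have [c cP] := usc_le_paraboloid cS uscu uoo Sy ua.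
  have [d dP] := usc_le_paraboloid cS uscv voo Sy vb.
  have pq (a' c' : R) : polyfun x0 (fun x => a' + c' * sqdist y x).
    by apply: polyfun_add; [exact: polyfun_cst|apply: polyfun_scale; exact: polyfun_sqdist].
  exists ((fun x => a + c * sqdist y x), (fun x => b + d * sqdist y x)).
    by split => //=; apply: approx_poly.
  have pD : polyfun x0 (fun x => (a + c * sqdist y x) + (b + d * sqdist y x)) by exact: polyfun_add.
  have nD : \forall x \near y, -1 * g x + ((a + c * sqdist y x) + (b + d * sqdist y x)) < 0.
    apply: continuous_lt; last by rewrite sqdist_self; lra.
    apply: (@continuousD _ _ _ (fun x => -1 * g x)); last exact: polyfun_continuous pD _.
    apply: (@continuousM _ _ (cst (-1)) g); [exact: cst_continuous|exact: cg].
  apply: filterS nD => x hx [f1 f2] _ lef Sx; have [/=] := lef x Sx.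
  by rewrite /P /=; lra.
by exists phi, psi.
Qed.

Definition sphere (x0 : Rn) (r2 : R) : set Rn := [set x | sqdist x0 x = r2].
Definition eball (x0 : Rn) (r2 : R) : set Rn := [set x | sqdist x0 x <= r2].

Lemma coord_le_norm (x : Rn) (j : 'I_n) : `|x 0 j| <= `|x|.
Proof.
rewrite [leRHS]/Num.norm /= mx_normrE.
by apply/bigmax_geP; right => /=; exists (ord0, j).
Qed.

Lemma eball_closed x0 r2 : closed (eball x0 r2).
Proof.
have -> : eball x0 r2 = sqdist x0 @^-1` [set t | t <= r2] by [].
apply: preimage_closed; first by move=> x _; exact: sqdist_continuous.
exact: closed_le.
Qed.

Lemma eball_compact x0 r2 : compact (eball x0 r2).
Proof.
apply: bounded_closed_compact; last exact: eball_closed.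
exists (`|x0| + (1 + `|r2|)); split; first by rewrite num_real.
move=> M hM x /= xr; apply: le_trans (ltW hM).
have : `|x - x0| <= 1 + `|r2|.
  rewrite [leLHS]/Num.norm /= mx_normrE; apply/bigmax_leP; split => [|[i j] _ /=].
    by rewrite addr_ge0.
  rewrite ord1 !mxE -(ler_pXn2r (n := 2)) ?nnegrE ?addr_ge0//.
  rewrite real_normK ?num_real//.
  have h1 : (x 0 j - x0 0 j) ^+ 2 <= r2.
    apply: le_trans xr; rewrite /sqdist (bigD1 j)//= lerDl.
    by apply: sumr_ge0 => k _; exact: sqr_ge0.
  have := ler_norm r2; have := normr_ge0 r2; nra.
by have := ler_normD (x - x0) x0; rewrite subrK; lra.
Qed.

Lemma sphere_compact x0 r2 : compact (sphere x0 r2).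
Proof.
apply: (subclosed_compact _ (eball_compact (x0 := x0) (r2 := r2))).
  have -> : sphere x0 r2 = sqdist x0 @^-1` [set t | t = r2] by [].
  apply: preimage_closed; first by move=> x _; exact: sqdist_continuous.
  exact: closed_eq.
by move=> x /= xr; rewrite /eball /= xr.
Qed.

Lemma eball_boundary x0 r2 x : (eball x0 r2 `\` (eball x0 r2)°) x -> sphere x0 r2 x.
Proof.
move=> [/= xr nx]; apply/eqP; rewrite eq_le xr /= leNgt; apply/negP => lt.
apply: nx; have := continuous_lt (@sqdist_continuous _ _ x0 x) lt.
by apply: filterS => y /ltW.
Qed.

Lemma eball_center x0 r2 : 0 <= r2 -> eball x0 r2 x0.
Proof. by move=> r0; rewrite /eball /= sqdist_self. Qed.

(** The harmonic majorization property restricted to a single ball and to harmonic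
polynomials. It keeps enough of subharmonicity for the maximum principle and
is visibly additive, see [submeanD]. *)
Definition submean x0 r2 u := forall h, harmpoly x0 h ->
  (forall x, sphere x0 r2 x -> (u x <= (h x)%:E)%E) -> (u x0 <= (h x0)%:E)%E.

Lemma subharmonic_submean U x0 r2 u : 0 <= r2 -> eball x0 r2 `<=` U ->
  subharmonic U u -> submean x0 r2 u.
Proof.
move=> r0 BU [_ _ H] h hh uh; have [ph _] := hh.
apply: (H _ h (eball_compact (x0 := x0) (r2 := r2)) BU).
- by apply: continuous_subspaceT; exact: polyfun_continuous ph.
- exact: harmpoly_harmonic hh.
- by move=> x /eball_boundary; exact: uh.
- exact: eball_center.
Qed.

Lemma harmpoly_submean x0 r2 g : 0 <= r2 -> harmpoly x0 g -> submean x0 r2 (EFin \o g).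
Proof.
move=> r0 hg; have [pg Lg] := hg.
apply: (subharmonic_submean (U := setT)) => //.
apply: (C2_subharmonic n0 openT (polyfun_C2 pg)); first by move=> x _; rewrite Lg.
by move=> x _; exact: polyfun_continuous pg x.
Qed.

(** Up to a small error u and v are majorized on the sphere by harmonic polynomials
hp and hq whose sum is at most h there. The inequality at the centre follows by
applying the hypotheses to hp and hq and the maximum principle to hp + hq - h. *)
Lemma submeanD x0 r2 u v : 0 <= r2 ->
  usc_within (sphere x0 r2) u -> usc_within (sphere x0 r2) v ->
  (forall x, sphere x0 r2 x -> (u x < +oo)%E) ->
  (forall x, sphere x0 r2 x -> (v x < +oo)%E) ->
  submean x0 r2 u -> submean x0 r2 v -> submean x0 r2 (u \+ v)%E.
Proof.
move=> r0 uscu uscv uoo voo su sv h hh uvh; have [ph _] := hh.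
apply/lee_addgt0Pr => e e0; rewrite -EFinD.
(* hp + d and hq + d majorize u and v, and hp + hq <= h + 3 d, all on the sphere *)
pose d := e / 5; have d0 : 0 < d by rewrite /d; lra.
have cS := @sphere_compact x0 r2.
have cg : continuous (fun x => h x + d).
  move=> x; apply: (@continuousD _ _ _ h (cst d)); last exact: cst_continuous.
  exact: polyfun_continuous ph x.
have [|phi [psi [aphi apsi uphi vpsi pp]]] := approx_separation x0 cS uscu uscv uoo voo cg.
  move=> x Sx; apply: le_lt_trans (uvh x Sx) _; by rewrite lte_fin ltrDl.
have [p pp1 Hp] := aphi _ d0; have [q pq1 Hq] := apsi _ d0.
have [hp hhp Ep] := harmpoly_sphere n0 r2 pp1; have [hq hhq Eq] := harmpoly_sphere n0 r2 pq1.
have hp' : harmpoly x0 (fun x => 1 * hp x + d) := harmpoly_lin 1 hhp (harmpoly_cst x0 d).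
have hq' : harmpoly x0 (fun x => 1 * hq x + d) := harmpoly_lin 1 hhq (harmpoly_cst x0 d).
have h1 : (u x0 <= (1 * hp x0 + d)%:E)%E.
  apply: (su _ hp') => x Sx; apply: le_trans (uphi x Sx) _.
  rewrite lee_fin mul1r Ep//; have := Hp x Sx; rewrite ler_norml => /andP[]; lra.
have h2 : (v x0 <= (1 * hq x0 + d)%:E)%E.
  apply: (sv _ hq') => x Sx; apply: le_trans (vpsi x Sx) _.
  rewrite lee_fin mul1r Eq//; have := Hq x Sx; rewrite ler_norml => /andP[]; lra.
have h3 : 1 * hp x0 + hq x0 <= 1 * h x0 + 3 * d.
  have hh3 : harmpoly x0 (fun x => 1 * h x + 3 * d) := harmpoly_lin 1 hh (harmpoly_cst x0 (3 * d)).
  have := harmpoly_submean r0 (harmpoly_lin 1 hhp hhq) hh3; rewrite /= lee_fin; apply.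
  move=> x Sx; rewrite lee_fin (Ep x Sx) (Eq x Sx).
  have := Hp x Sx; have := Hq x Sx; have := pp x Sx; rewrite !ler_norml.
  by move=> h4 /andP[h5 h6] /andP[h7 h8]; lra.
apply: le_trans (leeD h1 h2) _; rewrite -EFinD lee_fin.
rewrite /d in h3 *; lra.
Qed.

End Separation.

(** * The sum of two subharmonic functions *)

Section Sum.
Context {R : realType} {n : nat} (n0 : (0 < n)%N).
Local Notation Rn := 'rV[R]_n.
Implicit Types (U V C S : set Rn) (f g h p q : Rn -> R) (u v : Rn -> \bar R).

Lemma eball_small V (x : Rn) : open V -> V x ->
  exists2 r2 : R, 0 < r2 & eball x r2 `<=` V.
Proof.
move=> oV Vx; have /nbhs_ballP[r /= r0 rV] := open_near oV Vx.
exists (r ^+ 2 / 2); first by rewrite divr_gt0 ?exprn_gt0.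
move=> y yr; apply/rV/sqdist_ball => //; apply: le_lt_trans yr _.
have : 0 < r ^+ 2 by rewrite exprn_gt0.
lra.
Qed.

Lemma sphere_eball (x : Rn) r2 : sphere x r2 `<=` eball x r2.
Proof. by move=> y; rewrite /sphere /eball /= => ->. Qed.

(** Squared distances to two points differ by an affine function. *)
Lemma sqdist_sphere (x y : Rn) : exists2 l, harmpoly x l &
  (l x = sqdist y x) /\ forall z, sqdist y z = sqdist x z + l z.
Proof.
pose l (z : Rn) := \sum_(i < n) (2 * (x 0 i - y 0 i) * z 0 i +
   (- 2 * (x 0 i - y 0 i) * x 0 i + (x 0 i - y 0 i) ^+ 2)).
exists l.
  rewrite /l; elim: (index_enum _) => [|i s IH].
    have := harmpoly_cst x (0 : R); congr (harmpoly _ _); apply/funext => z.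
    by rewrite big_nil.
  have := harmpoly_lin 1 (harmpoly_lin (2 * (x 0 i - y 0 i)) (harmpoly_coord x i)
    (harmpoly_cst x (- 2 * (x 0 i - y 0 i) * x 0 i + (x 0 i - y 0 i) ^+ 2))) IH.
  congr (harmpoly _ _); apply/funext => z.
  by rewrite big_cons mul1r.
split; first by apply: eq_bigr => i _; ring.
by move=> z; rewrite /sqdist -big_split; apply: eq_bigr => i _ /=; ring.
Qed.

Lemma harmonicN_subharmonic U h : open U -> harmonic_on U h ->
  (forall x, U x -> {for x, continuous h}) -> subharmonic U (fun x => (- h x)%:E).
Proof.
move=> oU [Ch Lh] ch.
have C0 : C2_on U (fun=> 0 : R) := C2_on_sub (@subsetT _ _) (polyfun_C2 (polyfun_cst 0 0)).
have := @C2_subharmonic _ _ n0 U (fun x => -1 * h x + 0) oU (C2_on_lin (-1) oU Ch C0).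
have E : (EFin \o fun x => -1 * h x + 0) = fun x => (- h x)%:E.
  by apply/funext => x /=; rewrite addr0 mulN1r.
rewrite E; apply.
- move=> x Ux; rewrite (laplacian_lin (-1) oU Ux Ch C0) Lh// mulr0 add0r.
  by rewrite (harmpoly_cst (0 : Rn) (0 : R)).2.
- move=> x Ux; apply: (@continuousD _ _ _ (fun x => -1 * h x) (cst 0) x); last exact: cst_continuous.
  by apply: (@continuousM _ _ (cst (-1)) h x); [exact: cst_continuous|exact: ch].
Qed.

Lemma continuous_interior C h x : {within C, continuous h} -> C° x ->
  {for x, continuous h}.
Proof.
move=> ch Cx; have := ch x; rewrite /continuous_at /prop_for.
by rewrite -(nbhs_subspace_interior Cx).
Qed.

(** Suppose that w = u + v - h is positive at y although it is at most 0 on the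
boundary of C. With a small e the function w + e |x - y|^2 attains its maximum
over C at an interior point x. On a small sphere about x, |z - y|^2 is the sum
of the constant r2 and of a harmonic polynomial, and so the sub-mean value
inequality for w contradicts the maximality by the amount e r2. *)
Lemma subharmonicD U u v : open U -> subharmonic U u -> subharmonic U v ->
  subharmonic U (u \+ v)%E.
Proof.
move=> oU su sv; have [uoo uscu Hu] := su; have [voo uscv Hv] := sv.
have uvoo x : U x -> (u x + v x < +oo)%E.
  by move=> Ux; rewrite lte_add_pinfty// ?uoo ?voo.
have uscuv : usc_within U (u \+ v)%E.
  have UU : U `<=` U by [].
  exact: (usc_add (usc_on_within UU uscu) (usc_on_within UU uscv) uoo voo).
split => //.
  move=> x Ux a xa.
  by apply: filterS2 (open_near oU Ux) (uscuv x Ux a xa) => z Uz; exact.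
move=> C h cC CU ch hh bd y Cy; rewrite leNgt; apply/negP => hy.
have Ci : C° `<=` C := @interior_subset _ C.
pose w := ((u \+ v) \+ (fun x => (- h x)%:E))%E.
have wE x : w x = (u x + v x - (h x)%:E)%E by rewrite /w /= EFinN.
have woo x : C x -> (w x < +oo)%E.
  by move=> Cx; rewrite /w /= lte_add_pinfty ?ltry// uvoo//; exact: CU.
have chN : {within C, continuous (fun x => - h x)}.
  by move=> x; apply: (@continuousN _ _ (subspace C) h); exact: ch.
have uscw : usc_within C w.
  apply: usc_add; [|exact: within_cont_usc chN| |].
  - by apply: usc_on_within CU _ => x Ux a xa; apply: filterS2 (open_near oU Ux) (uscuv x Ux a xa) => z Uz; exact.
  - by move=> x /CU; exact: uvoo.
  - by move=> x _; rewrite ltry.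
have wy : (0 < w y)%E by rewrite wE sube_gt0.
have /fineK : w y \is a fin_num by rewrite gt0_fin_numE// woo.
set b := fine _ => bE.
have b0 : 0 < b by rewrite -lte_fin bE.
have C0 : C !=set0 by exists y.
have csqd : {within C, continuous (sqdist y)}.
  by apply: continuous_subspaceT; exact: sqdist_continuous.
have [m Cm mmax] := compact_max C0 cC csqd.
have m0 := sqdist_ge0 y m.
(* chosen so that e |x - y|^2 < b on C, where m is the point of C farthest from y *)
pose e := b / (2 * (1 + sqdist y m)).
have e0 : 0 < e by rewrite /e divr_gt0//; lra.
have em : e * sqdist y m < b.
  rewrite /e mulrAC ltr_pdivrMr; last by lra.
  by rewrite ltr_pM2l//; lra.
pose W := (w \+ (fun x => (e * sqdist y x)%:E))%E.
have cesqd : {within C, continuous (fun x => e * sqdist y x)}.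
  apply: continuous_subspaceT => x.
  by apply: (@continuousM _ _ (cst e) (sqdist y) x);
    [exact: cst_continuous|exact: sqdist_continuous].
have [|x Cx xmax] := usc_max C0 cC (usc_add uscw (within_cont_usc cesqd) woo (fun x _ => ltry _)).
  by move=> x Cx /=; rewrite lte_add_pinfty ?ltry// woo.
rewrite /= in xmax.
have wx : (0 < w x)%E.
  have := xmax y Cy; rewrite sqdist_self mulr0 adde0 -bE => h1.
  have h2 : e * sqdist y x < b by apply: le_lt_trans em; rewrite ler_pM2l// mmax.
  have := woo x Cx; move: h1; case: (w x) => [r| |]//.
  by rewrite -EFinD !lee_fin lte_fin; lra.
have /fineK : w x \is a fin_num by rewrite gt0_fin_numE// woo.
set a := fine _ => aE.
have Cix : C° x.
  apply: contrapT => nCx; move: wx; rewrite wE sube_gt0 ltNge.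
  by rewrite bd.
have oC : open C° by exact: open_interior.
have [r2 r20 Br] := eball_small oC Cix.
have [l hl [lx lE]] := sqdist_sphere x y.
have SC : sphere x r2 `<=` C by move=> z /sphere_eball /Br /Ci.
have BU : eball x r2 `<=` U by move=> z /Br /Ci /CU.
have sh : submean x r2 (fun x => (- h x)%:E).
  apply: (subharmonic_submean (ltW r20) Br); apply: harmonicN_subharmonic => //.
  by move=> z; exact: continuous_interior.
have suv : submean x r2 (u \+ v)%E.
  apply: (submeanD n0 (ltW r20)).
  - exact: usc_on_within (fun z hz => CU _ (SC _ hz)) uscu.
  - exact: usc_on_within (fun z hz => CU _ (SC _ hz)) uscv.
  - by move=> z /SC /CU; exact: uoo.
  - by move=> z /SC /CU; exact: voo.
  - exact: subharmonic_submean (ltW r20) BU su.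
  - exact: subharmonic_submean (ltW r20) BU sv.
have sw : submean x r2 w.
  apply: (submeanD n0 (ltW r20)) => //.
  - by move=> z Sz c zc; have := uscuv z (CU _ (SC _ Sz)) c zc; apply: filterS => t ht /SC /CU.
  - by move=> z Sz c zc; have := within_cont_usc chN (SC _ Sz) zc; apply: filterS => t ht /SC.
  - by move=> z /SC /CU; exact: uvoo.
  - by move=> z _; rewrite ltry.
have hq : harmpoly x (fun z => - e * l z + (a + e * sqdist y x - e * r2)) :=
  harmpoly_lin (- e) hl (harmpoly_cst x _).
have := sw _ hq; rewrite /= -aE lee_fin => H.
suff : a <= - e * l x + (a + e * sqdist y x - e * r2).
  rewrite lx => h1; have : 0 < e * r2 by rewrite mulr_gt0.
  lra.
apply: H => z Sz; have := xmax z (SC _ Sz).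
rewrite lE Sz -aE -EFinD.
case: (w z) => [s| |].
- by rewrite -EFinD !lee_fin; lra.
- by rewrite addye.
- by move=> _; exact: leNye.
Qed.

End Sum.

(** * Perron envelopes of the squared distance *)

Section Translate.
Context {R : realType} {n : nat}.
Local Notation Rn := 'rV[R]_n.
Implicit Types (U V C S : set Rn) (f g h p q : Rn -> R) (u v : Rn -> \bar R).

Lemma translate_quot h (a x v : Rn) :
  (fun t : R => t^-1 *: (h (t *: v + x - a) - h (x - a))) =
  (fun t : R => t^-1 *: (h (t *: v + (x - a)) - h (x - a))).
Proof. by apply/funext => t; rewrite addrA. Qed.

Lemma partial_translate (i : 'I_n) h (a : Rn) :
  partial i (fun x => h (x - a)) = fun x => partial i h (x - a).
Proof. by apply/funext => x; rewrite /partial /derive /= translate_quot. Qed.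

Lemma translate_continuous (a : Rn) : continuous (fun x : Rn => x + a).
Proof.
move=> x; apply: (@continuousD _ _ _ (fun y : Rn => y) (cst a) x).
  exact: cvg_id.
exact: cst_continuous.
Qed.

Lemma C1_on_translate U h a : C1_on U h ->
  C1_on [set x | U (x - a)] (fun x => h (x - a)).
Proof.
move=> Ch x /= Ux i; have [dh ch] := Ch _ Ux i; split.
  by move: dh; rewrite /derivable /= translate_quot.
rewrite partial_translate.
apply: (@continuous_comp Rn Rn R (fun y : Rn => y - a) (partial i h) x); last exact: ch.
exact: (@translate_continuous (- a)).
Qed.

Lemma harmonic_on_translate U h a : harmonic_on U h ->
  harmonic_on [set x | U (x - a)] (fun x => h (x - a)).
Proof.
move=> [[C1h C2h] Lh]; split; last first.
  move=> x /= Ux; rewrite -[RHS](Lh _ Ux) /laplacian.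
  by apply: eq_bigr => i _; rewrite !partial_translate.
split; first exact: C1_on_translate.
by move=> i; rewrite partial_translate; exact: (C1_on_translate (C2h i)).
Qed.

(** The boundary conditions on a compact C are those on its translate. *)
Lemma subharmonic_translate u (a : Rn) : subharmonic setT u ->
  subharmonic setT (fun x => u (x + a)).
Proof.
move=> [u1 u2 u3]; split.
- by move=> x _; exact: u1.
- by move=> x _ b ub; exact: translate_continuous (u2 (x + a) I b ub).
move=> C h cC _ ch hh bd x Cx.
pose D := [set y : Rn | C (y - a)].
have DE : D = (fun x => x + a) @` C.
  apply/seteqP; split => y /=; first by move=> Cy; exists (y - a) => //; rewrite subrK.
  by move=> [t Ct <-]; rewrite /D /= addrK.
have cD : compact D.
  rewrite DE; apply: continuous_compact => //; apply: continuous_subspaceT.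
  exact: translate_continuous.
have Dint : D° `<=` [set y | C° (y - a)].
  move=> y Dy /=.
  have nD : nbhs (y - a + a) D by rewrite subrK.
  have H : \forall t \near (y - a), D (t + a) := @translate_continuous a (y - a) _ nD.
  by apply: filterS H => t; rewrite /D /= addrK.
have intD : [set y | C° (y - a)] `<=` D°.
  by move=> y Cy; exact: (@translate_continuous (- a) y _ Cy).
have -> : h x = h (x + a - a) by rewrite addrK.
apply: (u3 D (fun y => h (y - a)) cD); [exact: subsetT| | | |].
- apply/subspace_continuousP => y Dy.
  have [ch' _] := @subspace_continuousP _ C _ h.
  apply: (@cvg_comp _ _ _ (fun y : Rn => y - a) h); last exact: ch' ch _ Dy.
  move=> A wA.
  have H : \forall t \near y, C (t - a) -> A (t - a) := @translate_continuous (- a) y _ wA.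
  exact: H.
- have [[h1 h2] h3] := harmonic_on_translate a hh.
  split; last by move=> y /Dint; exact: h3.
  split; first exact: C1_on_sub h1.
  by move=> i; exact: C1_on_sub (h2 i).
- move=> y [Dy nDy]; rewrite -{1}(subrK a y); apply: bd; split => // Cy.
  by apply: nDy; exact: intD.
- by rewrite /D /= addrK.
Qed.

End Translate.

Section Envelope.
Context {R : realType} {n : nat} (n0 : (0 < n)%N).
Local Notation Rn := 'rV[R]_n.
Context (K : set Rn) (cK : compact K) (z : Rn).
Implicit Types (U V C S : set Rn) (f g h p q : Rn -> R) (u v s : Rn -> \bar R) (r : R).
Local Notation f := (sqdist z).

Definition tube r : set Rn := [set x | exists2 y, K y & `|x - y| < r].

Lemma tube_le r r' : r <= r' -> tube r `<=` tube r'.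
Proof. by move=> rr' x [y Ky xy]; exists y => //; exact: lt_le_trans rr'. Qed.

Lemma tube_sub r : 0 < r -> K `<=` tube r.
Proof. by move=> r0 x Kx; exists x => //; rewrite subrr normr0. Qed.

Lemma tube_trans r x y : tube r x -> tube (r + `|y - x|) y.
Proof.
move=> [t Kt xt]; exists t => //.
rewrite (_ : y - t = (x - t) + (y - x)); last by rewrite [RHS]addrC addrA subrK.
by apply: le_lt_trans (ler_normD _ _) _; rewrite ltrD2r.
Qed.

Lemma ball_rV (x y : Rn) r : ball x r y = (`|y - x| < r) :> Prop.
Proof. by rewrite mx_norm_ball /ball_ /= distrC. Qed.

Lemma near_dist (x : Rn) r : 0 < r -> \forall y \near x, `|y - x| < r.
Proof.
move=> r0; apply: (filterS _ (nbhsx_ballx x r r0)) => y.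
by rewrite ball_rV.
Qed.

Lemma tube_open r : open (tube r).
Proof.
rewrite openE => x [y Ky xy]; have e0 : 0 < r - `|x - y| by rewrite subr_gt0.
apply: filterS (near_dist x e0) => t tx; exists y => //.
rewrite (_ : t - y = (x - y) + (t - x)); last by rewrite [RHS]addrC addrA subrK.
by apply: le_lt_trans (ler_normD _ _) _; rewrite addrC -ltrBrDr.
Qed.

Definition subsolutions r : set (Rn -> \bar R) :=
  [set s | subharmonic setT s /\ forall x, ~ tube r x -> (s x <= (f x)%:E)%E].

Definition perron r x : \bar R := ereal_sup [set s x | s in subsolutions r].

Lemma perron_ub r s x : subsolutions r s -> (s x <= perron r x)%E.
Proof. by move=> Fs; apply: ereal_sup_ubound; exists s. Qed.

Lemma perron_le r x (b : \bar R) : (forall s, subsolutions r s -> (s x <= b)%E) -> (perron r x <= b)%E.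
Proof. by move=> H; apply: ge_ereal_sup => _ [s Fs <-]; exact: H. Qed.

Lemma subsolutions_le r r' : r <= r' -> subsolutions r `<=` subsolutions r'.
Proof. by move=> rr' s [ss sf]; split => // x nx; apply: sf => /(tube_le rr'). Qed.

Lemma le_perron r r' x : r <= r' -> (perron r x <= perron r' x)%E.
Proof. by move=> rr'; apply: perron_le => s /(subsolutions_le rr'); exact: perron_ub. Qed.

Lemma sqdist_subharmonic : subharmonic setT (EFin \o f).
Proof.
apply: (C2_subharmonic n0 openT (hompoly_C2 (hompoly_sqdist z))).
  by move=> x _; rewrite laplacian_sqdist mulr_ge0.
by move=> x _; exact: sqdist_continuous.
Qed.

Lemma sqdist_subsolution r : subsolutions r (EFin \o f).
Proof. by split => //; exact: sqdist_subharmonic. Qed.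

Lemma perron_ge r x : ((f x)%:E <= perron r x)%E.
Proof. exact: (perron_ub x (sqdist_subsolution r)). Qed.

Lemma harmpoly_subharmonic (x0 : Rn) h : harmpoly x0 h -> subharmonic setT (EFin \o h).
Proof.
move=> [ph Lh]; apply: (C2_subharmonic n0 openT (polyfun_C2 ph)).
  by move=> x _; rewrite Lh.
by move=> x _; exact: polyfun_continuous ph x.
Qed.

(** The function s(. + (x - y)) - l, where l is the affine function
f(. + (x - y)) - f, is subharmonic. Off the larger tube its argument is off the
smaller tube, so it is at most f(. + (x - y)) - l = f and belongs to the larger
family. At y it is s x - (f x - f y). *)
Lemma perron_translate r r' s (x y : Rn) : subsolutions r s -> r + `|x - y| <= r' ->
  (s x <= perron r' y + (f x - f y)%:E)%E.
Proof.
move=> [ss sf] rr'; pose a := x - y.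
pose l (t : Rn) := \sum_(i < n) (- 2 * a 0 i * t 0 i + (2 * a 0 i * z 0 i - a 0 i ^+ 2)).
have lE t : l t = f t - f (t + a).
  rewrite /l /sqdist -sumrB; apply: eq_bigr => i _; rewrite !mxE; ring.
have hl : harmpoly 0 l.
  rewrite /l; elim: (index_enum _) => [|i e IH].
    have := harmpoly_cst (0 : Rn) (0 : R); congr (harmpoly _ _); apply/funext => t.
    by rewrite big_nil.
  have := harmpoly_lin 1 (harmpoly_lin (- 2 * a 0 i) (harmpoly_coord 0 i)
    (harmpoly_cst 0 (2 * a 0 i * z 0 i - a 0 i ^+ 2))) IH.
  congr (harmpoly _ _); apply/funext => t.
  by rewrite big_cons mul1r.
pose w := ((fun t : Rn => s (t + a)%R) \+ (EFin \o l))%E.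
have Fw : subsolutions r' w.
  split; first by apply: (subharmonicD n0 openT) (harmpoly_subharmonic hl); exact: subharmonic_translate.
  move=> t nt; rewrite /w /= lE.
  have : (s (t + a)%R <= (f (t + a))%:E)%E.
    apply: sf => /(@tube_trans _ _ t) H; apply: nt; apply: tube_le H.
    by rewrite opprD addrA subrr add0r normrN.
  case: (s (t + a)%R) => [b| |].
  - by rewrite -EFinD !lee_fin; lra.
  - by [].
  - by move=> _; exact: leNye.
have := perron_ub y Fw; rewrite /w /= lE /a [y + _]addrC subrK => H.
by rewrite -leeBlDr// -EFinN opprB.
Qed.

End Envelope.

Section EnvelopeRegularity.
Context {R : realType} {n : nat} (n0 : (0 < n)%N).
Local Notation Rn := 'rV[R]_n.
Context (K : set Rn) (cK : compact K) (z : Rn).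
Implicit Types (U V C S : set Rn) (f g h p q : Rn -> R) (u v s : Rn -> \bar R) (r : R).
Local Notation f := (sqdist z).
Local Notation tube := (tube K).
Local Notation subsolutions := (subsolutions K z).
Local Notation perron := (perron K z).

Lemma sqdist_le_norm (x : Rn) : sqdist z x <= n%:R * `|x - z| ^+ 2.
Proof.
rewrite /sqdist -[n in n%:R]card_ord mulr_natl -sumr_const; apply: ler_sum => i _.
rewrite -(real_normK (num_real (x 0 i - z 0 i))) lerXn2r ?nnegrE//.
by have := coord_le_norm (x - z) i; rewrite !mxE.
Qed.

Lemma tube_bounded r : exists M, forall x, tube r x -> f x < M.
Proof.
have [B [_ BK]] := compact_bounded cK.
have B1 : B < `|B| + 1 by have := ler_norm B; lra.
have {}BK := BK _ B1.
exists (n%:R * (`|B| + 1 + `|r| + `|z|) ^+ 2 + 1) => x [y Ky xy].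
apply: (@le_lt_trans _ _ (n%:R * (`|B| + 1 + `|r| + `|z|) ^+ 2)); last by rewrite ltrDl.
apply: le_trans (sqdist_le_norm x) _; apply: ler_wpM2l => //.
rewrite lerXn2r ?nnegrE// ?addr_ge0//.
rewrite (_ : x - z = (x - y) + y - z); last by rewrite subrK.
have := ler_normB (x - y + y) z; have := ler_normD (x - y) y.
have := BK y Ky; have := ler_norm r; rewrite /=; lra.
Qed.

(** Outside a large ball containing the tube the functions of the family are at
most f. The maximum principle on the ball bounds them by the constant value of f
on its boundary. *)
Lemma subsolutions_bounded r : exists M : R, forall s x, subsolutions r s -> tube r x -> (s x <= M%:E)%E.
Proof.
have [M MP] := tube_bounded r; exists M => s x [ss sf] tx.
apply: (subharmonic_le_cst (U := setT) ss (eball_compact (x0 := z) (r2 := M))); last exact: (ltW (MP x tx)).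
  exact: subsetT.
move=> y /eball_boundary yM; have ny : ~ tube r y.
  by move=> /MP; rewrite yM ltxx.
by apply: le_trans (sf y ny) _; rewrite yM.
Qed.

Lemma perron_out r x : ~ tube r x -> (perron r x <= (f x)%:E)%E.
Proof. by move=> nx; apply: perron_le => s [_]; exact. Qed.

Lemma perron_lty r x : (perron r x < +oo)%E.
Proof.
have [M MP] := subsolutions_bounded r.
have [tx|nx] := pselect (tube r x); last by apply: le_lt_trans (perron_out nx) _; rewrite ltry.
by apply: (@le_lt_trans _ _ M%:E); [apply: perron_le => s Fs; exact: MP|rewrite ltry].
Qed.

Lemma perron_fin r x : exists b : R, perron r x = b%:E.
Proof.
have := perron_lty r x; have := perron_ge n0 K z r x.
by case: (perron r x) => [b| |]// _ _; exists b.
Qed.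

Lemma perron_translate_le r r' (x y : Rn) : r + `|x - y| <= r' ->
  (perron r x <= perron r' y + (f x - f y)%:E)%E.
Proof. by move=> rr'; apply: perron_le => s Fs; exact: perron_translate Fs rr'. Qed.

(** The quantitative form of upper semicontinuity which [perron_translate_le]
gives: the value at x in the larger tube controls the values near x in all the
smaller tubes. *)
Lemma perron_near r r' x (a : R) : r < r' -> (perron r' x < a%:E)%E ->
  \forall y \near x, forall r1, r1 <= (r + r') / 2 -> (perron r1 y < a%:E)%E.
Proof.
move=> rr' ea; have [b bE] := perron_fin r' x.
have ba : b < a by rewrite -lte_fin -bE.
have d0 : 0 < (r' - r) / 2 by lra.
have n1 : \forall y \near x, f y < f x + (a - b).
  by apply: continuous_lt; [exact: sqdist_continuous|lra].
apply: filterS2 n1 (near_dist x d0) => y fy yd r1 r1r.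
apply: le_lt_trans (perron_translate_le (r' := r') (y := x) _) _; first by lra.
by rewrite bE -EFinD lte_fin; lra.
Qed.

Lemma perron_near_gt r r' x (a : R) : r < r' -> (a%:E < perron r x)%E ->
  \forall y \near x, forall r1, (r + r') / 2 <= r1 -> (a%:E < perron r1 y)%E.
Proof.
move=> rr' ea; have [b bE] := perron_fin r x.
have ba : a < b by rewrite -lte_fin -bE.
have d0 : 0 < (r' - r) / 2 by lra.
have n1 : \forall y \near x, -1 * f y < -1 * f x + (b - a).
  apply: continuous_lt; last by lra.
  by apply: (@continuousM _ _ (cst (-1)) f x); [exact: cst_continuous|exact: sqdist_continuous].
apply: filterS2 n1 (near_dist x d0) => y fy yd r1 r1r.
have := perron_translate_le (r := r) (r' := r1) (x := x) (y := y).
rewrite distrC => /(_ _)/wrap[]; first by lra.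
rewrite bE; have [c ->] := perron_fin r1 y.
by rewrite -EFinD lee_fin lte_fin; lra.
Qed.

(** The limit of perron r' as r' decreases to r. *)
Definition upper_perron r x : \bar R := ereal_inf [set perron r' x | r' in [set r' | r < r']].

Lemma upper_perron_le r r' x : r < r' -> (upper_perron r x <= perron r' x)%E.
Proof. by move=> rr'; apply: ereal_inf_lbound; exists r'. Qed.

Lemma upper_perron_lt r x (a : \bar R) : (upper_perron r x < a)%E -> exists2 r', r < r' & (perron r' x < a)%E.
Proof. by move=> /ereal_inf_lt[_ [r' rr' <-]] h; exists r'. Qed.

Lemma le_upper_perron r x (b : \bar R) : (forall r', r < r' -> (b <= perron r' x)%E) -> (b <= upper_perron r x)%E.
Proof. by move=> H; apply: le_ereal_inf_tmp => _ [r' rr' <-]; exact: H. Qed.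

Lemma perron_le_upper r x : (perron r x <= upper_perron r x)%E.
Proof. by apply: le_upper_perron => r' rr'; apply: le_perron; exact: ltW. Qed.

Lemma boundary_compact C : compact C -> compact (C `\` C°).
Proof.
move=> cC; rewrite setDE; apply: compact_closedI => //.
exact: open_closedC (@open_interior _ C).
Qed.

(** On the compact boundary of C, Dini's argument gives a single r' with
perron r' < h + e. Each function of the family of r' is then at most h + e on C,
and so is its supremum. *)
Lemma upper_perron_subharmonic r : subharmonic setT (upper_perron r).
Proof.
split.
- by move=> x _; apply: le_lt_trans (upper_perron_le x (ltr_pwDr ltr01 (lexx r))) (perron_lty _ _).
- move=> x _ a /upper_perron_lt[r' rr' ea].
  apply: filterS (perron_near rr' ea) => y H.
  by apply: le_lt_trans (upper_perron_le y _) (H ((r + r') / 2) _); lra.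
move=> C h cC _ ch hh bd x Cx; apply/lee_addgt0Pr => e e0; rewrite -EFinD.
have [||||r' rr' H] := @compact_directed _ (C `\` C°) R [set r' | r < r']
  (fun i j => j <= i) (fun r' y => (perron r' y < (h y + e)%:E)%E) (boundary_compact cC).
- by exists (r + 1); rewrite /= ltrDl.
- by [].
- move=> i j /= ri rj; exists (Num.min i j); first by rewrite lt_min ri rj.
  by move=> l _; rewrite le_min => /andP[-> ->].
- move=> y [Cy nCy].
  have hy : (upper_perron r y < (h y + e)%:E)%E.
    by apply: le_lt_trans (bd y (conj Cy nCy)) _; rewrite lte_fin ltrDl.
  have [r' rr' ea] := upper_perron_lt hy; have [b bE] := perron_fin r' y.
  move: ea; rewrite bE lte_fin => be.
  pose b' := (b + h y + e) / 2.
  have bb' : (perron r' y < b'%:E)%E by rewrite bE lte_fin /b'; lra.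
  have chN : {within C, continuous (fun x => - h x)}.
    by move=> t; apply: (@continuousN _ _ (subspace C) h); exact: ch.
  have hb : - h y < e - b' by rewrite /b'; lra.
  exists ((r + r') / 2); first by rewrite /=; lra.
  apply: filterS2 (perron_near rr' bb') (within_continuous_lt chN Cy hb) => t H1 H2 j rj /= jr [Ct _].
  by apply: lt_trans (H1 j jr) _; rewrite lte_fin; have := H2 Ct; lra.
apply: le_trans (upper_perron_le x rr') _; apply: perron_le => s Fs.
have [_ _ ss] := subharmonic_addcst (- e) Fs.1.
have se t (b : R) : (s t + (- e)%:E <= b%:E)%E = (s t <= (b + e)%:E)%E.
  by rewrite EFinN leeBlDr// EFinD.
rewrite -se; apply: (ss C h cC) => // y Cy.
by rewrite se; apply: le_trans (perron_ub y Fs) _; apply/ltW/H.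
Qed.

(** The limit of perron r' as r' increases to r. *)
Definition lower_perron r x : \bar R :=
  ereal_sup [set perron r' x | r' in [set r' | 0 < r' < r]].

Lemma lower_perron_ge r r' x : 0 < r' < r -> (perron r' x <= lower_perron r x)%E.
Proof. by move=> rr'; apply: ereal_sup_ubound; exists r'. Qed.

Lemma lower_perron_gt r x (a : \bar R) : (a < lower_perron r x)%E ->
  exists2 r', 0 < r' < r & (a < perron r' x)%E.
Proof. by move=> /ereal_sup_gt[_ [r' rr' <-]] h; exists r'. Qed.

Lemma lower_perron_le r x : (lower_perron r x <= perron r x)%E.
Proof. by apply: ge_ereal_sup => _ [r' /= /andP[_ rr'] <-]; apply/le_perron/ltW. Qed.

Lemma lower_perron_ge_sqdist r x : 0 < r -> ((f x)%:E <= lower_perron r x)%E.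
Proof.
move=> r0; apply: le_trans (perron_ge n0 K z (r / 2) x) _; apply: lower_perron_ge; lra.
Qed.

(** As in the Perron method: if -h - e < perron r1 on the boundary of C, raising
upper_perron r3 to -h - e inside C gives a subharmonic function. It belongs to
the family of r4 when r3 < r4 < r and C is contained in the tube of r3, and
therefore it is at most lower_perron r. *)
Lemma lower_perron_superharmonic r : 0 < r -> subharmonic (tube r) (fun x => - lower_perron r x)%E.
Proof.
move=> r0; split.
- by move=> x _; rewrite lteNl; apply: lt_le_trans (lower_perron_ge_sqdist x r0); rewrite ltNyr.
- move=> x _ a; rewrite lteNl -EFinN => /lower_perron_gt[r' /andP[r'0 r'r] ea].
  apply: filterS (perron_near_gt r'r ea) => y H; rewrite lteNl.
  apply: lt_le_trans (H ((r' + r) / 2) (lexx _)) _; apply: lower_perron_ge; lra.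
move=> C h cC Ctube ch hh bd x Cx.
have chN : {within C, continuous (fun x => - h x)}.
  by move=> t; apply: (@continuousN _ _ (subspace C) h); exact: ch.
have [||||r2 /= /andP[r20 r2r] H2] := @compact_directed _ C R [set r' | 0 < r' < r]
  (fun i j => i <= j) tube cC.
- exists (r / 2) => /=; lra.
- by [].
- move=> i j /= /andP[i0 ir] /andP[j0 jr].
  exists (Num.max i j); first by rewrite lt_max i0 gt_max ir jr.
  by move=> l _; rewrite ge_max => /andP[].
- move=> y Cy; have [t Kt yt] := Ctube y Cy.
  have d0 : 0 < (r - `|y - t|) / 2 by lra.
  have t0 := normr_ge0 (y - t).
  exists ((r + `|y - t|) / 2); first by rewrite /=; lra.
  apply: filterS (near_dist y d0) => w wy j _ jr _; exists t => //.
  rewrite (_ : w - t = (y - t) + (w - y)); last by rewrite [RHS]addrC addrA subrK.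
  by apply: le_lt_trans (ler_normD _ _) _; lra.
apply/lee_addgt0Pr => e e0; rewrite -EFinD.
have [||||r1 /= /andP[r10 r1r] H1] := @compact_directed _ (C `\` C°) R [set r' | 0 < r' < r]
  (fun i j => i <= j) (fun r' y => ((- h y - e)%:E < perron r' y)%E) (boundary_compact cC).
- exists (r / 2) => /=; lra.
- by [].
- move=> i j /= /andP[i0 ir] /andP[j0 jr].
  exists (Num.max i j); first by rewrite lt_max i0 gt_max ir jr.
  by move=> l _; rewrite ge_max => /andP[].
- move=> y [Cy nCy].
  have hy : ((- h y - e)%:E < lower_perron r y)%E.
    apply: (@lt_le_trans _ _ (- h y)%:E); first by rewrite lte_fin; lra.
    by rewrite EFinN leeNl; exact: bd.
  have [r' /andP[r'0 rr'] ea] := lower_perron_gt hy; have [b bE] := perron_fin r' y.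
  move: ea; rewrite bE lte_fin => be.
  pose b' := (b - h y - e) / 2.
  have bb' : (b'%:E < perron r' y)%E by rewrite bE lte_fin /b'; lra.
  have hb : - h y < b' + e by rewrite /b'; lra.
  exists ((r' + r) / 2); first by rewrite /=; lra.
  apply: filterS2 (perron_near_gt rr' bb') (within_continuous_lt chN Cy hb) => t H3 H4 j rj /= jr [Ct _].
  by apply: lt_trans (H3 j jr); rewrite lte_fin; have := H4 Ct; lra.
pose r3 := Num.max r1 r2; pose r4 := (r3 + r) / 2.
have r3r : r3 < r by rewrite gt_max r1r r2r.
have r13 : r1 <= r3 by rewrite le_max lexx.
have r23 : r2 <= r3 by rewrite le_max lexx orbT.
pose g y := -1 * h y + - e.
have [Ch Lh] := hh.
have oC : open C° by exact: open_interior.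
have [Cc Lc] := @harmpoly_harmonic _ _ 0 C° _ (harmpoly_cst 0 (- e)).
have F4 : subsolutions r4 (glue C g (upper_perron r3)).
  split.
    apply: (subharmonic_glue n0 (upper_perron_subharmonic r3) cC).
    + rewrite (_ : g = fun y => - h y + - e); last by apply/funext => y; rewrite /g mulN1r.
      by apply: (within_addc chN); apply: continuous_subspaceT; exact: cst_continuous.
    + split; first exact: (C2_on_lin (-1) oC Ch Cc).
      by move=> y Cy; rewrite /g (laplacian_lin (-1) oC Cy Ch Cc) Lh// Lc// mulr0 addr0.
    + move=> y Cy; rewrite /g mulN1r; apply: le_trans (perron_le_upper r3 y).
      by apply: le_trans (le_perron _ _ _ r13); apply/ltW/H1.
  move=> y ny; rewrite glue_out; last first.
    by move=> /H2 ty; apply: ny; apply: tube_le ty; rewrite /r4; lra.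
  by apply: le_trans (upper_perron_le y (r' := r4) _) (perron_out ny); rewrite /r4; lra.
(* strictness of r4 < r is what makes the glued function count in lower_perron r *)
have H5 : ((g x)%:E <= lower_perron r x)%E.
  apply: le_trans (lower_perron_ge x (r' := r4) _); last by rewrite /r4; lra.
  by apply: le_trans (perron_ub x F4); rewrite glue_in// le_max lexx orbT.
rewrite leeNl -EFinN; apply: le_trans H5; rewrite lee_fin /g; lra.
Qed.

End EnvelopeRegularity.

(** * Fine neighbourhoods *)

Section Fine.
Context {R : realType} {n : nat} (n0 : (0 < n)%N).
Local Notation Rn := 'rV[R]_n.
Local Notation fineT := (fine_space R n).
Implicit Types (U V C S : set Rn) (f g h p q : Rn -> R) (u v s : Rn -> \bar R) (r : R).

Lemma fine_nbhs_preimage u (W : set (\bar R)) (x : Rn) : subharmonic setT u ->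
  nbhs (u x) W -> nbhs (x : fineT) (u @^-1` W).
Proof.
move=> su nW.
have [H _] := @cvg_sup Rn {w : Rn -> \bar R | subharmonic setT w}
  (fun w => Topological.class (initial_topology (proj1_sig w))) (nbhs (x : fineT)) x _.
have := H (fun A nA => nA) (exist _ u su); apply.
exact: (@initial_continuous _ _ u x _ nW).
Qed.

Lemma fine_nbhs_le (x : Rn) (A : set Rn) : nbhs x A -> nbhs (x : fineT) A.
Proof.
move=> nA; have /(eball_small (@open_interior _ A)) [r r0 rA] : A° x by [].
have H : nbhs (x : fineT) ((EFin \o sqdist x) @^-1` [set t | (t < r%:E)%E]).
  apply: fine_nbhs_preimage; first exact: sqdist_subharmonic.
  apply: open_nbhs_nbhs; split; first exact: open_ereal_lt_ereal.
  by rewrite /= sqdist_self lte_fin.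
apply: filterS H => y /=; rewrite lte_fin => yr.
exact: (@interior_subset _ A y (rA y (ltW yr))).
Qed.

(** The fine neighbourhoods of x, described by a single subharmonic function: a set
containing the part of {u > c} near x, where c < u x. *)
Definition fine_filter (x : Rn) : set_system Rn :=
  [set A | exists u c, [/\ subharmonic setT u, (c%:E < u x)%E &
    \forall y \near x, (c%:E < u y)%E -> A y]].

Lemma fine_filter_near (x : Rn) (A : set Rn) : nbhs x A -> fine_filter x A.
Proof.
move=> nA; exists (EFin \o (fun=> 0)), (-1); split.
- exact: harmpoly_subharmonic (harmpoly_cst 0 0).
- by rewrite lte_fin ltrN10.
- by apply: filterS nA => y Ay _.
Qed.

(** For the intersection of the traces of {u > c} and {v > d} take u + v. Near x the
functions u and v exceed their values at x by less than e, and so u + v cannot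
be close to its value at x unless both u and v are. *)
Lemma fine_filter_filter (x : Rn) : Filter (fine_filter x).
Proof.
split.
- by apply: fine_filter_near; exact: filterT.
- move=> A B [u [c [su cu uA]]] [v [d [sv dv vB]]].
  have [uoo uu _] := su; have [voo vu _] := sv.
  have := uoo x I; have := voo x I; move: (cu) (dv).
  case ux : (u x) => [a| |]//; case vx : (v x) => [b| |]// ca db _ _.
  rewrite !lte_fin in ca db.
  (* e is at most half of each of the margins a - c and b - d *)
  pose e := Num.min (a - c) (b - d) / 2.
  have m0 : 0 < Num.min (a - c) (b - d) by rewrite lt_min !subr_gt0 ca.
  have ea : Num.min (a - c) (b - d) <= a - c by rewrite ge_min lexx.
  have eb : Num.min (a - c) (b - d) <= b - d by rewrite ge_min lexx orbT.
  exists (u \+ v)%E, (a + b - e); split; first exact: subharmonicD openT su sv.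
    by rewrite /= ux vx -EFinD lte_fin /e; lra.
  have ua : (u x < (a + e)%:E)%E by rewrite ux lte_fin /e; lra.
  have vb : (v x < (b + e)%:E)%E by rewrite vx lte_fin /e; lra.
  have nu : \forall y \near x, (u y < (a + e)%:E)%E /\ (v y < (b + e)%:E)%E.
    exact: filterI (uu x I _ ua) (vu x I _ vb).
  have nAB : \forall y \near x, ((c%:E < u y)%E -> A y) /\ ((d%:E < v y)%E -> B y).
    exact: filterI uA vB.
  apply: filterS2 nu nAB => y [u1 v1] [uAy vBy] uv.
  have : (c%:E < u y)%E /\ (d%:E < v y)%E.
    move: u1 v1 uv => /=.
    case: (u y) => [a'| |]//; case: (v y) => [b'| |]//.
    by rewrite -EFinD !lte_fin /e => *; split; lra.
  by move=> [/uAy ? /vBy ?].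
- move=> A B AB [u [c [su cu uA]]]; exists u, c; split => //.
  by apply: filterS uA => y uy /uy /AB.
Qed.

(** The fine topology is generated by the preimages of open sets. The conditions
u < b are Euclidean open, so that only conditions u > c contribute; if u x is
-oo there is no such condition. *)
Lemma fine_nbhs_filter (x : Rn) (A : set Rn) : nbhs (x : fineT) A -> fine_filter x A.
Proof.
have FF := fine_filter_filter x.
have [_ H] := @cvg_sup Rn {w : Rn -> \bar R | subharmonic setT w}
  (fun w => Topological.class (initial_topology (proj1_sig w))) (fine_filter x) x FF.
apply: H => -[u su] B /=.
rewrite (@nbhsE (initial_topology u)) => -[_ [[W oW <-] Wx] WB].
have nW : nbhs (u x) W by exact: open_nbhs_nbhs.
have [uoo uu _] := su.
apply: (filterS WB); move: nW (uoo x I); case E : (u x) => [a| |]// nW _.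
  have [e e0 eW] : exists2 e : R, 0 < e & forall t, `|a - t| < e -> W t%:E.
    by have /nbhs_ballP[e /= e0 eW] : nbhs a (fun t => W t%:E) by []; exists e.
  exists u, (a - e); split => //; first by rewrite E lte_fin; lra.
  have ua : (u x < (a + e)%:E)%E by rewrite E lte_fin; lra.
  apply: filterS (uu x I _ ua) => y u1 u2 /=.
  move: u1 u2; case: (u y) => [t| |]//; rewrite !lte_fin => t1 t2.
  by apply: eW; rewrite ltr_norml; lra.
apply: fine_filter_near.
have [M [_ MW]] : nbhs (-oo)%E W by [].
have ua : (u x < M%:E)%E by rewrite E ltNyr.
by apply: filterS (uu x I _ ua) => y; exact: MW.
Qed.

(** A compact set is finely closed. *)
Lemma fine_boundaryE (K : set Rn) : compact K ->
  fine_boundary K = [set x | K x /\ ~ nbhs (x : fineT) K].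
Proof.
move=> cK; apply/seteqP; split => x [Kx nK]; split => //.
  apply: contrapT => nKx.
  have nC : nbhs (x : fineT) (~` K).
    apply: fine_nbhs_le; apply: open_near => //; apply: closed_openC.
    exact: compact_closed_rV.
  by have [y []] := Kx _ nC.
exact: subset_closure.
Qed.

End Fine.

(** * Jensen measures at points outside the fine interior *)

From mathcomp Require Import measurable_realfun.

Section Measure.
Context {R : realType} {n : nat} (n0 : (0 < n)%N).
Local Notation Rn := 'rV[R]_n.
Local Notation Bn := (@borel_space R n).
Implicit Types (U V C S : set Rn) (f g h p q : Rn -> R) (u v s : Rn -> \bar R) (r : R).

Lemma open_borel U : open U -> measurable (U : set Bn).
Proof. by move=> oU; exact: sub_sigma_algebra. Qed.

Lemma closed_borel U : closed U -> measurable (U : set Bn).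
Proof.
move=> cU; rewrite -(setCK U); apply: measurableC; apply: open_borel.
exact: closed_openC.
Qed.

Lemma usc_measurable U u : open U -> usc_on U u -> measurable_fun (U : set Bn) (u : g_sigma_algebraType (@open Rn) -> \bar R).
Proof.
move=> oU uscu; apply: (measurability _ (ErealGenInftyO.measurableE R)).
move=> _ [_ [a ->]] <-; apply: open_borel.
rewrite preimage_itvNyo openE => x [Ux /= ua].
by apply: filterS2 (open_near oU Ux) (uscu x Ux a ua) => y Uy uy; split.
Qed.

Lemma subharmonic_cst (c : R) U : subharmonic U (fun=> c%:E).
Proof.
apply: (subharmonicS (@subsetT _ U)).
exact: harmpoly_subharmonic (harmpoly_cst 0 c).
Qed.

Lemma jensen_total (mu : @borel_probability R n) U z : open U -> jensen_open U z mu ->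
  mu U = 1%E.
Proof.
move=> oU [_ _ /(_ _ (subharmonic_cst 1 U))]; rewrite integral_cst ?mul1e; last exact: open_borel.
by move=> H; apply/eqP; rewrite eq_le H andbT; apply: probability_le1; exact: open_borel.
Qed.

Lemma jensen_subset (K U : set Rn) z (mu : @borel_probability R n) : open U -> K `<=` U ->
  jensen K z mu -> jensen_open U z mu.
Proof. by move=> oU KU; apply; split. Qed.

(** The Jensen inequality for the subharmonic function -lower_perron on the tube,
where f <= lower_perron <= perron. *)
Lemma jensen_le_perron (K : set Rn) (z : Rn) (mu : @borel_probability R n) r : compact K -> 0 < r ->
  jensen K z mu ->
  (\int[mu]_(x in (tube K r : set Bn)) (sqdist z x)%:E <= perron K z r z)%E.
Proof.
move=> cK r0 Jmu.
have Jr := jensen_subset (@tube_open _ _ K r) (tube_sub r0) Jmu.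
have [_ _ /(_ _ (lower_perron_superharmonic n0 cK z r0))] := Jr.
have mT : measurable (tube K r : set Bn) by apply: open_borel; exact: tube_open.
have m0 x : (0 <= lower_perron K z r x)%E.
  by apply: le_trans (lower_perron_ge_sqdist n0 K z x r0); rewrite lee_fin sqdist_ge0.
rewrite integral_ge0N => [|x _]; last exact: m0.
rewrite leeN2 => H; apply: le_trans (lower_perron_le K z r z); apply: le_trans H.
have menv : measurable_fun (tube K r : set Bn) (lower_perron K z r).
  have [_ uscN _] := lower_perron_superharmonic n0 cK z r0.
  have := usc_measurable (@tube_open _ _ K r) uscN.
  move=> /(measurableT_comp (@oppe_measurable R setT)) /=.
  by apply: eq_measurable_fun => x _ /=; rewrite oppeK.
apply: ge0_le_integral => //.
- by move=> x _; rewrite lee_fin sqdist_ge0.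
- have [_ uscf _] := subharmonicS (@subsetT _ (tube K r)) (sqdist_subharmonic n0 z).
  exact: usc_measurable (@tube_open _ _ K r) uscf.
- by move=> x _; exact: lower_perron_ge_sqdist.
Qed.

Lemma sqdist_eq0 (z x : Rn) : sqdist z x = 0 -> x = z.
Proof.
move=> /eqP; rewrite /sqdist psumr_eq0 => [|i _]; last exact: sqr_ge0.
move=> /allP H; apply/matrixP => i j; rewrite ord1.
have := H j (mem_index_enum j); rewrite sqrf_eq0 subr_eq0 => /eqP ->.
by [].
Qed.

Lemma sqdist_ge_closed (z : Rn) (t : R) : closed [set x | t <= sqdist z x].
Proof.
have -> : [set x | t <= sqdist z x] = sqdist z @^-1` [set b | t <= b] by [].
apply: preimage_closed; first by move=> x _; exact: sqdist_continuous.
exact: closed_ge.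
Qed.

(** Chebyshev's inequality for f, whose integral is at most [perron] r z for all
r > 0. *)
Lemma jensen_outer (K : set Rn) (z : Rn) (mu : @borel_probability R n) (t : R) :
  compact K -> (upper_perron K z 0 z <= 0)%E -> jensen K z mu -> 0 < t ->
  mu [set x | t <= sqdist z x] = 0%E.
Proof.
move=> cK E0 Jmu t0; set A := [set x | _].
have mA : measurable (A : set Bn) by apply: closed_borel; exact: sqdist_ge_closed.
suff H : forall e : R, 0 < e -> (t%:E * mu A <= e%:E)%E.
  have : (t%:E * mu A <= 0)%E.
    by apply/lee_addgt0Pr => e e0; rewrite add0e; exact: H.
  rewrite pmule_rle0 ?lte_fin// => h.
  by apply/eqP; rewrite eq_le h measure_ge0.
move=> e e0.
have /upper_perron_lt[r r0 re] : (upper_perron K z 0 z < e%:E)%E by apply: le_lt_trans E0 _; rewrite lte_fin.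
have Jr := jensen_subset (@tube_open _ _ K r) (tube_sub r0) Jmu.
have mT : measurable (tube K r : set Bn) by apply: open_borel; exact: tube_open.
have T1 := jensen_total (@tube_open _ _ K r) Jr.
have TA : mu A = mu (A `&` tube K r).
  have TC : mu (A `\` tube K r) = 0%E.
    apply/eqP; rewrite eq_le measure_ge0 andbT.
    apply: (@le_trans _ _ (mu (~` tube K r : set Bn))).
      by apply: le_measure; rewrite ?inE;
        [exact: measurableD|exact: measurableC|move=> x []].
    by rewrite probability_setC// T1 subee.
  rewrite -{1}(setUIDK A (tube K r)) measureU//; last first.
  + by apply/seteqP; split => // x [[_ ?] [_]].
  + exact: measurableD.
  + exact: measurableI.
  by rewrite [X in (_ + X = _)%E]TC adde0.
have mAT : measurable (A `&` tube K r : set Bn) by exact: measurableI.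
rewrite TA -integral_cst//.
have mf : measurable_fun (tube K r : set Bn) (EFin \o sqdist z).
  have [_ uscf _] := subharmonicS (@subsetT _ (tube K r)) (sqdist_subharmonic n0 z).
  exact: usc_measurable (@tube_open _ _ K r) uscf.
have f0 x : (0 <= (sqdist z x)%:E)%E by rewrite lee_fin sqdist_ge0.
apply: (@le_trans _ _ (\int[mu]_(x in (A `&` tube K r : set Bn)) (sqdist z x)%:E)%E).
  apply: ge0_le_integral => //.
  - by move=> x _; rewrite lee_fin ltW.
  - by apply: measurable_funS mf => // x [].
  - by move=> x [Ax _]; rewrite lee_fin.
apply: le_trans (ltW re); apply: le_trans (jensen_le_perron cK r0 Jmu).
by apply: ge0_subset_integral => // x [].
Qed.

Lemma jensen_dirac (K : set Rn) (z : Rn) (mu : @borel_probability R n) :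
  compact K -> (upper_perron K z 0 z <= 0)%E -> jensen K z mu ->
  measure_eq mu (\d_(z : Bn)).
Proof.
move=> cK E0 Jmu.
pose A k := [set x : Rn | k.+1%:R^-1 <= sqdist z x].
have N0 : mu.-negligible (\bigcup_k A k : set Bn).
  apply: negligible_bigcup => k; apply/negligibleP.
    by apply: closed_borel; exact: sqdist_ge_closed.
  by apply: jensen_outer cK E0 Jmu _; rewrite invr_gt0.
have AE (x : Rn) : x <> z -> (\bigcup_k A k) x.
  move=> xz; have q0 : 0 < sqdist z x.
    by rewrite lt_def sqdist_ge0 andbT; apply/eqP => /sqdist_eq0.
  exists (Num.truncn (sqdist z x)^-1) => //; rewrite /A /=.
  rewrite -[leRHS]invrK lef_pV2 ?posrE ?invr_gt0//.
  exact: ltW (truncnS_gt _).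
have null S : measurable (S : set Bn) -> ~ S z -> mu S = 0%E.
  move=> mS Sz; apply/negligibleP => //; apply: negligibleS N0 => x Sx.
  by apply: AE => xz; apply: Sz; rewrite -xz.
move=> S mS; rewrite [RHS]diracE; have [Sz|Sz] := pselect (S z).
  rewrite mem_set//=.
  have := null (~` S) (measurableC mS) (fun H => H Sz).
  have /fineK <- : mu S \is a fin_num by exact: fin_num_measure.
  by rewrite probability_setC// -{1}[mu S]fineK ?fin_num_measure// -EFinB => -[] /eqP;
    rewrite subr_eq0 => /eqP <-.
by rewrite memNset//= null.
Qed.

Lemma dirac_jensen (K : set Rn) (z : Rn) (mu : @borel_probability R n) : K z ->
  measure_eq mu (\d_(z : Bn)) -> jensen K z mu.
Proof.
move=> Kz muE U [oU KU].
have Uz := KU z Kz.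
have supp : measure_support mu = [set z].
  apply/seteqP; split => x /=.
    move=> Sx; apply: contrapT => xz.
    have oV : open (~` [set z] : set Rn).
      by apply: closed_openC; apply: compact_closed_rV; exact: compact_set1.
    have := Sx (~` [set z]) (conj oV xz).
    rewrite muE; last exact: open_borel.
    rewrite [X in (_ < X)%E]diracE memNset//= ?ltxx//.
  move=> -> V [oV Vz]; rewrite muE; last exact: open_borel.
  by rewrite [X in (_ < X)%E]diracE mem_set//= lte01.
split.
- by rewrite supp; exact: compact_set1.
- by rewrite supp => x /= ->.
move=> f [_ uscf _].
rewrite (@eq_measure_integral _ _ _ _ (\d_(z : Bn))); last by move=> A mA _; exact: muE.
rewrite integral_dirac; [|exact: open_borel|exact: usc_measurable].
by rewrite [X in (_ <= X * _)%E]diracE mem_set//= mul1e.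
Qed.

End Measure.

(** * Linear functionals dominated by a sublinear functional *)

Section HahnBanach.
Context {R : realType} {V : lmodType R} (D : set V).
Hypothesis D0 : D 0.
Hypothesis DD : forall x y, D x -> D y -> D (x + y).
Hypothesis DZ : forall (t : R) x, D x -> D (t *: x).
Implicit Types p q : V -> R.

Definition sublinear_on p :=
  (forall x y, D x -> D y -> p (x + y) <= p x + p y) /\
  (forall t x, 0 < t -> D x -> p (t *: x) <= t * p x).

Lemma sublinear_homo p t x : sublinear_on p -> 0 < t -> D x -> p (t *: x) = t * p x.
Proof.
move=> [_ ph] t0 Dx; apply/eqP; rewrite eq_le ph//=.
rewrite mulrC -ler_pdivlMr//.
have {1}-> : x = t^-1 *: (t *: x) by rewrite scalerA mulVf ?scale1r// gt_eqF.
by rewrite mulrC; apply: ph; [rewrite invr_gt0|exact: DZ].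
Qed.

Lemma sublinear0 p : sublinear_on p -> p 0 = 0.
Proof.
move=> sp; have := sublinear_homo sp (ltr0Sn R 1) D0.
by rewrite scaler0; lra.
Qed.

Lemma sublinearN p x : sublinear_on p -> D x -> - p (- x) <= p x.
Proof.
move=> sp Dx; have DN : D (- x) by rewrite -scaleN1r; exact: DZ.
have := sp.1 _ _ Dx DN; rewrite subrr sublinear0//; lra.
Qed.

Lemma inf_le_lbound (E : set R) (b y : R) : lbound E b -> E y -> inf E <= y.
Proof. by move=> lb Ey; apply: ge_inf => //; exists b. Qed.

(** Zorn's lemma; the pointwise infimum of a chain is sublinear because two
elements of the chain can be replaced by the smaller one. *)
Lemma minimal_sublinear p : sublinear_on p -> exists q,
  [/\ sublinear_on q, forall x, D x -> q x <= p x &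
   forall q', sublinear_on q' -> (forall x, D x -> q' x <= q x) ->
     forall x, D x -> q x <= q' x].
Proof.
move=> sp; pose T := {q | sublinear_on q /\ forall x, D x -> q x <= p x}.
pose t0 : T := exist _ p (conj sp (fun x _ => lexx (p x))).
pose le (s t : T) := `[< forall x, D x -> sval t x <= sval s x >].
have [|||[q [sq qp]] qmin] := @ZL_preorder T t0 le.
- by move=> s; apply/asboolP.
- move=> s t u /asboolP st /asboolP tu; apply/asboolP => x Dx.
  exact: le_trans (tu x Dx) (st x Dx).
- move=> A tot; have [[a Aa]|A0] := pselect (A !=set0); last first.
    by exists t0 => s As; exfalso; apply: A0; exists s.
  pose E x := [set sval s x | s in A].
  have Elb x : D x -> lbound (E x) (- p (- x)).
    move=> Dx _ [[s [ss sp']] _ <-] /=.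
    have DN : D (- x) by rewrite -scaleN1r; exact: DZ.
    by apply: le_trans (sublinearN ss Dx); rewrite lerN2; exact: sp'.
  have qle s x : D x -> A s -> inf (E x) <= sval s x.
    by move=> Dx As; apply: inf_le_lbound (Elb x Dx) _; exists s.
  have qlt x (b : R) : D x -> inf (E x) < b -> exists2 s, A s & sval s x < b.
    move=> Dx ib; have hi : has_inf (E x).
      by split; [exists (sval a x); exists a|exists (- p (- x)); exact: Elb].
    have e0 : 0 < b - inf (E x) by rewrite subr_gt0.
    have [_ [s As <-] sb] := inf_adherent e0 hi.
    by exists s => //; move: sb; rewrite addrC subrK.
  pose q x := inf (E x).
  have sq : sublinear_on q.
    split => [x y Dx Dy|t x t0' Dx].
      apply/ler_addgt0Pr => e e0.
      have [s1 A1 h1] : exists2 s, A s & sval s x < q x + e / 2.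
        by apply: qlt => //; rewrite ltrDl divr_gt0.
      have [s2 A2 h2] : exists2 s, A s & sval s y < q y + e / 2.
        by apply: qlt => //; rewrite ltrDl divr_gt0.
      have [s As [g1 g2]] : exists2 s, A s & sval s x <= sval s1 x /\ sval s y <= sval s2 y.
        have [/asboolP H|/asboolP H] := tot s1 s2 A1 A2.
          by exists s2 => //; split => //; exact: H.
        by exists s1 => //; split => //; exact: H.
      apply: le_trans (qle s _ (DD Dx Dy) As) _.
      have [[ss _] _] := svalP s; have := ss x y Dx Dy; lra.
    apply/ler_addgt0Pr => e e0.
    have [s As h] : exists2 s, A s & sval s x < q x + e / t.
      by apply: qlt => //; rewrite ltrDl divr_gt0.
    apply: le_trans (qle s _ (DZ t Dx) As) _.
    have [[_ ss] _] := svalP s; apply: le_trans (ss t x t0' Dx) _.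
    have : t * sval s x <= t * (q x + e / t) by rewrite ler_pM2l// ltW.
    by rewrite mulrDr mulrCA divff ?mulr1// gt_eqF.
  have qp x : D x -> q x <= p x.
    by move=> Dx; apply: le_trans (qle a x Dx Aa) _; have [_] := svalP a; exact.
  exists (exist _ q (conj sq qp)) => s As; apply/asboolP => x Dx /=.
  exact: qle.
exists q; split => // q' sq' q'q x Dx.
have q'p y : D y -> q' y <= p y by move=> Dy; exact: le_trans (q'q y Dy) (qp y Dy).
pose t' : T := exist _ q' (conj sq' q'p).
have /qmin /asboolP : le (exist _ q (conj sq qp)) t' by apply/asboolP.
exact.
Qed.

(** The Hahn-Banach theorem, on a subspace D of V. A minimal sublinear q is linear:
for a in D, the infimum over t >= 0 of q(x + t a) - t q(a) is sublinear in x and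
at most q, hence equal to q by minimality. With t = 1 this says that
q(x) + q(a) <= q(x + a). *)
Theorem sublinear_dominates_linear p : sublinear_on p -> exists L : V -> R,
  [/\ forall x y, D x -> D y -> L (x + y) = L x + L y,
      forall t x, D x -> L (t *: x) = t * L x &
      forall x, D x -> L x <= p x].
Proof.
move=> /minimal_sublinear[q [sq qp qmin]].
have DN x : D x -> D (- x) by rewrite -scaleN1r => Dx; exact: DZ.
have q0 := sublinear0 sq.
have supadd a x : D a -> D x -> q x + q a <= q (x + a).
  move=> Da Dx.
  pose E x := [set q (x + t *: a) - t * q a | t in [set t : R | 0 <= t]].
  have qt t : 0 <= t -> q (t *: a) = t * q a.
    rewrite le_eqVlt => /orP[/eqP <-|t0]; last exact: sublinear_homo.
    by rewrite scale0r mul0r.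
  have Elb y : D y -> lbound (E y) (- q (- y)).
    move=> Dy _ [t /= t0 <-].
    have := sq.1 _ _ (DD Dy (DZ t Da)) (DN _ Dy).
    by rewrite addrAC subrr add0r qt//; lra.
  have qle y t : D y -> 0 <= t -> inf (E y) <= q (y + t *: a) - t * q a.
    by move=> Dy t0; apply: inf_le_lbound (Elb y Dy) _; exists t.
  have qlt y (b : R) : D y -> inf (E y) < b ->
      exists2 t, 0 <= t & q (y + t *: a) - t * q a < b.
    move=> Dy ib; have hi : has_inf (E y).
      split; last by exists (- q (- y)); exact: Elb.
      by exists (q (y + 0 *: a) - 0 * q a); exists 0 => //=.
    have e0 : 0 < b - inf (E y) by rewrite subr_gt0.
    have [_ [t t0 <-] sb] := inf_adherent e0 hi.
    by exists t => //; move: sb; rewrite [X in _ < X]addrC subrK.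
  have sE : sublinear_on (fun y => inf (E y)).
    split => [y w Dy Dw|s y s0 Dy]; apply/ler_addgt0Pr => e e0.
      have [t1 t10 h1] : exists2 t, 0 <= t & q (y + t *: a) - t * q a < inf (E y) + e / 2.
        by apply: qlt => //; rewrite ltrDl divr_gt0.
      have [t2 t20 h2] : exists2 t, 0 <= t & q (w + t *: a) - t * q a < inf (E w) + e / 2.
        by apply: qlt => //; rewrite ltrDl divr_gt0.
      apply: le_trans (qle _ (t1 + t2) (DD Dy Dw) (addr_ge0 t10 t20)) _.
      have := sq.1 _ _ (DD Dy (DZ t1 Da)) (DD Dw (DZ t2 Da)).
      by rewrite addrACA -scalerDl; lra.
    have [t t0 h] : exists2 t, 0 <= t & q (y + t *: a) - t * q a < inf (E y) + e / s.
      by apply: qlt => //; rewrite ltrDl divr_gt0.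
    have st0 : 0 <= s * t by rewrite mulr_ge0// ltW.
    apply: le_trans (qle _ (s * t) (DZ s Dy) st0) _.
    rewrite -scalerA -scalerDr (sublinear_homo sq s0) ?DD ?DZ//; last exact: DD Dy (DZ t Da).
    have : s * (q (y + t *: a) - t * q a) <= s * (inf (E y) + e / s) by rewrite ler_pM2l// ltW.
    by rewrite mulrBr mulrDr [s * (e / s)]mulrCA divff ?mulr1 ?gt_eqF// mulrA.
  have Eq y : D y -> inf (E y) <= q y.
    by move=> Dy; have := qle y 0 Dy (lexx 0); rewrite scale0r addr0 mul0r subr0.
  have := qmin _ sE Eq x Dx; have := qle x 1 Dx ler01.
  by rewrite scale1r mul1r; lra.
have add x y : D x -> D y -> q (x + y) = q x + q y.
  by move=> Dx Dy; apply/eqP; rewrite eq_le sq.1//= supadd.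
have opp x : D x -> q (- x) = - q x.
  by move=> Dx; have := add x (- x) Dx (DN x Dx); rewrite subrr q0; lra.
exists q; split => // t x Dx.
have [t0|t0|->] := ltgtP t 0; last by rewrite scale0r mul0r.
  rewrite -[t *: x]opprK -scaleNr opp; last exact: DZ.
  by rewrite (sublinear_homo sq)// ?oppr_gt0// mulNr opprK.
exact: sublinear_homo.
Qed.

End HahnBanach.

(** * From a positive functional to a probability measure *)

Section Riesz.
Context {R : realType} {n : nat}.
Local Notation Rn := 'rV[R]_n.
Local Notation Bn := (@borel_space R n).
Context (K : set Rn) (cK : compact K) (L : (Rn -> R) -> R).
Implicit Types (A B U V F : set Rn) (f g h : Rn -> R).

(** The domain of the functional L: all bounded functions on K rather than the
continuous ones, so that L applies to indicators and to the step functions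
below. Values off K are arbitrary. *)
Definition bounded_fun_on f := exists M, forall x, K x -> `|f x| <= M.

Hypothesis LD : forall f g, bounded_fun_on f -> bounded_fun_on g ->
  L (f + g) = L f + L g.
Hypothesis LZ : forall t f, bounded_fun_on f -> L (t *: f) = t * L f.
Hypothesis Lpos : forall f, bounded_fun_on f -> (forall x, K x -> 0 <= f x) -> 0 <= L f.
Hypothesis L1 : L (cst 1) = 1.

Lemma bounded_funD f g : bounded_fun_on f -> bounded_fun_on g -> bounded_fun_on (f + g).
Proof.
move=> [M HM] [N HN]; exists (M + N) => x Kx.
by apply: le_trans (ler_normD _ _) _; rewrite lerD ?HM ?HN.
Qed.

Lemma bounded_funZ t f : bounded_fun_on f -> bounded_fun_on (t *: f).
Proof.
move=> [M HM]; exists (`|t| * M) => x Kx.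
by rewrite /= normrM ler_wpM2l// HM.
Qed.

Lemma bounded_fun_indic A : bounded_fun_on (\1_A).
Proof. by exists 1 => x _; rewrite indicE; case: (x \in A); rewrite ?normr1 ?normr0. Qed.

Lemma bounded_fun_cst c : bounded_fun_on (cst c).
Proof. by exists `|c|. Qed.

Lemma Lmono f g : bounded_fun_on f -> bounded_fun_on g ->
  (forall x, K x -> f x <= g x) -> L f <= L g.
Proof.
move=> bf bg fg; rewrite -subr_ge0 -mulN1r -LZ// -LD//; last exact: bounded_funZ.
apply: Lpos; first by apply: bounded_funD => //; exact: bounded_funZ.
by move=> x Kx; rewrite /= scaleN1r subr_ge0 fg.
Qed.

(** A finitely additive probability on all the subsets, to be regularized. *)
Definition mass A := L (\1_A).
Local Notation m := mass.

Lemma mass_le A B : (forall x, K x -> A x -> B x) -> m A <= m B.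
Proof.
move=> AB; apply: Lmono; [exact: bounded_fun_indic|exact: bounded_fun_indic|] => x Kx.
rewrite !indicE; have [/set_mem Ax|_] := boolP (x \in A); last by rewrite ler0n.
by rewrite mem_set//; exact: AB.
Qed.

Lemma mass_ge0 A : 0 <= m A.
Proof. by apply: Lpos => [|x _]; [exact: bounded_fun_indic|rewrite indicE ler0n]. Qed.

Lemma massT : m setT = 1.
Proof. by rewrite /mass -[RHS]L1; congr (L _); apply/funext => x; rewrite indicE mem_set. Qed.

Lemma mass_setU A B : A `&` B = set0 -> m (A `|` B) = m A + m B.
Proof.
move=> AB; rewrite /mass -LD; [|exact: bounded_fun_indic|exact: bounded_fun_indic].
congr (L _); apply/funext => x; rewrite -[RHS]/(\1_A x + \1_B x) !indicE in_setU.
have [/set_mem Ax|_] := boolP (x \in A); last by rewrite /= mulr0n add0r.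
rewrite memNset /= ?mulr0n ?addr0// => Bx.
by have : (A `&` B) x by []; rewrite AB.
Qed.

Lemma mass_setC A : m (~` A) = 1 - m A.
Proof. by rewrite -massT -(setUv A) mass_setU ?setICr//; ring. Qed.

Lemma mass_bigcup (F : nat -> set Rn) k A : (forall x, K x -> A x -> exists2 i, (i < k)%N & F i x) ->
  m A <= \sum_(i < k) m (F i).
Proof.
elim: k A => [|k IH] A AF.
  rewrite big_ord0; apply: le_trans (mass_le (B := set0) _) _.
    by move=> x Kx /(AF x Kx)[].
  rewrite (_ : set0 = ~` setT); last by rewrite setCT.
  by rewrite mass_setC massT subrr.
rewrite big_ord_recr /=.
have -> : A = (A `\` F k) `|` (A `&` F k) by rewrite setUC setUIDK.
rewrite mass_setU; last by apply/seteqP; split => // x [[_ nF] [_ /nF]].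
apply: lerD; last by apply: mass_le => x _ [].
apply: IH => x Kx [Ax nFk]; have [i] := AF x Kx Ax.
rewrite ltnS leq_eqVlt => /orP[/eqP -> //|ik Fi]; by exists i.
Qed.

(** Inner regularity on open sets, then outer regularity. As the masses are only
finitely additive, inner_mass V may be smaller than mass V for V open; it
follows that the measure obtained is larger than mass on closed sets. *)
Definition inner_mass V : \bar R := ereal_sup [set (m F)%:E | F in [set F | compact F /\ F `<=` V]].
Definition outer_mass A : \bar R := ereal_inf [set inner_mass V | V in [set V | open V /\ A `<=` V]].

Lemma inner_mass_ub F V : compact F -> F `<=` V -> ((m F)%:E <= inner_mass V)%E.
Proof. by move=> cF FV; apply: ereal_sup_ubound; exists F. Qed.

Lemma inner_mass_le V (b : \bar R) : (forall F, compact F -> F `<=` V -> ((m F)%:E <= b)%E) -> (inner_mass V <= b)%E.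
Proof. by move=> H; apply: ge_ereal_sup => _ [F [cF FV] <-]; exact: H. Qed.

Lemma inner_mass_mono V W : V `<=` W -> (inner_mass V <= inner_mass W)%E.
Proof. by move=> VW; apply: inner_mass_le => F cF FV; apply: inner_mass_ub => // x /FV /VW. Qed.

Lemma inner_mass_ge0 V : (0 <= inner_mass V)%E.
Proof.
apply: (@le_trans _ _ (m set0)%:E); first by rewrite lee_fin mass_ge0.
by apply: inner_mass_ub => //; exact: compact0.
Qed.

Lemma inner_mass_le_mass V : (inner_mass V <= (m V)%:E)%E.
Proof. by apply: inner_mass_le => F _ FV; rewrite lee_fin mass_le// => x _ /FV. Qed.

Lemma inner_massT : inner_mass setT = 1%E.
Proof.
apply/eqP; rewrite eq_le; apply/andP; split.
  by apply: le_trans (inner_mass_le_mass _) _; rewrite massT.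
apply: le_trans (inner_mass_ub cK (@subsetT _ _)); rewrite lee_fin -massT.
exact: mass_le.
Qed.

Lemma outer_mass_open V : open V -> outer_mass V = inner_mass V.
Proof.
move=> oV; apply/eqP; rewrite eq_le; apply/andP; split.
  by apply: ereal_inf_lbound; exists V => //; split.
by apply: le_ereal_inf_tmp => _ [W [oW VW] <-]; exact: inner_mass_mono.
Qed.

Lemma outer_mass_le A V : open V -> A `<=` V -> (outer_mass A <= inner_mass V)%E.
Proof. by move=> oV AV; apply: ereal_inf_lbound; exists V => //; split. Qed.

Lemma outer_mass_mono A B : A `<=` B -> (outer_mass A <= outer_mass B)%E.
Proof.
move=> AB; apply: le_ereal_inf_tmp => _ [W [oW BW] <-].
by apply: outer_mass_le => // x /AB /BW.
Qed.

Lemma outer_mass_ge0 A : (0 <= outer_mass A)%E.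
Proof. by apply: le_ereal_inf_tmp => _ [W _ <-]; exact: inner_mass_ge0. Qed.

Lemma outer_mass_lt A (b : \bar R) : (outer_mass A < b)%E ->
  exists V, [/\ open V, A `<=` V & (inner_mass V < b)%E].
Proof. by move=> /ereal_inf_lt[_ [V [oV AV] <-]] h; exists V. Qed.

Lemma outer_mass_le1 A : (outer_mass A <= 1)%E.
Proof. by rewrite -inner_massT; apply: outer_mass_le => //; exact: openT. Qed.

Lemma outer_mass_fin A : outer_mass A \is a fin_num.
Proof.
by rewrite ge0_fin_numE ?outer_mass_ge0//; apply: le_lt_trans (outer_mass_le1 A) _; rewrite ltry.
Qed.

Lemma outer_mass0 : outer_mass set0 = 0%E.
Proof.
apply/eqP; rewrite eq_le outer_mass_ge0 andbT outer_mass_open; last exact: open0.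
apply: le_trans (inner_mass_le_mass _) _.
by rewrite lee_fin -setCT mass_setC massT subrr.
Qed.

(** By a Lebesgue number argument a compact subset F of the union is the union of
finitely many closed sets G i contained in the V i. *)
Lemma inner_mass_bigcup (V : nat -> set Rn) : (forall i, open (V i)) ->
  (inner_mass (\bigcup_i V i) <= \sum_(i <oo) inner_mass (V i))%E.
Proof.
move=> oV; apply: inner_mass_le => F cF FV.
have near_cov := (compact_near_coveringP F).1 cF.
pose P k (x : Rn) := exists2 i, (i < k)%N & ball x k.+1%:R^-1 `<=` V i.
have [k _ kP] : \forall k \near \oo, F `<=` P k.
  apply: near_cov => x Fx; have [i _ Vix] := FV x Fx.
  have /nbhs_ballP[e /= e0 eV] := open_near (oV i) Vix.
  exists (ball x (e / 2), [set k | (maxn i.+1 (Num.truncn (2 / e)) <= k)%N]).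
    split; first by apply: nbhsx_ballx; rewrite divr_gt0.
    by exists (maxn i.+1 (Num.truncn (2 / e))).
  move=> [y k] /= [xy]; rewrite geq_max => /andP[ik tk].
  exists i => // t yt; apply: eV.
  rewrite (splitr e); apply: ball_triangle xy _; apply: le_ball yt.
  have h : 2 / e < k.+1%:R by apply: lt_le_trans (truncnS_gt _) _; rewrite ler_nat.
  have e2 : 0 < e / 2 by rewrite divr_gt0.
  by rewrite -[leRHS]invrK lef_pV2 ?posrE ?invr_gt0// invf_div ltW.
have {}kP := kP k (leqnn k).
pose G i := F `&` [set x | ball x k.+1%:R^-1 `<=` V i].
have cG i : compact (G i).
  apply: compact_closedI => //; rewrite -[X in closed X]setCK; apply: open_closedC.
  rewrite openE => x /= nx.
  have [y [xy nVy]] : exists y, ball x k.+1%:R^-1 y /\ ~ V i y.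
    apply: contrapT => H; apply: nx => y xy; apply: contrapT => nV; apply: H.
    by exists y.
  have : \forall z \near x, ball y k.+1%:R^-1 z.
    by apply: open_near; [exact: ball_open|exact: ball_sym].
  by apply: filterS => z yz /= H; apply/nVy/H/ball_sym.
apply: (@le_trans _ _ (\sum_(i < k) inner_mass (V i))%E).
  apply: (@le_trans _ _ (\sum_(i < k) m (G i))%:E).
    rewrite lee_fin; apply: mass_bigcup => x _ Fx; have [i ik iV] := kP x Fx.
    by exists i.
  rewrite -sumEFin; apply: lee_sum => i _; apply: inner_mass_ub => // x [_] /=.
  by apply; exact: ballxx.
rewrite -(big_mkord xpredT (fun i => inner_mass (V i))).
by apply: nneseries_lim_ge => i *; exact: inner_mass_ge0.
Qed.

Lemma outer_mass_sigma_subadditive : sigma_subadditive outer_mass.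
Proof.
move=> A; apply/lee_addgt0Pr => e e0.
apply: le_trans (epsilon_trick _ (fun i => outer_mass_ge0 (A i)) (ltW e0)).
have H i : exists V, [/\ open V, A i `<=` V &
    (inner_mass V < outer_mass (A i) + (e / (2 ^ i.+1)%:R)%:E)%E].
  by apply: outer_mass_lt; rewrite lteDl ?outer_mass_fin// lte_fin divr_gt0//.
have [V HV] := choice H.
apply: (@le_trans _ _ (inner_mass (\bigcup_i V i))).
  apply: outer_mass_le; first by apply: bigcup_open => i _; have [] := HV i.
  by move=> x [i _ Aix]; exists i => //; have [_ AV _] := HV i; exact: AV.
apply: le_trans (inner_mass_bigcup _) _; first by move=> i; have [] := HV i.
apply: lee_nneseries => i _ *; first exact: inner_mass_ge0.
by have [_ _ /ltW] := HV i.
Qed.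

Let outerM : {outer_measure set Rn -> \bar R} :=
  HB.pack outer_mass (isOuterMeasure.Build R Rn outer_mass outer_mass0 outer_mass_ge0
    outer_mass_mono outer_mass_sigma_subadditive).

Lemma compact_setD_open F V : compact F -> open V -> compact (F `\` V).
Proof. by move=> cF oV; rewrite setDE; apply: compact_closedI => //; exact: open_closedC. Qed.

(** Enclose A in an open set W, then choose compact sets F in W /\ V and G in W \ F
of almost full inner mass. They are disjoint and contained in W, while A \ V is
contained in W \ F. *)
Lemma open_caratheodory V : open V -> outerM.-caratheodory V.
Proof.
move=> oV; apply: le_caratheodory_measurable => A.
change (outer_mass (A `&` V) + outer_mass (A `&` ~` V) <= outer_mass A)%E.
apply/lee_addgt0Pr => e e0; pose d := e / 3.
have d0 : 0 < d by rewrite divr_gt0.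
have [W [oW AW We]] : exists W, [/\ open W, A `<=` W & (inner_mass W < outer_mass A + d%:E)%E].
  by apply: outer_mass_lt; rewrite lteDl ?outer_mass_fin// lte_fin.
have inner_mass_fin U : inner_mass U \is a fin_num.
  rewrite ge0_fin_numE ?inner_mass_ge0//; apply: le_lt_trans (inner_mass_mono (@subsetT _ U)) _.
  by rewrite inner_massT ltry.
have inner_mass_gt U : exists F, [/\ compact F, F `<=` U & (inner_mass U < (m F + d)%:E)%E].
  have : (inner_mass U - d%:E < inner_mass U)%E by rewrite lteBlDr// lteDl// lte_fin.
  move=> /ereal_sup_gt[_ [F [cF FU] <-]] h; exists F; split => //.
  by rewrite EFinD -lteBlDr.
have [F [cF FWV hF]] := inner_mass_gt (W `&` V).
have oWF : open (W `\` F).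
  by rewrite setDE; apply: openI => //; apply: closed_openC; exact: compact_closed_rV.
have [G [cG GWF hG]] := inner_mass_gt (W `\` F).
have h1 : (outer_mass (A `&` V) <= inner_mass (W `&` V))%E.
  by apply: outer_mass_le; [exact: openI|move=> x [/AW]].
have h2 : (outer_mass (A `&` ~` V) <= inner_mass (W `\` F))%E.
  by apply: outer_mass_le => // x [/AW Wx nVx]; split => // /FWV[].
have h3 : ((m F + m G)%:E <= inner_mass W)%E.
  rewrite -mass_setU; last first.
    by apply/seteqP; split => // x [Fx /GWF[_ /(_ Fx)]].
  apply: inner_mass_ub; first exact: compactU.
  by move=> x [/FWV[]|/GWF[]].
have h4 := leeD (le_trans h1 (ltW hF)) (le_trans h2 (ltW hG)).
apply: le_trans h4 _.
have := le_lt_trans h3 We; rewrite -(fineK (outer_mass_fin A)) -!EFinD lte_fin lee_fin.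
rewrite /d; lra.
Qed.

Lemma borel_caratheodory : (@measurable _ Bn) `<=` outerM.-caratheodory.
Proof.
apply: smallest_sub; last exact: open_caratheodory.
split.
- exact: caratheodory_measurable_set0.
- by move=> A mA; rewrite setTD; exact: caratheodory_measurable_setC.
- by move=> F mF; exact: caratheodory_measurable_bigcup.
Qed.

(** For F closed, the measure of the open complement is its inner mass and hence at
most its mass. *)
Theorem dominating_probability : exists mu : @borel_probability R n,
  forall F, closed F -> ((m F)%:E <= mu F)%E.
Proof.
have sadd : semi_sigma_additive (outer_mass : set Bn -> \bar R).
  move=> F mF tF mUF.
  apply: (@caratheodory_measure_sigma_additive R Rn outerM) => //.
    by move=> i; exact: (borel_caratheodory (mF i)).
  exact: borel_caratheodory.
pose M := isMeasure.Build _ Bn R (outer_mass : set Bn -> \bar R) outer_mass0 outer_mass_ge0 sadd.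
pose mu0 : {measure set Bn -> \bar R} := HB.pack (outer_mass : set Bn -> \bar R) M.
have muT : mu0 setT = 1%E.
  by change (outer_mass setT = 1%E); rewrite outer_mass_open ?inner_massT//; exact: openT.
pose mu : @borel_probability R n := HB.pack (Measure.sort mu0)
   (Measure_isProbability.Build _ _ _ mu0 muT).
exists mu => F cF.
have mC : measurable (~` F : set Bn) by apply: open_borel; exact: closed_openC.
have -> : mu F = (1 - mu (~` F))%E by rewrite -[in LHS](setCK F) probability_setC.
have : (mu (~` F) <= (m (~` F))%:E)%E.
  change (outer_mass (~` F) <= (m (~` F))%:E)%E.
  by rewrite outer_mass_open; [exact: inner_mass_le_mass|exact: closed_openC].
have /fineK <- := fin_num_measure mu _ mC.
by rewrite mass_setC -EFinB !lee_fin; lra.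
Qed.

End Riesz.

(** * Integrals of upper semicontinuous functions *)

Section LayerCake.
Context {R : realType} {n : nat}.
Local Notation Rn := 'rV[R]_n.
Local Notation Bn := (@borel_space R n).
Context (K : set Rn) (cK : compact K) (L : (Rn -> R) -> R).
Implicit Types (A B U V F : set Rn) (f g h phi : Rn -> R).
Local Notation bdd := (bounded_fun_on K).

Hypothesis LD : forall f g, bdd f -> bdd g -> L (f + g) = L f + L g.
Hypothesis LZ : forall t f, bdd f -> L (t *: f) = t * L f.
Hypothesis Lpos : forall f, bdd f -> (forall x, K x -> 0 <= f x) -> 0 <= L f.
Hypothesis L1 : L (cst 1) = 1.
Local Notation m := (mass L).

Context (mu : @borel_probability R n).
Hypothesis mum : forall F, closed F -> ((m F)%:E <= mu F)%E.

Lemma measurable_K : measurable (K : set Bn).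
Proof. by apply: closed_borel; exact: compact_closed_rV. Qed.

Lemma mu_K : mu K = 1%E.
Proof.
apply/eqP; rewrite eq_le (probability_le1 mu measurable_K)/=.
apply: le_trans (mum (compact_closed_rV cK)); rewrite lee_fin -(massT L1).
by apply: (mass_le LD LZ Lpos).
Qed.

Context (U : set Rn) (u : Rn -> \bar R) (oU : open U) (KU : K `<=` U)
  (uscu : usc_on U u) (M : R) (M0 : 0 <= M) (uM : forall x, K x -> (u x <= M%:E)%E).
Let w x : \bar R := (M%:E - u x)%E.

Lemma w_ge0 x : K x -> (0 <= w x)%E.
Proof.
move=> Kx; rewrite /w; have := uM Kx; case: (u x) => [r| |].
- by rewrite -EFinB !lee_fin subr_ge0.
- by [].
- by move=> _; exact: leey.
Qed.

Lemma measurable_u : measurable_fun (U : set Bn) u.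
Proof. exact: usc_measurable. Qed.

Lemma measurable_w : measurable_fun (K : set Bn) w.
Proof.
apply: emeasurable_funB; first exact: measurable_cst.
by apply: measurable_funS measurable_u => //; exact: open_borel.
Qed.

Definition layer (a : R) : set Rn := K `&` [set x | (a%:E < w x)%E].

(** In K the layer {w > a} is the trace of an open set since u is upper
semicontinuous, and so its complement in K is closed.
There mu is at least the mass, and both have total mass 1 on K. *)
Lemma layer_mass a : (mu (layer a) <= (m (layer a))%:E)%E.
Proof.
pose V : set Rn := U `&` [set x | (u x < (M - a)%:E)%E].
have oV : open V.
  rewrite openE => x [Ux ua].
  by apply: filterS2 (open_near oU Ux) (uscu Ux ua) => y Uy uy; split.
have lE : layer a = K `&` V.
  have E x : (a%:E < w x)%E = (u x < (M - a)%:E)%E.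
    rewrite /w; case: (u x) => [r| |] /=.
    - by rewrite -EFinB !lte_fin; apply/idP/idP; lra.
    - by rewrite addeNy.
    - by rewrite ?ltNyr ?ltry.
  apply/seteqP; split => x [Kx]; rewrite /= ?E => h.
    by split => //; split => //; exact: KU.
  by split => //=; rewrite E; case: h.
have cC : closed (K `\` V) by apply: compact_closed_rV; exact: compact_setD_open.
have mKV : measurable (K `&` V : set Bn).
  by apply: measurableI; [exact: measurable_K|exact: open_borel].
have h1 : mu K = (mu (K `&` V) + mu (K `\` V))%E.
  rewrite -measureU//; first by rewrite setUIDK.
    exact: closed_borel.
  by apply/seteqP; split => // x [[_ ?] [_]].
have h2 : m (K `\` V) = 1 - m (K `&` V).
  apply/eqP; rewrite eq_sym subr_eq -(mass_setU LD); last first.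
    by apply/seteqP; split => // x [[_ nV] [_ /nV]].
  rewrite setUC setUIDK -(massT L1) eq_le !(mass_le LD LZ Lpos)//.
have := mum cC; rewrite h2 => h3; rewrite lE.
have := h1; rewrite mu_K -(fineK (fin_num_measure mu _ mKV)).
move: h3; have /fineK <- := fin_num_measure mu _ (closed_borel cC).
by rewrite -EFinD => + []; rewrite !lee_fin; lra.
Qed.

(** The lower Riemann sum, with N steps of size d, of the layer cake formula for w. *)
Definition layer_sum (d : R) (N : nat) (x : Rn) : R :=
  \sum_(j < N) d * \1_(layer (j.+1%:R * d)) x.

Lemma layer_sum_recr d N : layer_sum d N.+1 = layer_sum d N + d *: (\1_(layer (N.+1%:R * d)) : Rn -> R).
Proof. by apply/funext => x; rewrite /layer_sum big_ord_recr. Qed.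

Lemma layer_sumS d N x : layer_sum d N.+1 x = layer_sum d N x + d * \1_(layer (N.+1%:R * d)) x.
Proof. by rewrite /layer_sum big_ord_recr. Qed.

Lemma layer_sum_ge0 d N x : 0 <= d -> 0 <= layer_sum d N x.
Proof. by move=> d0; apply: sumr_ge0 => j _; rewrite mulr_ge0// indicE ler0n. Qed.

Lemma layer_sum_le d N x : 0 <= d -> layer_sum d N x <= N%:R * d.
Proof.
move=> d0; elim: N => [|N IH]; first by rewrite /layer_sum big_ord0 mul0r.
rewrite layer_sumS -[in leRHS]natr1 mulrDl mul1r.
apply: lerD; first exact: IH.
by rewrite indicE; case: (_ \in _); rewrite /= ?mulr1// mulr0.
Qed.

Lemma layer_sum_bdd d N : 0 <= d -> bdd (layer_sum d N).
Proof.
by move=> d0; exists (N%:R * d) => x _; rewrite ger0_norm ?layer_sum_ge0// layer_sum_le.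
Qed.

Lemma layer_sum_le_w d N x : 0 <= d -> K x -> ((layer_sum d N x)%:E <= w x)%E.
Proof.
move=> d0 Kx; elim: N => [|N IH]; first by rewrite /layer_sum big_ord0 w_ge0.
rewrite layer_sumS indicE.
have [/set_mem [_ /= lx]|_] := boolP (x \in layer (N.+1%:R * d)).
  apply: le_trans (ltW lx); rewrite lee_fin mulr1 -natr1 mulrDl mul1r.
  by rewrite lerD2r layer_sum_le.
by rewrite mulr0n mulr0 addr0.
Qed.

Lemma layer_sum_top d N x : 0 <= d -> K x -> ((N%:R * d)%:E < w x)%E -> layer_sum d N x = N%:R * d.
Proof.
move=> d0 Kx Nx; rewrite /layer_sum.
transitivity (\sum_(j < N) d); last by rewrite sumr_const card_ord mulr_natl.
apply: eq_bigr => j _; rewrite indicE mem_set ?mulr1//; split => //=.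
apply: le_lt_trans Nx; rewrite lee_fin ler_wpM2r// ler_nat.
exact: ltn_ord.
Qed.

Lemma min_w_layer_sum d N x : 0 <= d -> K x ->
  (mine (w x) (N%:R * d)%:E <= (layer_sum d N x + d)%:E)%E.
Proof.
move=> d0 Kx; elim: N => [|N IH].
  rewrite /layer_sum big_ord0 add0r mul0r ge_min lee_fin d0 orbT//.
have [wN|wN] := leP (w x) (N%:R * d)%:E.
  rewrite min_l; last first.
    by apply: le_trans wN _; rewrite lee_fin ler_wpM2r// ler_nat.
  move: IH; rewrite min_l// => h; apply: le_trans h _; rewrite lee_fin lerD2r.
  rewrite layer_sumS.
  by rewrite lerDl mulr_ge0// indicE ler0n.
rewrite ge_min; apply/orP; right; rewrite lee_fin -natr1 mulrDl mul1r lerD2r.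
rewrite -(layer_sum_top d0 Kx wN).
rewrite layer_sumS.
by rewrite lerDl mulr_ge0// indicE ler0n.
Qed.

Lemma layer_measurable a : measurable (layer a : set Bn).
Proof.
have := measurable_w measurable_K (emeasurable_itv `]a%:E, +oo[).
by rewrite preimage_itvoy.
Qed.

Lemma layer_sum_measurable d N : measurable_fun (K : set Bn) (EFin \o layer_sum d N).
Proof.
apply/measurable_EFinP; elim: N => [|N IH].
  rewrite (_ : layer_sum d 0 = cst 0); first exact: measurable_cst.
  by apply/funext => x; rewrite /layer_sum big_ord0.
rewrite layer_sum_recr; apply: measurable_funD => //; apply: measurable_funM => //.
exact: measurable_indic (layer_measurable _).
Qed.

Lemma integral_layer_sum d N : 0 <= d ->
  (\int[mu]_(x in (K : set Bn)) (layer_sum d N x)%:E <= (L (layer_sum d N))%:E)%E.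
Proof.
move=> d0; elim: N => [|N IH].
  rewrite integral0_eq ?lee_fin.
    by apply: Lpos; [exact: layer_sum_bdd|move=> x _; exact: layer_sum_ge0].
  by move=> x _; rewrite /layer_sum big_ord0.
under eq_integral => x _ do rewrite layer_sumS EFinD.
rewrite layer_sum_recr LD; [|exact: layer_sum_bdd|exact: bounded_funZ (bounded_fun_indic _ _)].
rewrite LZ; last exact: bounded_fun_indic.
rewrite ge0_integralD; last 5 first.
- exact: measurable_K.
- by move=> x _; rewrite lee_fin layer_sum_ge0.
- exact: layer_sum_measurable.
- by move=> x _; rewrite lee_fin mulr_ge0// indicE ler0n.
- apply/measurable_EFinP; apply: measurable_funM => //.
  exact: measurable_indic (layer_measurable _).
rewrite EFinD; apply: leeD; first exact: IH.
under eq_integral => x _ do rewrite EFinM.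
rewrite ge0_integralZl_EFin//; last 2 first.
- exact: measurable_K.
- by apply/measurable_EFinP; exact: measurable_indic (layer_measurable _).
rewrite integral_indic; [|exact: measurable_K|exact: layer_measurable].
rewrite EFinM; apply: lee_wpmul2l; first by rewrite lee_fin.
rewrite (_ : layer _ `&` K = layer (N.+1%:R * d)); first exact: layer_mass.
by apply/seteqP; split => x [] // Kx lx; split.
Qed.

Context (c : R).
Hypothesis Lc : forall phi, bdd phi -> (forall x, K x -> (u x <= (phi x)%:E)%E) -> c <= L phi.

Lemma integral_layer_sum_le d N : 0 <= d ->
  (\int[mu]_(x in (K : set Bn)) (layer_sum d N x)%:E <= (M - c)%:E)%E.
Proof.
move=> d0; apply: le_trans (integral_layer_sum N d0) _; rewrite lee_fin.
have bs := layer_sum_bdd N d0.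
have bN : bdd (M *: cst 1 + (-1) *: layer_sum d N).
  by apply: bounded_funD; apply: bounded_funZ => //; exact: bounded_fun_cst.
have : c <= L (M *: cst 1 + (-1) *: layer_sum d N).
  apply: Lc => // x Kx; have := layer_sum_le_w N d0 Kx; rewrite /w.
  rewrite -[(_ + _) x]/(M * 1 + -1 * layer_sum d N x).
  case: (u x) => [r| |].
  - by rewrite -EFinB !lee_fin; lra.
  - by [].
  - by move=> _; exact: leNye.
rewrite LD; [|by apply: bounded_funZ; exact: bounded_fun_cst|exact: bounded_funZ].
rewrite (LZ _ bs) LZ; last exact: bounded_fun_cst.
by rewrite L1; lra.
Qed.

Lemma integral_min_w (T : nat) :
  (\int[mu]_(x in (K : set Bn)) mine (w x) T%:R%:E <= (M - c)%:E)%E.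
Proof.
apply/lee_addgt0Pr => e e0.
(* N steps of size e reach the height T *)
pose N := (Num.truncn (T%:R / e)).+1.
have TN : T%:R <= N%:R * e.
  by rewrite -ler_pdivrMr// ltW// truncnS_gt.
have mint d N' : measurable_fun (K : set Bn) (fun x => mine (w x) (N'%:R * d)%:E).
  by apply: measurable_mine; [exact: measurable_w|exact: measurable_cst].
apply: (@le_trans _ _ (\int[mu]_(x in (K : set Bn)) ((layer_sum e N x)%:E + e%:E))%E).
  apply: ge0_le_integral.
  - exact: measurable_K.
  - by move=> x Kx; rewrite le_min w_ge0//= lee_fin.
  - by apply: measurable_mine; [exact: measurable_w|exact: measurable_cst].
  - apply: emeasurable_funD; [exact: layer_sum_measurable|exact: measurable_cst].
  - move=> x Kx; apply: le_trans (min_w_layer_sum N (ltW e0) Kx).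
    by rewrite le_min ge_min lexx/= ge_min lee_fin TN orbT.
rewrite ge0_integralD; last 5 first.
- exact: measurable_K.
- by move=> x _; rewrite lee_fin layer_sum_ge0// ltW.
- exact: layer_sum_measurable.
- by move=> x _; rewrite lee_fin ltW.
- exact: measurable_cst.
apply: leeD; first exact: integral_layer_sum_le (ltW e0).
rewrite integral_cst; last exact: measurable_K.
by rewrite [X in (_ * X)%E]mu_K mule1.
Qed.

Lemma integral_w_le : (\int[mu]_(x in (K : set Bn)) w x <= (M - c)%:E)%E.
Proof.
rewrite (eq_integral ((fun x : Rn => limn (fun T : nat => mine (w x) T%:R%:E)) : Bn -> \bar R)); last first.
  move=> x /set_mem Kx; apply/esym/cvg_lim => //.
  have := w_ge0 Kx; case: (w x) => [r| |]// _.
    apply: cvg_near_cst; exists (Num.truncn r).+1 => // k /= rk.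
    rewrite min_l// lee_fin; apply: le_trans (ltW (truncnS_gt r)) _.
    by rewrite ler_nat.
  apply/cvgeryP/cvgryPge => A; exists (Num.truncn A).+1 => // k /= Ak.
  apply: le_trans (ltW (truncnS_gt A)) _.
  by rewrite ler_nat.
rewrite monotone_convergence; last 4 first.
- exact: measurable_K.
- by move=> T; apply: measurable_mine; [exact: measurable_w|exact: measurable_cst].
- by move=> T x Kx; rewrite le_min w_ge0//= lee_fin.
- move=> x Kx i j ij; rewrite le_min ge_min lexx/= ge_min lee_fin.
  by rewrite ler_nat ij orbT.
apply: lime_le; last by apply: nearW => T; exact: integral_min_w.
apply: ereal_nondecreasing_is_cvgn => i j ij; apply: ge0_le_integral.
- exact: measurable_K.
- by move=> x Kx; rewrite le_min w_ge0//= lee_fin.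
- by apply: measurable_mine; [exact: measurable_w|exact: measurable_cst].
- by apply: measurable_mine; [exact: measurable_w|exact: measurable_cst].
- move=> x Kx; rewrite le_min ge_min lexx/= ge_min lee_fin.
  by rewrite ler_nat ij orbT.
Qed.

(** Let w = M - u on K. Its lower layer sums have integrals at most their value
under L, by [layer_mass], and M minus such a sum is a bounded majorant of u, so
that its value under L is at least c. Thus the integral of w is at most M - c. *)
Theorem integral_ge : (c%:E <= \int[mu]_(x in (U : set Bn)) u x)%E.
Proof.
have mU : measurable (U : set Bn) by exact: open_borel.
have mN : measurable (U `\` K : set Bn) by apply: measurableD => //; exact: measurable_K.
have N0 : mu (U `\` K) = 0%E.
  apply/eqP; rewrite eq_le measure_ge0 andbT.
  apply: (@le_trans _ _ (mu (~` K : set Bn))).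
    by apply: le_measure; rewrite ?inE;
      [exact: mN|apply: measurableC; exact: measurable_K|move=> x []].
  rewrite probability_setC; last exact: measurable_K.
  by rewrite [X in (_ - X)%E]mu_K subee.
have UK : U `\` (U `\` K) = K.
  by rewrite setDD setIidr.
have restr (g : Rn -> \bar R) : measurable_fun (U : set Bn) g -> (forall x, (0 <= g x)%E) ->
    (\int[mu]_(x in (U : set Bn)) g x = \int[mu]_(x in (K : set Bn)) g x)%E.
  move=> mg g0; rewrite (ge0_negligible_integral mN mU mg _ N0).
    exact: (congr1 (fun D : set Bn => \int[mu]_(x in D) g x)%E UK).
  by move=> x _; exact: g0.
have mpos : measurable_fun (U : set Bn) (u^\+)%E by apply: measurable_funepos; exact: measurable_u.
have mneg : measurable_fun (U : set Bn) (u^\-)%E by apply: measurable_funeneg; exact: measurable_u.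
have mposK : measurable_fun (K : set Bn) (u^\+)%E by exact: measurable_funS mpos.
have mnegK : measurable_fun (K : set Bn) (u^\-)%E by exact: measurable_funS mneg.
rewrite integralE (restr _ mpos) ?(restr _ mneg)//.
set A := integral _ _ _; set B := integral _ _ _.
have A0 : (0 <= A)%E by exact: integral_ge0.
have B0 : (0 <= B)%E by exact: integral_ge0.
have AM : (A <= M%:E)%E.
  have -> : M%:E = (\int[mu]_(x in (K : set Bn)) (cst M%:E) x)%E.
    by rewrite integral_cst; [rewrite [X in (_ * X)%E]mu_K mule1|exact: measurable_K].
  apply: ge0_le_integral => //; first exact: measurable_K.
  move=> x Kx; rewrite funeposE ge_max lee_fin M0 andbT; exact: uM.
have W0 : (0 <= \int[mu]_(x in (K : set Bn)) w x)%E.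
  by apply: integral_ge0 => x; exact: w_ge0.
have E : (M%:E + B = \int[mu]_(x in (K : set Bn)) w x + A)%E.
  have -> : M%:E = (\int[mu]_(x in (K : set Bn)) (cst M%:E) x)%E.
    by rewrite integral_cst; [rewrite [X in (_ * X)%E]mu_K mule1|exact: measurable_K].
  rewrite -ge0_integralD; last 5 first.
  - exact: measurable_K.
  - by move=> x _; rewrite lee_fin.
  - exact: measurable_cst.
  - by [].
  - exact: mnegK.
  rewrite -ge0_integralD; last 5 first.
  - exact: measurable_K.
  - by move=> x; exact: w_ge0.
  - exact: measurable_w.
  - by [].
  - exact: mposK.
  apply: eq_integral => x /set_mem Kx; rewrite funeposE funenegE /w /=.
  have := uM Kx; case: (u x) => [r _| |_].
  - rewrite -EFinB -EFinN -!EFin_max -!EFinD; congr EFin.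
    by rewrite /Num.max; case: ifPn; case: ifPn; lra.
  - by [].
  - by rewrite /= max_l ?leey// max_r ?leNye//= adde0.
move: E integral_w_le A0 B0 AM W0.
case: (integral mu (K : set Bn) w) => [wr| |]//; case: A => [a| |]//; case: B => [b| |]//.
by rewrite -!(EFinD, EFinN) !lee_fin => -[]; lra.
Qed.

End LayerCake.

(** * A bound for subharmonic functions at a fine interior point *)

Section Existence.
Context {R : realType} {n : nat} (n0 : (0 < n)%N).
Local Notation Rn := 'rV[R]_n.
Local Notation fineT := (fine_space R n).
Local Notation Bn := (@borel_space R n).
Implicit Types (U V C S : set Rn) (h p q phi : Rn -> R) (u v s f : Rn -> \bar R) (r : R).

Lemma tube_in_open (K V : set Rn) : compact K -> open V -> K `<=` V ->
  exists2 r, 0 < r & tube K r `<=` V.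
Proof.
move=> cK oV KV.
have [||||r r0 rP] := @compact_directed _ K R [set r | 0 < r] (fun i j => j <= i)
  (fun r x => forall y : Rn, `|y - x| < r -> V y) cK.
- by exists 1; rewrite /=.
- by [].
- move=> i j /= i0 j0; exists (Num.min i j); first by rewrite lt_min i0 j0.
  by move=> l _; rewrite le_min => /andP[].
- move=> x Kx; have /nbhs_ballP[e /= e0 eV] := open_near oV (KV x Kx).
  have e2 : 0 < e / 2 by rewrite divr_gt0.
  exists (e / 2) => //.
  apply: filterS (near_dist x e2) => y yx j j0 je _ t ty; apply: eV.
  rewrite ball_rV (_ : t - x = (t - y) + (y - x)); last by rewrite addrA subrK.
  by apply: le_lt_trans (ler_normD _ _) _; lra.
by exists r => // x [y Ky xy]; exact: rP xy.
Qed.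

Lemma closure_tube (K : set Rn) r : 0 < r -> closure (tube K (r / 2)) `<=` tube K r.
Proof.
move=> r0 x /(_ _ (near_dist x (divr_gt0 r0 (ltr0Sn R 1)))) [y [[t Kt yt] yx]].
exists t => //; rewrite (_ : x - t = - (y - x) + (y - t)); last first.
  by rewrite opprB addrA subrK.
apply: le_lt_trans (ler_normD _ _) _; rewrite normrN; move: yx => /=; lra.
Qed.

Lemma closure_tube_compact (K : set Rn) r : compact K -> compact (closure (tube K r)).
Proof.
move=> cK; have [B [_ BK]] := compact_bounded cK.
have B1 : B < `|B| + 1 by have := ler_norm B; lra.
apply: bounded_closed_compact; last exact: closed_closure.
exists (`|B| + 2 + `|r|); split; first by rewrite num_real.
move=> M hM x /(_ _ (near_dist x ltr01)) [y [[t Kt yt] yx]].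
apply: le_trans (ltW hM); have := BK _ B1 t Kt.
have -> : x = - (y - x) + (y - t) + t by rewrite opprB addrA subrK subrK.
have := ler_normD (- (y - x) + (y - t)) t; have := ler_normD (- (y - x)) (y - t).
rewrite normrN; have := ler_norm r; move: yx => /=; lra.
Qed.

(** Let w = max(u - c, 0), which vanishes off K in a ball B about z of squared radius
r2, and let w <= M0 on B. For tau = t r2 / M0 the subharmonic function
f + tau w is at most M + d on the boundary of the intersection of B with a small
neighbourhood of K: where w = 0 since f + t |x - z|^2 <= M + d near K, and on
the sphere since there tau w <= t r2 = t |x - z|^2. At z this gives
f(z) + tau w(z) <= M + d, so e = w(z) r2 / M0 works, whatever f, t and M are. *)
Lemma fine_interior_bound (K : set Rn) (z : Rn) : compact K -> nbhs (z : fineT) K ->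
  exists2 e : R, 0 < e & forall U f t M, open U -> K `<=` U -> subharmonic U f -> 0 <= t ->
    (forall x, K x -> (f x + (t * sqdist z x)%:E <= M%:E)%E) ->
    (f z + (t * e)%:E <= M%:E)%E.
Proof.
move=> cK nK; have Kz : K z := nbhs_singleton nK.
have [u [c [su cu uK]]] := fine_nbhs_filter n0 nK.
pose w x := maxe (u x + (- c)%:E)%E 0%:E.
have sw : subharmonic setT w by apply: subharmonic_max; [exact: subharmonic_addcst|exact: subharmonic_cst].
have [woo wu _] := sw.
have w0 x : (0 <= w x)%E by rewrite /w le_max lexx orbT.
have [r2 r20 rB] : exists2 r2, 0 < r2 & forall x, eball z r2 x -> (c%:E < u x)%E -> K x.
  pose A : set Rn := [set x | (c%:E < u x)%E -> K x].
  have [r2 r20 rB] := eball_small (@open_interior _ A) (uK : A° z).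
  by exists r2 => // x Bx; exact: (interior_subset (rB x Bx)).
have wK x : eball z r2 x -> (0 < w x)%E -> K x.
  move=> Bx; rewrite /w lt_max ltxx orbF EFinN sube_gt0; exact: (rB x Bx).
have wz0 : (0 < w z)%E by rewrite /w lt_max EFinN sube_gt0 cu.
have /fineK : w z \is a fin_num by rewrite gt0_fin_numE// woo.
set a := fine _ => aE; have a0 : 0 < a by rewrite -lte_fin aE.
have [M1 M1P] := usc_bounded (eball_compact (x0 := z) (r2 := r2))
  (usc_on_within (@subsetT _ _) wu) (fun x _ => woo x I).
pose M0 := `|M1| + 1; have M00 : 0 < M0 by rewrite /M0 ltr_pwDr.
have wM x : eball z r2 x -> (w x <= M0%:E)%E.
  by move=> /M1P h; apply: le_trans h _; rewrite lee_fin /M0; have := ler_norm M1; lra.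
exists (a * r2 / M0) => [|U f t M oU KU sf t0 fM]; first by rewrite divr_gt0// mulr_gt0.
have [foo fu _] := sf.
have [->|tn0] := eqVneq t 0.
  by rewrite mul0r; have := fM z Kz; rewrite sqdist_self mulr0.
have tp : 0 < t by rewrite lt_neqAle eq_sym tn0.
(* the largest multiple of w which t |x - z|^2 majorizes on the sphere *)
pose tau := t * r2 / M0; have tau0 : 0 < tau by rewrite divr_gt0// mulr_gt0.
have sg : subharmonic U (fun x => f x + tau%:E * w x)%E.
  by apply: (subharmonicD n0 oU sf); apply: subharmonic_scale => //; exact: subharmonicS (@subsetT _ U) sw.
apply/lee_addgt0Pr => d d0; rewrite -EFinD.
pose V : set Rn := U `&` [set x | (f x + (t * sqdist z x)%:E < (M + d)%:E)%E].
have cq : {within U, continuous (fun x => t * sqdist z x)}.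
  apply: continuous_subspaceT => x.
  by apply: (@continuousM _ _ (cst t) (sqdist z) x); [exact: cst_continuous|exact: sqdist_continuous].
have oV : open V.
  rewrite openE => x [Ux ux].
  have UU : U `<=` U by [].
  have := usc_add (usc_on_within UU fu) (within_cont_usc cq) foo (fun x _ => ltry _) Ux ux.
  by move=> H; apply: filterS2 (open_near oU Ux) H => y Uy /(_ Uy).
have KV : K `<=` V.
  move=> x Kx; split; first exact: KU.
  by apply: le_lt_trans (fM x Kx) _; rewrite lte_fin; lra.
have [rho rho0 tV] := tube_in_open cK oV KV.
pose N := closure (tube K (rho / 2)).
have NV : N `<=` V by move=> x /(closure_tube rho0); exact: tV.
have cN : compact N by exact: closure_tube_compact.
have KN : K `<=` N°.
  move=> x Kx; have rho2 : 0 < rho / 2 by rewrite divr_gt0.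
  apply: filterS (open_near (@tube_open _ _ K (rho / 2)) (tube_sub rho2 Kx)).
  exact: subset_closure.
pose C := eball z r2 `&` N.
have cC : compact C by apply: compact_closedI => //; [exact: eball_compact|exact: closed_closure].
have CU : C `<=` U by move=> x [_ /NV[]].
have bd x : (C `\` C°) x -> (f x + tau%:E * w x <= (M + d)%:E)%E.
  move=> [[Bx Nx]]; rewrite interiorI => nC.
  have [_ /= fx] := NV _ Nx; apply: le_trans (ltW fx); apply: leeD => //.
  have [wx|wx] := ltP 0%E (w x); last first.
    have -> : w x = 0%E by apply/eqP; rewrite eq_le wx w0.
    by rewrite mule0 lee_fin mulr_ge0// sqdist_ge0.
  have -> : sqdist z x = r2.
    by apply: eball_boundary; split => // Bi; apply: nC; split => //; exact/KN/wK.
  apply: (@le_trans _ _ (tau%:E * M0%:E)%E).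
    by apply: lee_wpmul2l; [rewrite lee_fin ltW|exact: wM].
  by rewrite -EFinM lee_fin /tau mulfVK// gt_eqF.
have Cz : C z by split; [exact: eball_center (ltW r20)|exact: (@interior_subset _ N z (KN z Kz))].
have := subharmonic_le_cst sg cC CU bd Cz; rewrite -aE -EFinM.
by rewrite /tau (_ : t * r2 / M0 * a = t * (a * r2 / M0))//; field; rewrite gt_eqF.
Qed.

End Existence.

(** * Jensen measures at fine interior points, and the theorem *)

Section Functional.
Context {R : realType} {n : nat} (n0 : (0 < n)%N).
Local Notation Rn := 'rV[R]_n.
Local Notation fineT := (fine_space R n).
Local Notation Bn := (@borel_space R n).
Context (K : set Rn) (cK : compact K) (z : Rn) (Kz : K z) (e : R).
Implicit Types (U V C S : set Rn) (h p q phi psi : Rn -> R) (u v s f : Rn -> \bar R) (r c : R).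
Local Notation bdd := (bounded_fun_on K).

Hypothesis bound : forall U f t M, open U -> K `<=` U -> subharmonic U f -> 0 <= t ->
    (forall x, K x -> (f x + (t * sqdist z x)%:E <= M%:E)%E) ->
    (f z + (t * e)%:E <= M%:E)%E.

(** The values which L phi has to exceed: L should be positive and normalized, be
at least f(z) on f subharmonic near K, and be at least e on |x - z|^2. Finite
values are recorded as bounds c since f z may be -oo. *)
Definition minorants phi : set R := [set c | exists U f t,
  [/\ open U, K `<=` U & subharmonic U f] /\
  [/\ 0 <= t, forall x, K x -> (f x + (t * sqdist z x)%:E <= (phi x)%:E)%E &
      (c%:E <= f z + (t * e)%:E)%E]].

Lemma minorants_cst phi c : (forall x, K x -> c <= phi x) -> minorants phi c.
Proof.
move=> H; exists setT, (fun=> c%:E), 0; split; split => //.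
- exact: openT.
- exact: subharmonic_cst.
- by move=> x Kx; rewrite mul0r adde0 lee_fin H.
- by rewrite mul0r adde0.
Qed.

Lemma minorants_subharmonic U f phi c : open U -> K `<=` U -> subharmonic U f ->
  (forall x, K x -> (f x <= (phi x)%:E)%E) -> (c%:E <= f z)%E -> minorants phi c.
Proof.
move=> oU KU sf fphi cf; exists U, f, 0; split; split => //.
- by move=> x Kx; rewrite mul0r adde0 fphi.
- by rewrite mul0r adde0.
Qed.

Lemma minorants_sqdist phi : (forall x, K x -> sqdist z x <= phi x) -> minorants phi e.
Proof.
move=> H; exists setT, (fun=> 0%:E), 1; split; split => //.
- exact: openT.
- exact: subharmonic_cst.
- by move=> x Kx; rewrite mul1r add0e lee_fin H.
- by rewrite mul1r add0e.
Qed.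

(** The hypothesis [bound], that is, the conclusion of [fine_interior_bound], says
that the requirements on L are compatible: L phi is never required to
exceed an upper bound of |phi| on K. *)
Lemma minorants_ub phi M c : (forall x, K x -> `|phi x| <= M) -> minorants phi c -> c <= M.
Proof.
move=> HM [U [f [t [[oU KU sf] [t0 fphi cf]]]]]; rewrite -lee_fin.
apply: le_trans cf _; apply: (bound oU KU sf t0) => x Kx.
apply: le_trans (fphi x Kx) _; rewrite lee_fin.
by apply: le_trans (ler_norm _) _; exact: HM.
Qed.

Lemma minorantsD phi psi b c : minorants phi b -> minorants psi c ->
  minorants (phi + psi) (b + c).
Proof.
move=> [U [f [t [[oU KU sf] [t0 fphi bf]]]]] [V [g [s [[oV KV sg] [s0 gpsi cg]]]]].
have oUV : open (U `&` V) by exact: openI.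
exists (U `&` V), (f \+ g)%E, (t + s); split; split => //.
- by move=> x Kx; split; [exact: KU|exact: KV].
- by apply: (subharmonicD n0 oUV); [exact: subharmonicS sf|exact: subharmonicS sg].
- exact: addr_ge0.
- move=> x Kx; rewrite /= mulrDl !EFinD addeACA.
  by apply: leeD; [exact: fphi|exact: gpsi].
- by rewrite /= mulrDl !EFinD addeACA; exact: leeD.
Qed.

Lemma minorantsZ phi r c : 0 < r -> minorants phi c -> minorants (r *: phi) (r * c).
Proof.
move=> r0 [U [f [t [[oU KU sf] [t0 fphi cf]]]]].
have E (y : \bar R) b : (r%:E * y + (r * b)%:E = r%:E * (y + b%:E))%E.
  by rewrite EFinM muleDr// fin_num_adde_defl.
exists U, (fun x => r%:E * f x)%E, (r * t); split; split => //.
- exact: subharmonic_scale.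
- by rewrite mulr_ge0// ltW.
- move=> x Kx; rewrite -mulrA E -[(r *: phi) x]/(r * phi x) [leRHS]EFinM.
  by apply: lee_wpmul2l; [rewrite lee_fin ltW|exact: fphi].
- by rewrite -mulrA E [leLHS]EFinM; apply: lee_wpmul2l; [rewrite lee_fin ltW|].
Qed.

Definition envelope phi := sup (minorants phi).

Lemma envelope_ub phi c : bdd phi -> minorants phi c -> c <= envelope phi.
Proof. by move=> [M HM] mc; apply: ub_le_sup => //; exists M => b; exact: minorants_ub. Qed.

Lemma envelope_le phi b : bdd phi -> (forall c, minorants phi c -> c <= b) -> envelope phi <= b.
Proof.
move=> [M HM] H; apply: ge_sup => //; exists (- M); apply: minorants_cst => x Kx.
by have := HM x Kx; rewrite ler_norml => /andP[].
Qed.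

Lemma bounded_funN phi : bdd phi -> bdd (- phi).
Proof. by move=> [M HM]; exists M => x Kx; rewrite normrN HM. Qed.

Lemma envelope_sublinear : sublinear_on bdd (fun phi => - envelope (- phi)).
Proof.
split => [phi psi bphi bpsi|t phi t0 bphi].
  have b1 := bounded_funN bphi; have b2 := bounded_funN bpsi.
  rewrite -opprD lerN2 -lerBrDr; apply: envelope_le => // c mc.
  rewrite lerBrDl -lerBrDr; apply: envelope_le => // b mb.
  rewrite lerBrDr addrC; apply: envelope_ub; first by rewrite opprD; exact: bounded_funD.
  by rewrite opprD; exact: minorantsD.
have b1 := bounded_funN bphi.
rewrite mulrN lerN2 mulrC -ler_pdivlMr//; apply: envelope_le => // c mc.
rewrite ler_pdivlMr// mulrC; apply: envelope_ub; first by rewrite -scalerN; exact: bounded_funZ.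
by rewrite -scalerN; exact: minorantsZ.
Qed.

Lemma exists_functional : exists L : (Rn -> R) -> R,
  [/\ forall phi psi, bdd phi -> bdd psi -> L (phi + psi) = L phi + L psi,
      forall t phi, bdd phi -> L (t *: phi) = t * L phi &
      forall phi c, bdd phi -> minorants phi c -> c <= L phi].
Proof.
have [|||L [LD LZ LQ]] := sublinear_dominates_linear _ _ _ envelope_sublinear.
- by exists 0 => x _; rewrite normr0.
- by move=> phi psi; exact: bounded_funD.
- by move=> t phi; exact: bounded_funZ.
exists L; split => // phi c bphi mc.
have bN := bounded_funN bphi.
have := LQ _ bN; rewrite opprK -scaleN1r LZ// mulN1r lerN2.
by apply: le_trans; exact: envelope_ub.
Qed.

(** The functional dominates all minorants, and [integral_ge] transfers this from
the functional to integrals. *)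
Theorem exists_jensen : exists mu : @borel_probability R n,
  jensen K z mu /\ (e%:E <= \int[mu]_(x in (setT : set Bn)) (sqdist z x)%:E)%E.
Proof.
have [L [LD LZ Lm]] := exists_functional.
have Lpos phi : bdd phi -> (forall x, K x -> 0 <= phi x) -> 0 <= L phi.
  by move=> bphi phi0; apply: Lm => //; exact: minorants_cst.
have L1 : L (cst 1) = 1.
  have b1 : bdd (cst 1) := bounded_fun_cst K 1.
  apply/eqP; rewrite eq_le; apply/andP; split; last by apply: Lm => //; exact: minorants_cst.
  rewrite -lerN2 -[leRHS]mulN1r -LZ//; apply: Lm; first exact: bounded_funZ.
  by apply: minorants_cst => x _; rewrite -[leRHS]/(-1 * 1) mulr1.
have [mu mum] := dominating_probability cK LD LZ Lpos L1.
have muK1 := mu_K cK LD LZ Lpos L1 mum.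
have cvxK U f c : open U -> K `<=` U -> usc_on U f -> (forall x, K x -> (f x < +oo)%E) ->
    (forall phi, bdd phi -> (forall x, K x -> (f x <= (phi x)%:E)%E) -> minorants phi c) ->
    (c%:E <= \int[mu]_(x in (U : set Bn)) f x)%E.
  move=> oU KU uscf foo Hc.
  have [M MP] := usc_bounded cK (usc_on_within KU uscf) foo.
  have M0 : 0 <= `|M| by [].
  apply: (integral_ge cK LD LZ Lpos L1 mum oU KU uscf M0).
    by move=> x Kx; apply: le_trans (MP x Kx) _; rewrite lee_fin ler_norm.
  by move=> phi bphi fphi; apply: Lm => //; exact: Hc.
have suppK : measure_support mu `<=` K.
  move=> x Sx; apply: contrapT => nKx.
  have oV : open (~` K) by apply: closed_openC; exact: compact_closed_rV.
  have := Sx (~` K) (conj oV nKx).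
  by rewrite probability_setC ?muK1 ?subee ?ltxx//; exact: measurable_K.
exists mu; split; last first.
  have [_ uscq _] := sqdist_subharmonic n0 z.
  apply: cvxK => //; [exact: openT|by move=> x _; rewrite ltry|].
  by move=> phi _ H; apply: minorants_sqdist => x Kx; have := H x Kx; rewrite lee_fin.
move=> U [oU KU]; split.
- apply: (subclosed_compact _ cK suppK).
  rewrite -[X in closed X]setCK; apply: open_closedC; rewrite openE => x nSx.
  have [V [oV Vx] V0] : exists2 V : set Rn, open_nbhs x V & ~ (0 < mu V)%E.
    by apply: contrapT => H; apply: nSx => V oV; apply: contrapT => V0; apply: H; exists V.
  apply: filterS (open_near oV Vx) => y Vy Sy; exact: V0 (Sy V (conj oV Vy)).
- by move=> x /suppK /KU.
- move=> f sf; have [foo uscf _] := sf.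
  have := foo z (KU z Kz); case E : (f z) => [r| |]// _; last exact: leNye.
  apply: cvxK => // [x /KU|phi _ fphi]; first exact: foo.
  by apply: (minorants_subharmonic oU KU sf fphi); rewrite E.
Qed.

End Functional.

Section Main.
Context {R : realType} {n : nat} (n0 : (0 < n)%N).
Local Notation Rn := 'rV[R]_n.
Local Notation fineT := (fine_space R n).
Local Notation Bn := (@borel_space R n).

(** Otherwise {upper_perron 0 > c} /\ {f < c} is a fine neighbourhood of z for some
c > 0. It is contained in K because upper_perron 0 <= f off K. *)
Lemma upper_perron_le0 (K : set Rn) (z : Rn) : compact K -> ~ nbhs (z : fineT) K ->
  (upper_perron K z 0 z <= 0)%E.
Proof.
move=> cK nK; rewrite leNgt; apply/negP => E0; apply: nK.
have [c c0 cE] : exists2 c : R, 0 < c & (c%:E < upper_perron K z 0 z)%E.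
  move: E0; case: (upper_perron K z 0 z) => [b| |]//.
    by rewrite lte_fin => b0; exists (b / 2); rewrite ?lte_fin; lra.
  by move=> _; exists 1 => //; rewrite ltry.
have n1 : nbhs (z : fineT) (upper_perron K z 0 @^-1` [set y | (c%:E < y)%E]).
  apply: (fine_nbhs_preimage (upper_perron_subharmonic n0 cK z 0)); apply: open_nbhs_nbhs.
  by split; [exact: open_ereal_gt_ereal|].
have n2 : nbhs (z : fineT) ((EFin \o sqdist z) @^-1` [set y | (y < c%:E)%E]).
  apply: (fine_nbhs_preimage (sqdist_subharmonic n0 z)); apply: open_nbhs_nbhs.
  by split; [exact: open_ereal_lt_ereal|rewrite /= sqdist_self lte_fin].
apply: filterS2 n1 n2 => x /= h1 h2; apply: contrapT => nKx.
have [r r0 rK] : exists2 r, 0 < r & ~ tube K r x.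
  have oC : open (~` K) by apply: closed_openC; exact: compact_closed_rV.
  have /nbhs_ballP[r /= r0 rP] := open_near oC nKx.
  exists r => // -[y Ky xy]; apply: (rP y) Ky; rewrite ball_rV distrC//.
have := le_lt_trans (le_trans (upper_perron_le K z x r0) (perron_out z rK)) h2.
by move=> /(lt_trans h1); rewrite ltxx.
Qed.

Lemma jensen_not_dirac (K : set Rn) (z : Rn) : compact K -> nbhs (z : fineT) K ->
  exists2 mu : @borel_probability R n, jensen K z mu & ~ measure_eq mu (\d_(z : Bn)).
Proof.
move=> cK nK; have Kz : K z := nbhs_singleton nK.
have [e e0 He] := fine_interior_bound n0 cK nK.
have [mu [Jmu emu]] := exists_jensen n0 cK Kz He.
exists mu => // muE; move: emu.
rewrite (@eq_measure_integral _ _ _ _ (\d_(z : Bn))); last by move=> A mA _; exact: muE.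
rewrite integral_dirac//; last first.
  have [_ uscq _] := sqdist_subharmonic n0 z.
  exact: (usc_measurable openT uscq).
by rewrite sqdist_self mule0 lee_fin leNgt e0.
Qed.

End Main.

Theorem lemma5p1 (R : realType) (n : nat) (hn : (2 <= n)%N)
    (K : set 'rV[R]_n) (hK : compact K) :
  choquet_boundary K = fine_boundary K.
Proof.
have n0 : (0 < n)%N by exact: ltnW.
rewrite fine_boundaryE//; apply/seteqP; split => z [Kz].
  move=> JE; split => // nK.
  have [mu Jmu] := jensen_not_dirac n0 hK nK.
  by move: Jmu; rewrite JE.
move=> nK; split => //.
apply/seteqP; split => mu; last exact: dirac_jensen.
by apply: jensen_dirac => //; exact: upper_perron_le0.
Qed.
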